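(* Let $\hat{\mathcal O}\subset\mathbb R^n$ be a bounded connected Lipschitz domain, let $F\hat x=x_0+B\hat x$ with $x_0\in\mathbb R^n$ and $B\in\mathbb R^{n\times n}$ invertible, and let $\mathcal O=F(\hat{\mathcal O})$. Let $k(s,\hat{\mathcal O})$, $K(s,\hat{\mathcal O})$, $C_{\rm PF,SS}(s,\hat{\mathcal O})$, $C_{\rm PF,I}(s,\hat{\mathcal O})$ be the constants on $\hat{\mathcal O}$ described in the context. Then the following hold for every $s\in(0,1)$ and every $v\in H^s(\mathcal O)$. (i) The semi-norms $|\cdot|_{s,\mathcal O}$ and $|\cdot|_{L^2(\mathcal O),H^1(\mathcal O),s}$ are uniformly equivalent for a family of shape-regular domains $\mathcal O$: $$|v|_{s,\mathcal O}^2\le\rho_{\mathcal O}^{n+2s}\rho_{\hat{\mathcal O}}^{n+2s}K(s,\hat{\mathcal O})^2\Bigl(3+\frac{C_{\rm PF,I}(s,\hat{\mathcal O})^2}{s(1-s)}\Bigr)|v|_{L^2(\mathcal O),H^1(\mathcal O),s}^2,$$ $$|v|_{L^2(\mathcal O),H^1(\mathcal O),s}^2\le\rho_{\mathcal O}^{n+2s}\rho_{\hat{\mathcal O}}^{n+2s}k(s,\hat{\mathcal O})^{-2}\Bigl(1+C_{\rm PF,SS}(s,\hat{\mathcal O})^2\Bigr)|v|_{s,\mathcal O}^2.$$ (ii) The semi-norms $|\cdot|_{s,\mathcal O}$ and $|\cdot|_{s,\mathcal O,\inf}$ are uniformly equivalent for a family of uniformly bounded, shape-regular domains $\mathcal O$: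 $$|v|_{s,\mathcal O}\le|v|_{s,\mathcal O,\inf},\qquad |v|_{s,\mathcal O,\inf}^2\le\Bigl(1+\frac{D_{\mathcal O}^{2s}}{D_{\hat{\mathcal O}}^{2s}}\,\rho_{\mathcal O}^n\,\rho_{\hat{\mathcal O}}^{n+2s}\,C_{\rm PF,SS}(s,\hat{\mathcal O})^2\Bigr)|v|_{s,\mathcal O}^2.$$ (iii) a) For a family of shape-regular domains $\mathcal O$ whose diameters are bounded from below by a positive constant, $|\cdot|_{L^2(\mathcal O),H^1(\mathcal O),s}$ is uniformly bounded by $|\cdot|_{s,\mathcal O,\inf}$: $$|v|_{L^2(\mathcal O),H^1(\mathcal O),s}^2\le\max\{\rho_{\mathcal O}^n\rho_{\hat{\mathcal O}}^{n+2s},\,D_{\mathcal O}^{-2s}D_{\hat{\mathcal O}}^{2s}\}\;\rho_{\mathcal O}^{2s}\,k(s,\hat{\mathcal O})^{-2}\,|v|_{s,\mathcal O,\inf}^2.$$ (iii) b) For a family of uniformly bounded, shape-regular domains $\mathcal O$, $|\cdot|_{s,\mathcal O,\inf}$ is uniformly bounded by $|\cdot|_{L^2(\mathcal O),H^1(\mathcal O),s}$: $$|v|_{s,\mathcal O,\inf}^2\le\max\{\rho_{\mathcal O}^{n+2s}\rho_{\hat{\mathcal O}}^{n},\,D_{\mathcal O}^{2s}D_{\hat{\mathcal O}}^{-2s}\}\;\rho_{\hat{\mathcal O}}^{2s}\,K(s,\hat{\mathcal O})^2\Bigl(3+\frac{C_{\rm PF,I}(s,\hat{\mathcal O})^2}{s(1-s)}\Bigr)|v|_{L^2(\mathcal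 O),H^1(\mathcal O),s}^2.$$
   Context: Functions are real valued. For a bounded connected Lipschitz domain $\mathcal O\subset\mathbb R^n$, $\|\cdot\|_{0,\mathcal O}$ is the $L^2(\mathcal O)$-norm, $|v|_{1,\mathcal O}=\|\nabla v\|_{0,\mathcal O}$, and $\|v\|_{1,\mathcal O}^2=\|v\|_{0,\mathcal O}^2+|v|_{1,\mathcal O}^2$. $D_{\mathcal O}$ denotes the diameter of $\mathcal O$, $d_{\mathcal O}$ the supremum of the diameters of all balls contained in $\mathcal O$, and $\rho_{\mathcal O}=D_{\mathcal O}/d_{\mathcal O}$. A family of domains, each an affine image (as in the claim) of the fixed domain $\hat{\mathcal O}$, is shape-regular if $\rho_{\mathcal O}$ is bounded uniformly over the family, and uniformly bounded if $D_{\mathcal O}$ is bounded from above uniformly over the family. Uniform equivalence/boundedness of semi-norms means that the constants in the inequalities can be chosen uniformly over the family (for fixed $s$ and $\hat{\mathcal O}$); the displayed inequalities give the precise content and hold for each individual $\mathcal O$. For $0<s<1$: - Sobolev-Slobodeckij semi-norm: $|v|_{s,\mathcal O}=\Bigl(\int_{\mathcal O}\int_{\mathcal O}\frac{|v(x)-v(y)|^2}{|x-y|^{n+2s}}\,dx\,dy\Bigr)^{1/2}$; norm: $\|v\|_{s,\mathcal O}=\bigl(\|v\|_{0,\mathcal O}^2+|v|_{s,\mathcal O}^2\bigr)^{1/2}$. $H^s(\mathcal O)$ is the space of $v\in L^2(\mathcal O)$ with $\|v\|_{s,\mathcal O}<\infty$. - Quotient space semi-norm: $|v|_{s,\mathcal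 O,\inf}=\inf_{c\in\mathbb R}\|v+c\|_{s,\mathcal O}$. - Interpolation norm: $\|v\|_{L^2(\mathcal O),H^1(\mathcal O),s}=\Bigl(\int_0^\infty t^{-2s}\inf_{v=v_0+v_1}\bigl(\|v_0\|_{0,\mathcal O}^2+t^2\|v_1\|_{1,\mathcal O}^2\bigr)\frac{dt}{t}\Bigr)^{1/2}$. - Interpolation semi-norm: $|v|_{L^2(\mathcal O),H^1(\mathcal O),s}=\Bigl(\int_0^\infty t^{-2s}\inf_{v=v_0+v_1}\bigl(\|v_0\|_{0,\mathcal O}^2+t^2|v_1|_{1,\mathcal O}^2\bigr)\frac{dt}{t}\Bigr)^{1/2}$. The infima are over $v_0\in L^2(\mathcal O)$, $v_1\in H^1(\mathcal O)$ with $v_0+v_1=v$. Constants on a bounded connected Lipschitz domain $\mathcal O$, for given $s\in(0,1)$: - $k(s,\mathcal O),K(s,\mathcal O)>0$ are constants (which exist) such that $k(s,\mathcal O)\|w\|_{L^2(\mathcal O),H^1(\mathcal O),s}\le\|w\|_{s,\mathcal O}\le K(s,\mathcal O)\|w\|_{L^2(\mathcal O),H^1(\mathcal O),s}$ for all $w\in H^s(\mathcal O)$. - $C_{\rm PF,I}(s,\mathcal O)>0$ is a constant (which exists) such that $\|w\|_{0,\mathcal O}\le C_{\rm PF,I}(s,\mathcal O)\bigl(|w|_{L^2(\mathcal O),H^1(\mathcal O),s}+|\int_{\mathcal O}w|\bigr)$ for all $w\in H^s(\mathcal O)$. - $C_{\rm PF,SS}(s,\mathcal O)=|\mathcal O|^{-1/2}\max\{1,2^{-1/2}D_{\mathcal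 O}^{n/2+s}\}$, where $|\mathcal O|$ is the Lebesgue measure of $\mathcal O$. With it, $\|w\|_{0,\mathcal O}\le C_{\rm PF,SS}(s,\mathcal O)\bigl(|w|_{s,\mathcal O}+|\int_{\mathcal O}w|\bigr)$ for all $w\in H^s(\mathcal O)$. *)

(* Defs.v *)
From HB Require Import structures.
From mathcomp Require Import all_boot all_order all_algebra.
From mathcomp Require Import all_classical all_reals all_analysis.

Set Implicit Arguments.
Unset Strict Implicit.
Unset Printing Implicit Defensive.

Import Order.TTheory GRing.Theory Num.Theory.
Import numFieldNormedType.Exports.

Local Open Scope classical_set_scope.
Local Open Scope ring_scope.

Fact cV_display : measure_display.
Proof. exact: default_measure_display. Qed.

(* The sigma-algebra on R^n generated by the coordinates; it is the Borel
   sigma-algebra. *)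
Section measurable_cV.
Context (R : realType) (n : nat).

Definition cV_coord (i : 'I_n) (x : 'cV[R]_n) : measurableTypeR R := x i ord0.

Let cV_set0 : g_sigma_preimage cV_coord set0.
Proof. exact: sigma_algebra0. Qed.

Let cV_setC A : g_sigma_preimage cV_coord A -> g_sigma_preimage cV_coord (~` A).
Proof. exact: sigma_algebraC. Qed.

Let cV_bigcup (F : (set 'cV[R]_n)^nat) :
  (forall i, g_sigma_preimage cV_coord (F i)) ->
  g_sigma_preimage cV_coord (\bigcup_i F i).
Proof. exact: sigma_algebra_bigcup. Qed.

HB.instance Definition _ := @isMeasurable.Build cV_display
  'cV[R]_n (g_sigma_preimage cV_coord) cV_set0 cV_setC cV_bigcup.

End measurable_cV.

Definition cV_cons (R : realType) (n : nat)
    (p : measurableTypeR R * 'cV[R]_n) : 'cV[R]_(1 + n) :=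
  col_mx (const_mx (p.1 : R)) p.2.

(* n-dimensional Lebesgue measure, as the iterated product of the
   one-dimensional one. *)
Fixpoint lebesgue_cV (R : realType) (n : nat) : set 'cV[R]_n -> \bar R :=
  match n with
  | 0%N => \d_(0 : 'cV[R]_0)
  | n'.+1 => fun A => (\int[@lebesgue_measure R]_x
      lebesgue_cV [set y : 'cV[R]_n' | A (cV_cons (x, y))])%E
  end.

(* Canonical inference of sigma-finiteness fails on product measures. *)
Lemma sigma_finite_prod d1 d2 (T1 : measurableType d1) (T2 : measurableType d2)
    (R : realType) (m1 : {sigma_finite_measure set T1 -> \bar R})
    (m2 : {sigma_finite_measure set T2 -> \bar R}) :
  sigma_finite setT (m1 \x m2)%E.
Proof.
have /sigma_finiteP[F [TF ndF Foo]] := sigma_finiteT m1.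
have /sigma_finiteP[G [TG ndG Goo]] := sigma_finiteT m2.
exists (fun n => F n `*` G n).
  rewrite -setXTT TF TG predeqE => -[x y]; split.
    move=> [/= [n _ Fnx] [k _ Gky]]; exists (maxn n k) => //; split.
    - by move: x Fnx; exact/subsetPset/ndF/leq_maxl.
    - by move: y Gky; exact/subsetPset/ndG/leq_maxr.
  by move=> [n _ []/= ? ?]; split; exists n.
move=> k; have [? ?] := Foo k; have [? ?] := Goo k.
split; first exact: measurableX.
by rewrite product_measure1E// lte_mul_pinfty// ge0_fin_numE.
Qed.

Section lebesgue_cV_measure.
Context (R : realType).

Lemma measurable_cV_coord n (i : 'I_n) :
  measurable_fun [set: 'cV[R]_n] (cV_coord i).
Proof.
move=> _ Y mY; rewrite setTI; apply: sub_sigma_algebra => /=.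
rewrite -bigcup_seq/=; exists i => /=; first by rewrite mem_index_enum.
by exists Y => //; rewrite setTI.
Qed.

Lemma measurable_fun_cV d (T : measurableType d) n (f : T -> 'cV[R]_n) :
  (forall i, measurable_fun [set: T] (cV_coord i \o f)) ->
  measurable_fun [set: T] f.
Proof.
move=> mf _ Y mY; rewrite setTI.
have : g_sigma_preimage (fun i => cV_coord i \o f) `<=` measurable.
  apply: smallest_sub; first exact: sigma_algebra_measurable.
  rewrite -bigcup_seq/=; apply: bigcup_sub => i _ A [B mB <-].
  exact: mf.
apply; rewrite g_sigma_preimage_comp; exists Y => //.
by rewrite setTI.
Qed.

Lemma measurable_cV_cons n : measurable_fun setT (@cV_cons R n).
Proof.
apply: measurable_fun_cV => i.
case: (split_ordP i) => j ->.
  rewrite (_ : _ \o _ = fst); first exact: measurable_fst.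
  by apply/funext => p /=; rewrite /cV_coord /cV_cons col_mxEu mxE.
rewrite (_ : _ \o _ = cV_coord j \o snd); last first.
  by apply/funext => p /=; rewrite /cV_coord /cV_cons col_mxEd.
apply: measurableT_comp; last exact: measurable_snd.
exact: measurable_cV_coord.
Qed.

Definition cV_uncons n (x : 'cV[R]_(1 + n)) : measurableTypeR R * 'cV[R]_n :=
  (x ord0 ord0, dsubmx x).

Lemma cV_consK n : cancel (@cV_cons R n) (@cV_uncons n).
Proof.
move=> [a y]; rewrite /cV_uncons /cV_cons /= col_mxKd; congr pair.
transitivity (col_mx (const_mx a : 'cV[R]_1) y (lshift n ord0) ord0).
  by congr (col_mx _ _ _ _); exact/val_inj.
by rewrite col_mxEu mxE.
Qed.

Lemma cV_unconsK n : cancel (@cV_uncons n) (@cV_cons R n).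
Proof.
move=> x; rewrite /cV_cons /= -[RHS]vsubmxK; congr col_mx.
apply/matrixP => i j; rewrite !mxE !ord1.
by congr (x _ _); apply/val_inj.
Qed.

Lemma measurable_cV_uncons n : measurable_fun setT (@cV_uncons n).
Proof.
apply/measurable_fun_pairP; split; first exact: (@measurable_cV_coord n.+1).
apply: measurable_fun_cV => i.
rewrite (_ : _ \o _ = cV_coord (rshift 1 i)); first exact: measurable_cV_coord.
by apply/funext => x; rewrite /cV_coord /= mxE.
Qed.

Let mu1 : {sigma_finite_measure set (measurableTypeR R) -> \bar R} :=
  @lebesgue_measure R.

Section step.
Context (n : nat) (m : {sigma_finite_measure set 'cV[R]_n -> \bar R}).

Definition lebesgue_cV_step : set 'cV[R]_n.+1 -> \bar R :=
  pushforward (mu1 \x m)%E (@cV_cons R n).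

Let step0 : lebesgue_cV_step set0 = 0%E.
Proof. by rewrite /lebesgue_cV_step /pushforward preimage_set0 measure0. Qed.

Let step_ge0 A : (0 <= lebesgue_cV_step A)%E.
Proof. exact: (measure_ge0 (mu1 \x m)%E). Qed.

Let step_sigma_additive : semi_sigma_additive lebesgue_cV_step.
Proof.
pose nu : {measure set 'cV[R]_n.+1 -> \bar R} :=
  measure_function_pushforward__canonical__measure_function_Measure
    (mu1 \x m)%E (@measurable_cV_cons n).
exact: (@measure_semi_sigma_additive _ _ _ nu).
Qed.

HB.instance Definition _ := isMeasure.Build _ _ _ lebesgue_cV_step
  step0 step_ge0 step_sigma_additive.

Let step_sigma_finite : sigma_finite setT lebesgue_cV_step.
Proof.
have [F UF mF] := sigma_finite_prod mu1 m.
exists (fun i => @cV_uncons n @^-1` F i).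
  by rewrite -preimage_bigcup -UF preimage_setT.
move=> i; have [mFi Fioo] := mF i; split.
  by rewrite -[X in measurable X]setTI; exact: measurable_cV_uncons.
rewrite /lebesgue_cV_step /pushforward -comp_preimage.
rewrite (_ : _ \o _ = id) ?preimage_id//.
by apply/funext => p /=; rewrite cV_consK.
Qed.

HB.instance Definition _ := Measure_isSigmaFinite.Build _ _ _ lebesgue_cV_step
  step_sigma_finite.

End step.

Lemma lebesgue_cV_spec n :
  exists m : {sigma_finite_measure set 'cV[R]_n -> \bar R},
    (m : set 'cV[R]_n -> \bar R) = @lebesgue_cV R n.
Proof.
elim: n => [|n [m mE]]; first by exists (\d_(0 : 'cV[R]_0)).
exists (lebesgue_cV_step m); apply/funext => A /=.
apply: eq_integral => x _; rewrite -mE /=; congr (m _).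
by apply/seteqP; split => y; rewrite /xsection/= inE.
Qed.

Section instances.
Variable n : nat.

Let lebesgue_cV0 : @lebesgue_cV R n set0 = 0%E.
Proof. by have [m <-] := lebesgue_cV_spec n; exact: measure0. Qed.

Let lebesgue_cV_ge0 A : (0 <= @lebesgue_cV R n A)%E.
Proof. by have [m <-] := lebesgue_cV_spec n; exact: measure_ge0. Qed.

Let lebesgue_cV_sigma_additive : semi_sigma_additive (@lebesgue_cV R n).
Proof.
by have [m <-] := lebesgue_cV_spec n; exact: measure_semi_sigma_additive.
Qed.

HB.instance Definition _ := isMeasure.Build _ _ _ (@lebesgue_cV R n)
  lebesgue_cV0 lebesgue_cV_ge0 lebesgue_cV_sigma_additive.

Let lebesgue_cV_sigma_finite : sigma_finite setT (@lebesgue_cV R n).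
Proof. by have [m <-] := lebesgue_cV_spec n; exact: sigma_finiteT. Qed.

HB.instance Definition _ := Measure_isSigmaFinite.Build _ _ _ (@lebesgue_cV R n)
  lebesgue_cV_sigma_finite.

End instances.

End lebesgue_cV_measure.

Section euclidean_geometry.
Context {R : realType} {n : nat}.
Implicit Types (O : set 'cV[R]_n) (x y : 'cV[R]_n).

Definition dotv x y : R := \sum_(i < n) x i ord0 * y i ord0.

(* The Euclidean norm; the library norm `|x| on matrices is the max norm. *)
Definition enorm x : R := Num.sqrt (dotv x x).

Definition eball (c : 'cV[R]_n) (r : R) : set 'cV[R]_n :=
  [set x | enorm (x - c) < r].

Definition diam O : R := sup [set enorm (x - y) | x in O & y in O].

Definition indiam O : R :=
  sup [set d | exists c (r : R), [/\ 0 < r, eball c r `<=` O & d = 2 * r]].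

Definition aspect O : R := diam O / indiam O.

(* Near each boundary point the domain is the part of space lying strictly
   above the graph of a Lipschitz function, in a Cartesian coordinate system
   whose last axis is spanned by the unit vector e.  The point of the hyperplane
   orthogonal to e below x is x - (x . e) e, so phi is only used on that
   hyperplane; a Lipschitz function on a hyperplane always extends to R^n. *)
Definition lipschitz_boundary O : Prop :=
  forall p, (closure O `\` O) p ->
    exists (U : set 'cV[R]_n) (e : 'cV[R]_n) (phi : 'cV[R]_n -> R) (L : R),
      [/\ open_nbhs p U, enorm e = 1,
          forall x y, `|phi x - phi y| <= L * enorm (x - y) &
          forall x, U x -> (O x <-> phi (x - dotv x e *: e) < dotv x e)].

Definition lipschitz_domain O : Prop :=
  [/\ O !=set0, open O, connected O, bounded_set O & lipschitz_boundary O].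

Definition affine_map (x0 : 'cV[R]_n) (B : 'M[R]_n) (x : 'cV[R]_n) : 'cV[R]_n :=
  x0 + B *m x.

End euclidean_geometry.

Section sobolev_spaces.
Context {R : realType} {n : nat}.
Implicit Types (O : set 'cV[R]_n) (v w : 'cV[R]_n -> R) (s : R).

Local Notation leb := (@lebesgue_cV R n).
Local Open Scope ereal_scope.

(* An element of a function space on O is a Borel function on R^n, of which only
   the values on O matter; norms take the value +oo outside the space. *)
Definition normL2 O v : \bar R := sqrte (\int[leb]_(x in O) ((v x) ^+ 2)%:E).

Definition L2 O v : Prop := measurable_fun O v /\ normL2 O v < +oo.

Definition smooth v : Prop :=
  forall (ds : seq 'cV[R]_n) (x : 'cV[R]_n),
    differentiable (foldr (fun d f => 'D_d f) v ds) x.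

Definition test_function O (phi : 'cV[R]_n -> R) : Prop :=
  [/\ smooth phi, compact (closure [set x | phi x != 0%R]) &
      closure [set x | phi x != 0%R] `<=` O].

Definition is_weak_gradient O v (g : 'cV[R]_n -> 'cV[R]_n) : Prop :=
  forall i : 'I_n, L2 O (fun x => g x i ord0) /\
    forall phi, test_function O phi ->
      \int[leb]_(x in O) (v x * 'D_(delta_mx i ord0) phi x)%:E =
      - \int[leb]_(x in O) (g x i ord0 * phi x)%:E.

Definition H1 O v : Prop := L2 O v /\ exists g, is_weak_gradient O v g.

(* A weak gradient is unique up to a null set, so the infimum is over a
   singleton if v is in H^1, and is +oo otherwise. *)
Definition seminormH1 O v : \bar R :=
  ereal_inf [set normL2 O (fun x => enorm (g x)) | g in is_weak_gradient O v].

Definition normH1 O v : \bar R :=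
  sqrte (normL2 O v ^+ 2 + seminormH1 O v ^+ 2).

Definition seminormHs s O v : \bar R :=
  sqrte (\int[leb]_(x in O) \int[leb]_(y in O)
    (`|v x - v y| ^+ 2 / enorm (x - y) `^ (n%:R + 2 * s))%:E).

Definition normHs s O v : \bar R :=
  sqrte (normL2 O v ^+ 2 + seminormHs s O v ^+ 2).

Definition Hs s O v : Prop := L2 O v /\ normHs s O v < +oo.

Definition seminormHs_inf s O v : \bar R :=
  ereal_inf [set normHs s O (fun x => v x + c)%R | c in [set: R]].

Definition decomposition O v (w : ('cV[R]_n -> R) * ('cV[R]_n -> R)) : Prop :=
  [/\ L2 O w.1, H1 O w.2 &
      {ae leb, forall x, O x -> v x = (w.1 x + w.2 x)%R}].

(* The real interpolation functional between L^2 and H^1, the latter measured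
   in N. *)
Definition interpolation (N : set 'cV[R]_n -> ('cV[R]_n -> R) -> \bar R)
    s O v : \bar R :=
  sqrte (\int[lebesgue_measure]_(t in `]0%R, +oo[)
    ((t `^ (- (2 * s)))%:E *
     ereal_inf [set normL2 O w.1 ^+ 2 + (t ^+ 2)%:E * N O w.2 ^+ 2
               | w in decomposition O v] *
     (t^-1)%:E)).

Definition normI s O v : \bar R := interpolation normH1 s O v.

Definition seminormI s O v : \bar R := interpolation seminormH1 s O v.

Definition mass O v : \bar R := \int[leb]_(x in O) (v x)%:E.

Definition volume O : R := fine (leb O).

Definition CPF_SS s O : R :=
  (volume O `^ (- 2^-1) *
   Num.max 1 (2 `^ (- 2^-1) * diam O `^ (n%:R / 2 + s)))%R.

End sobolev_spaces.

Section families.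
Context {R : realType} {n : nat} {I : Type}.
Implicit Types O : I -> set 'cV[R]_n.

Definition shape_regular O : Prop := exists r : R, forall i, aspect (O i) <= r.

Definition diam_bounded O : Prop := exists r : R, forall i, diam (O i) <= r.

Definition diam_bounded_below O : Prop :=
  exists2 r : R, 0 < r & forall i, r <= diam (O i).

Definition uniformly_bounded_by s O
    (p q : R -> set 'cV[R]_n -> ('cV[R]_n -> R) -> \bar R) : Prop :=
  exists2 C : R, 0 < C &
    forall i v, Hs s (O i) v -> (p s (O i) v <= C%:E * q s (O i) v)%E.

Definition uniformly_equivalent s O
    (p q : R -> set 'cV[R]_n -> ('cV[R]_n -> R) -> \bar R) : Prop :=
  uniformly_bounded_by s O p q /\ uniformly_bounded_by s O q p.

End families.

(* Main.v *)
(* Pull v back to vF = v o F on the reference domain.  With J = |det B| and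
   b = D_O / d_Oh, b' = D_Oh / d_O, one has |B x| <= b |x|, |B^-1 x| <= b' |x|,
   J <= b^n and 1/J <= b'^n, because a ball of diameter close to d_Oh in Oh is
   mapped into a set of diameter at most D_O.  Changing variables, the squared
   L2 norm, Slobodeckij semi-norm and interpolation semi-norm of v are J,
   at most J^2 b'^(n+2s) and at most J b'^(2s) times those of vF, and conversely
   with F^-1; for the interpolation semi-norm the substitution t -> b t absorbs
   the scaling of gradients.  Since both semi-norms ignore additive constants,
   on the reference domain vF may be given mean zero, where the Poincare
   inequalities turn the equivalence of norms into one of semi-norms.  The
   interpolation norm exceeds the semi-norm only through the L2 norm: for t <= 1
   one keeps the decomposition v = v0 + v1, for t > 1 one takes v = v + 0.
   The products of scaling factors simplify by b b' = rho_O rho_Oh. *)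
Require Import Defs.
From HB Require Import structures.
From mathcomp Require Import all_boot all_order all_algebra.
From mathcomp Require Import all_classical all_reals all_analysis.
From mathcomp Require Import measurable_realfun ring lra.

Set Implicit Arguments.
Unset Strict Implicit.
Unset Printing Implicit Defensive.

Import Order.TTheory GRing.Theory Num.Theory.
Import numFieldNormedType.Exports.

Local Open Scope classical_set_scope.
Local Open Scope ring_scope.

(** * Lebesgue measure under affine maps *)

Section measurability.
Context {R : realType} {n : nat}.
Implicit Types A : set 'cV[R]_n.

Definition cube (a b : R) : set 'cV[R]_n :=
  [set x | forall i, a <= x i ord0 < b].

Lemma measurable_box (q : 'cV[R]_n) (r : R) :
  measurable [set x : 'cV[R]_n | forall i, `|x i ord0 - q i ord0| < r].
Proof.
rewrite [X in measurable X](_ : _ =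
    \bigcap_(i in [set: 'I_n]) (cV_coord i @^-1` [set y | `|y - q i ord0| < r])).
  apply: fin_bigcap_measurable; first exact: finite_finset.
  move=> i _; rewrite -[X in measurable X]setTI; apply: measurable_cV_coord => //.
  by apply: open_measurable; have := @ball_open R R (q i ord0) r;
    rewrite -ball_normE => /=; under eq_set do rewrite distrC.
apply/seteqP; split=> [x Px i _|x Px i]; [exact: Px i|exact: Px i Logic.I].
Qed.

Lemma measurable_cube a b : measurable (cube a b).
Proof.
rewrite [X in measurable X](_ : _ =
    \bigcap_(i in [set: 'I_n]) (cV_coord i @^-1` `[a, b[)).
  apply: fin_bigcap_measurable; first exact: finite_finset.
  move=> i _; rewrite -[X in measurable X]setTI.
  by apply: measurable_cV_coord => //; exact: measurable_itv.
apply/seteqP; split=> [x Px i _|x Px i].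
  by rewrite /= in_itv/=; exact: Px.
by have := Px i Logic.I; rewrite /= in_itv.
Qed.

Lemma ball_cVP (x y : 'cV[R]_n) (e : R) : 0 < e ->
  ball x e y <-> forall i, `|x i ord0 - y i ord0| < e.
Proof.
move=> e0; split=> [|xy].
  by move=> [_ xy] i; have := xy i ord0; rewrite -ball_normE.
by split=> // i j; rewrite (ord1 j) -ball_normE /=; exact: xy.
Qed.

Lemma open_measurable_cV A : open A -> measurable A.
Proof.
move=> oA.
pose box (p : 'cV[rat]_n * nat) : set 'cV[R]_n :=
  [set x | forall i, `|x i ord0 - ratr (p.1 i ord0)| < p.2.+1%:R^-1].
rewrite [X in measurable X](_ : _ =
   \bigcup_p (if pselect (box p `<=` A) then box p else set0)).
  apply: countable_bigcupT_measurable => [|p]; first exact: countableP.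
  case: pselect => _ /=; last exact: measurable0.
  have := measurable_box (map_mx ratr p.1) p.2.+1%:R^-1.
  rewrite (_ : [set _ | _] = box p)//.
  by apply/seteqP; split=> x bx i; have := bx i; rewrite !mxE.
apply/seteqP; split=> [x Ax|x [p _]]; last first.
  by case: pselect => //= pA /pA.
have /nbhs_ballP[e e0 xeA] : nbhs x A by exact: open_nbhs_nbhs.
pose k := Num.truncn (2 / e).
have ke : k.+1%:R^-1 * 2 < e.
  rewrite mulrC ltr_pdivrMr//; rewrite -ltr_pdivrMl//.
  by rewrite mulrC truncnS_gt.
have k0 : (0 : R) < k.+1%:R^-1 by rewrite invr_gt0.
have /choice[q qP] : forall i, exists q : rat,
    `|x i ord0 - ratr q| < k.+1%:R^-1.
  move=> i; have : x i ord0 - k.+1%:R^-1 < x i ord0 + k.+1%:R^-1.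
    by rewrite ltrD2l; apply: lt_trans k0; rewrite oppr_lt0.
  move=> /rat_in_itvoo[q]; rewrite in_itv/= => /andP[q1 q2]; exists q.
  by rewrite ltr_distlC q1.
have xbox : box (\col_i q i, k) x by move=> i /=; rewrite mxE.
exists (\col_i q i, k) => //; case: pselect => //= -[] y ybox.
apply: xeA; apply/ball_cVP => // i.
have := xbox i; have := ybox i; rewrite /= mxE => h1 h2.
rewrite (le_lt_trans (ler_distD (ratr (q i)) _ _))// (lt_trans _ ke)//.
by rewrite mulr2n mulrDr mulr1 ltrD// distrC.
Qed.

Lemma continuous_measurable_cV (f : 'cV[R]_n -> R) :
  continuous f -> measurable_fun setT f.
Proof.
move=> /continuousP cf; apply: (measurability _ (RGenOpens.measurableE R)).
move=> _ [_ [a [b ->] <-]]; rewrite setTI; apply: open_measurable_cV.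
exact/cf/interval_open.
Qed.

Lemma measurable_affine_map (x0 : 'cV[R]_n) (B : 'M[R]_n) :
  measurable_fun setT (affine_map x0 B).
Proof.
apply: measurable_fun_cV => i.
rewrite (_ : _ \o _ = fun x : 'cV[R]_n =>
   x0 i ord0 + \sum_j (B i j * cV_coord j x)); last first.
  by apply/funext => x; rewrite /cV_coord /affine_map /= !mxE.
apply: measurable_funD => //; apply: measurable_sum => j.
by apply: measurable_funM => //; exact: measurable_cV_coord.
Qed.

End measurability.

Section lebesgue_line.
Context {R : realType}.
Local Notation mu := (@lebesgue_measure R).

Lemma pushforward_lebesgue_shift (a : R) (A : set (measurableTypeR R)) :
  measurable A -> mu [set x | A (x + a)] = mu A.
Proof.
have mT : measurable_fun setT ((fun x => x + a) : measurableTypeR R -> measurableTypeR R).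
  exact: measurable_funD.
pose nu : {measure set _ -> \bar R} :=
  measure_function_pushforward__canonical__measure_function_Measure mu mT.
move=> mA; rewrite -[LHS]/(nu A); apply/esym/lebesgue_measure_unique => //.
move=> _ [[b c] _ <-]; rewrite /nu/= /pushforward.
rewrite (_ : _ @^-1` _ = `](b - a), (c - a)]%classic); last first.
  by apply/seteqP; split=> x /=; rewrite !in_itv/= ltrBlDr lerBrDr.
rewrite !lebesgue_measure_itv/= !lte_fin ltrD2r.
by case: ifP => // _; rewrite -!EFinB; congr EFin; ring.
Qed.

Lemma pushforward_lebesgue_scale (r : R) (A : set (measurableTypeR R)) :
  0 < r -> measurable A -> (mu [set x | A (r * x)%R] = r^-1%:E * mu A)%E.
Proof.
move=> r0.
have mT : measurable_fun setT (( *%R r) : measurableTypeR R -> measurableTypeR R).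
  exact: measurable_funM.
pose nu : {measure set _ -> \bar R} := mscale (NngNum (ltW r0))
  (measure_function_pushforward__canonical__measure_function_Measure mu mT).
move=> mA; rewrite [in RHS](@lebesgue_measure_unique R nu) //.
  by rewrite /nu/= /mscale/= /pushforward muleA -EFinM mulVf ?gt_eqF// mul1e.
move=> _ [[b c] _ <-]; rewrite /nu/= /mscale/= /pushforward.
rewrite (_ : _ @^-1` _ = `](r^-1 * b), (r^-1 * c)]%classic); last first.
  apply/seteqP; split=> x /=; rewrite !in_itv/=.
    by rewrite -[b < _]ltr_pdivrMl// -[_ <= c]ler_pdivlMl.
  by rewrite -[b < _]ltr_pdivrMl// -[_ <= c]ler_pdivlMl.
rewrite !lebesgue_measure_itv/= !lte_fin ltr_pM2l ?invr_gt0//.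
case: ifP => // _; last by rewrite mule0.
by rewrite -!EFinB -EFinM; congr EFin; field; rewrite gt_eqF.
Qed.

End lebesgue_line.

Section lebesgue_space.
Context {R : realType}.
Local Notation mu := (@lebesgue_measure R).
Local Notation leb := (@lebesgue_cV R _).

Lemma lebesgue_cVS n (A : set 'cV[R]_n.+1) :
  lebesgue_cV A = (\int[mu]_x leb [set y : 'cV[R]_n | A (cV_cons (x, y))])%E.
Proof. by []. Qed.

Lemma cV_cons0 n (p : measurableTypeR R * 'cV[R]_n) :
  cV_cons p (lshift n ord0) ord0 = p.1.
Proof. by rewrite /cV_cons col_mxEu mxE. Qed.

Lemma cV_consS n (p : measurableTypeR R * 'cV[R]_n) i :
  cV_cons p (rshift 1 i) ord0 = p.2 i ord0.
Proof. by rewrite /cV_cons col_mxEd. Qed.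

Lemma cV_consD n (x y : R) (u v : 'cV[R]_n) :
  cV_cons (x, u) + cV_cons (y, v) = cV_cons (x + y, u + v).
Proof.
apply/matrixP => i j; rewrite (ord1 j) mxE.
case: (split_ordP i) => k ->; last by rewrite !cV_consS mxE.
by rewrite (ord1 k) !cV_cons0.
Qed.

Lemma cube_cV_cons n (a b x : R) (y : 'cV[R]_n) :
  cube a b (cV_cons (x, y)) <-> a <= x < b /\ cube a b y.
Proof.
split=> [h|[h1 h2] i].
  split=> [|i]; first by have := h (lshift n ord0); rewrite cV_cons0.
  by have := h (rshift 1 i); rewrite cV_consS.
case: (split_ordP i) => k ->; last by rewrite cV_consS; exact: h2.
by rewrite (ord1 k) cV_cons0.
Qed.

Lemma lebesgue_cV_cube n (a b : R) : a <= b ->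
  leb (cube a b : set 'cV[R]_n) = ((b - a) ^+ n)%:E.
Proof.
move=> ab; elim: n => [|n IH].
  rewrite expr0 /= diracE (_ : _ \in _ = true)//.
  by apply/mem_set => -[].
rewrite lebesgue_cVS; transitivity (\int[mu]_x (((b - a) ^+ n)%:E * (\1_`[a, b[ x)%:E))%E.
  apply: eq_integral => x _; rewrite indicE.
  rewrite (_ : [set y | _] = if x \in `[a, b[%classic then cube a b else set0).
    by case: ifP => _; rewrite ?mule1 ?mule0 ?measure0 ?IH.
  apply/seteqP; split => y; first by move/cube_cV_cons => -[xab yab];
    rewrite ifT// inE/= in_itv.
  case: ifPn => // xab yab; apply/cube_cV_cons; split=> //.
  by move: xab; rewrite inE/= in_itv.
rewrite ge0_integralZl_EFin//; last 2 first.
  by apply/measurable_EFinP.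
  by rewrite exprn_ge0// subr_ge0.
rewrite integral_indic// setIT/= lebesgue_measure_itv/= lte_fin.
rewrite exprSr EFinM EFinB; case: ltgtP ab => // -> _.
by rewrite -EFinB subrr.
Qed.

Lemma lebesgue_cV_shift n (a : 'cV[R]_n) (A : set 'cV[R]_n) :
  measurable A -> leb [set x | A (x + a)] = leb A.
Proof.
elim: n a A => [|n IH] a A mA.
  by congr (lebesgue_cV _); apply/seteqP; split => x /=; rewrite (flatmx0 a) addr0.
rewrite -(cV_unconsK (a : 'cV[R]_(1 + n))).
case: (cV_uncons _) => a0 a1.
have mB : measurable (@cV_cons R n @^-1` A).
  by rewrite -[X in measurable X]setTI; exact: measurable_cV_cons.
pose h x := leb (xsection (@cV_cons R n @^-1` A) x).
have mh : measurable_fun setT h by exact: measurable_fun_xsection.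
rewrite lebesgue_cVS; have -> : leb A = (\int[mu]_x h x)%E.
  apply: eq_integral => x _; congr (lebesgue_cV _).
  by apply/seteqP; split=> y; rewrite /xsection/= inE.
transitivity (\int[mu]_x h (x + a0)%R)%E.
  apply: eq_integral => x _.
  rewrite /h -[RHS](IH a1); last exact: measurable_xsection.
  congr (lebesgue_cV _); apply/seteqP; split=> y; rewrite /xsection/= inE/=.
    by rewrite (cV_consD x a0 y a1).
  by rewrite (cV_consD x a0 y a1).
have mT : measurable_fun setT
   ((fun x => x + a0) : measurableTypeR R -> measurableTypeR R).
  exact: measurable_funD.
have := @ge0_integral_pushforward _ _ _ _ R _ mT mu setT h measurableT mh.
rewrite preimage_setT => <- //; apply: eq_measure_integral => B mB' _.
exact: pushforward_lebesgue_shift.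
Qed.

End lebesgue_space.

Section haar.
Context {R : realType} {n : nat}.
Local Notation leb := (@lebesgue_cV R n).

Lemma measurable_cVD d (T : measurableType d) (f g : T -> 'cV[R]_n) :
  measurable_fun setT f -> measurable_fun setT g ->
  measurable_fun setT (fun t => f t + g t).
Proof.
move=> mf mg; apply: measurable_fun_cV => i.
rewrite (_ : _ \o _ = fun t => cV_coord i (f t) + cV_coord i (g t)).
  by apply: measurable_funD; apply: measurableT_comp => //;
    exact: measurable_cV_coord.
by apply/funext => t; rewrite /cV_coord /= mxE.
Qed.

Lemma measurable_cVN d (T : measurableType d) (f : T -> 'cV[R]_n) :
  measurable_fun setT f -> measurable_fun setT (fun t => - f t).
Proof.
move=> mf; apply: measurable_fun_cV => i.
rewrite (_ : _ \o _ = fun t => - cV_coord i (f t)).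
  apply: measurableT_comp => //; apply: measurableT_comp => //.
  exact: measurable_cV_coord.
by apply/funext => t; rewrite /cV_coord /= mxE.
Qed.

Lemma tonelli_sections d1 d2 (T1 : measurableType d1) (T2 : measurableType d2)
    (m1 : {sigma_finite_measure set T1 -> \bar R})
    (m2 : {sigma_finite_measure set T2 -> \bar R}) (S : set (T1 * T2)) :
  measurable S ->
  (\int[m1]_x m2 [set y | S (x, y)] = \int[m2]_y m1 [set x | S (x, y)])%E.
Proof.
move=> mS; have := indic_fubini_tonelli m1 m2 mS.
rewrite indic_fubini_tonelli_FE// indic_fubini_tonelli_GE//= => E.
transitivity (\int[m1]_x (m2 \o xsection S) x)%E.
  apply: eq_integral => x _ /=; congr (m2 _).
  by apply/seteqP; split=> y; rewrite /xsection/= inE.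
rewrite E; apply: eq_integral => y _ /=; congr (m1 _).
by apply/seteqP; split=> x; rewrite /ysection/= inE.
Qed.

Variable nu : {sigma_finite_measure set 'cV[R]_n -> \bar R}.
Hypothesis nu_shift : forall (a : 'cV[R]_n) (A : set 'cV[R]_n),
  measurable A -> nu [set x | A (x + a)] = nu A.

(* In the leb \x nu measure of {(x, y) | A (x + y) and Q y}, integrating in x first
   gives leb A * nu Q, and replacing y by y - x gives nu A * leb Q. *)
Lemma invariant_measure_unique (A Q : set 'cV[R]_n) :
  measurable A -> measurable Q -> (forall x, Q (- x) <-> Q x) ->
  (leb A * nu Q = nu A * leb Q)%E.
Proof.
move=> mA mQ QN.
have mpre d (T : measurableType d) (f : T -> 'cV[R]_n) X :
    measurable_fun setT f -> measurable X -> measurable [set t | X (f t)].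
  by move=> mf mX; rewrite -[X in measurable X]setTI; exact: mf.
have mS : measurable [set p : 'cV[R]_n * 'cV[R]_n | A (p.1 + p.2) /\ Q p.2].
  apply: measurableI.
    by apply: mpre => //; apply: measurable_cVD.
  by apply: mpre.
have mS' : measurable [set p : 'cV[R]_n * 'cV[R]_n | A p.2 /\ Q (p.2 - p.1)].
  apply: measurableI; first exact: mpre.
  apply: mpre => //; apply: measurable_cVD => //; exact: measurable_cVN.
have := tonelli_sections leb nu mS; have := tonelli_sections leb nu mS'.
rewrite /=.
rewrite [X in _ = X -> _](_ : _ = nu A * leb Q)%E; last first.
  transitivity (\int[nu]_y (leb Q * (\1_A y)%:E))%E.
    apply: eq_integral => y _; rewrite indicE; case: (boolP (y \in A)) => yA.
      rewrite mule1 -(lebesgue_cV_shift (- y) mQ); congr (lebesgue_cV _).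
      apply/seteqP; split=> x /=.
        by move=> [_ /QN]; rewrite opprB.
      by move=> /QN; rewrite opprB => ?; split => //; exact: set_mem.
    rewrite mule0 [X in lebesgue_cV X](_ : _ = set0) ?measure0//.
    by apply/seteqP; split => x //= [/mem_set]; rewrite (negbTE yA).
  rewrite ge0_integralZl//; last first.
    by apply/measurable_EFinP.
  by rewrite integral_indic// setIT muleC.
move=> <-.
rewrite [X in _ = X -> _](_ : _ = leb A * nu Q)%E; last first.
  transitivity (\int[nu]_y (leb A * (\1_Q y)%:E))%E.
    apply: eq_integral => y _; rewrite indicE; case: (boolP (y \in Q)) => yQ.
      rewrite mule1 -(lebesgue_cV_shift y mA); congr (lebesgue_cV _).
      by apply/seteqP; split=> x /= => [[]|] //; split => //; exact: set_mem.
    rewrite mule0 [X in lebesgue_cV X](_ : _ = set0) ?measure0//.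
    by apply/seteqP; split => x //= [_ /mem_set]; rewrite (negbTE yQ).
  rewrite ge0_integralZl//; last first.
    by apply/measurable_EFinP.
  by rewrite integral_indic// setIT.
move=> <-; apply: eq_integral => x _.
rewrite -[RHS](nu_shift x).
  by congr (nu _); apply/seteqP; split=> y /=; rewrite addrK (addrC y).
apply: measurableI => //; apply: mpre => //; apply: measurable_cVD => //.
Qed.

End haar.

Section affine_change.
Context {R : realType} {n : nat}.
Local Notation leb := (@lebesgue_cV R n).
Implicit Types (B : 'M[R]_n) (A : set 'cV[R]_n).

Lemma mulmx_coord_bound B : exists2 M : R, 0 < M &
  forall (x : 'cV[R]_n) (r : R), (forall i, `|x i ord0| <= r) ->
    forall i, `|(B *m x) i ord0| <= M * r.
Proof.
exists (1 + \sum_i \sum_j `|B i j|).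
  by rewrite ltr_pwDl// sumr_ge0// => i _; rewrite sumr_ge0.
move=> x r xr i; rewrite mxE (le_trans (ler_norm_sum _ _ _))//.
have r0 : 0 <= r by exact: le_trans (xr i).
apply: (@le_trans _ _ ((\sum_j `|B i j|) * r)).
  rewrite mulr_suml ler_sum// => j _; rewrite normrM.
  exact: ler_wpM2l.
rewrite ler_wpM2r// ler_wpDl// [leRHS](bigD1 i)//= lerDl sumr_ge0// => k _.
by rewrite sumr_ge0.
Qed.

Lemma mulmx_affine B : affine_map 0 B = (fun x => B *m x).
Proof. by apply/funext => x; rewrite /affine_map add0r. Qed.

Lemma measurable_mulmx B : measurable_fun setT (fun x : 'cV[R]_n => B *m x).
Proof. by rewrite -mulmx_affine; exact: measurable_affine_map. Qed.

Lemma measurable_preimage_cV d (T : measurableType d) (f : T -> 'cV[R]_n) A :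
  measurable_fun setT f -> measurable A -> measurable [set t | A (f t)].
Proof. by move=> mf mA; rewrite -[X in measurable X]setTI; exact: mf. Qed.

Section linear.
Variables (B : 'M[R]_n) (Bu : B \in unitmx).

Definition lebesgue_image : set 'cV[R]_n -> \bar R :=
  pushforward leb (fun x => B *m x).
Local Notation nu := lebesgue_image.

Let nu0 : nu set0 = 0%E.
Proof. by rewrite /lebesgue_image /pushforward preimage_set0 measure0. Qed.

Let nu_ge0 A : (0 <= nu A)%E. Proof. exact: (measure_ge0 leb). Qed.

Let nu_sigma_additive : semi_sigma_additive nu.
Proof.
exact: (@measure_semi_sigma_additive _ _ _
  (measure_function_pushforward__canonical__measure_function_Measure leb
    (measurable_mulmx B))).
Qed.

HB.instance Definition _ := isMeasure.Build _ _ _ nu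
  nu0 nu_ge0 nu_sigma_additive.

Let nu_sigma_finite : sigma_finite setT nu.
Proof.
have [F UF mF] := @sigma_finiteT _ _ _ leb.
exists (fun i => (fun x => invmx B *m x) @^-1` F i).
  by rewrite -preimage_bigcup -UF preimage_setT.
move=> i; have [mFi Fioo] := mF i; split.
  by rewrite -[X in measurable X]setTI; exact: measurable_mulmx.
rewrite /lebesgue_image /pushforward -comp_preimage (_ : _ \o _ = id) ?preimage_id//.
by apply/funext => x /=; rewrite mulKmx.
Qed.

HB.instance Definition _ := Measure_isSigmaFinite.Build _ _ _ nu
  nu_sigma_finite.

Lemma lebesgue_cV_linear : exists2 c : R, 0 < c &
  forall A, measurable A -> leb [set x | A (B *m x)] = (c%:E * leb A)%E.
Proof.
pose Q : set 'cV[R]_n := [set x | forall i, `|x i ord0| < 1].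
have mQ : measurable Q.
  have := @measurable_box R n 0 1.
  by congr measurable; apply/seteqP; split=> x Qx i; have := Qx i;
    rewrite mxE subr0.
have QN x : Q (- x) <-> Q x.
  by split=> Qx i; have := Qx i; rewrite mxE normrN.
have nu_shift (a : 'cV[R]_n) A : measurable A -> nu [set x | A (x + a)] = nu A.
  move=> mA; rewrite /lebesgue_image /pushforward.
  rewrite -[RHS](lebesgue_cV_shift (invmx B *m a)).
    by congr (lebesgue_cV _); apply/seteqP; split=> x /=;
      rewrite mulmxDr mulKVmx.
  by apply: measurable_preimage_cV => //; exact: measurable_mulmx.
have bounded_pos X : measurable X -> (exists2 e : R, 0 < e & cube 0 e `<=` X) ->
    (exists2 M : R, 0 < M & X `<=` cube (- M) M) ->
    exists2 r : R, 0 < r & leb X = r%:E.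
  move=> mX [e e0 eX] [M M0 XM].
  have lo : ((e ^+ n)%:E <= leb X)%E.
    have := @lebesgue_cV_cube R n _ _ (ltW e0); rewrite subr0 => <-.
    by apply: le_measure; rewrite ?inE//; exact: measurable_cube.
  have hi : (leb X < +oo)%E.
    apply: (@le_lt_trans _ _ (leb (cube (- M) M))).
      by apply: le_measure; rewrite ?inE//; exact: measurable_cube.
    by rewrite lebesgue_cV_cube ?ltry// ge0_cp// ltW.
  have Xfin : leb X \is a fin_num by rewrite ge0_fin_numE.
  exists (fine (leb X)); last by rewrite fineK.
  by rewrite -lte_fin fineK// (lt_le_trans _ lo)// lte_fin exprn_gt0.
have [r r0 Qr] : exists2 r : R, 0 < r & leb Q = r%:E.
  apply: bounded_pos => //.
    exists 1 => // x x1 i; have /andP[x0 x2] := x1 i.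
    by rewrite ger0_norm.
  exists 1 => // x x1 i; have := x1 i; rewrite ltr_norml => /andP[x0 x2].
  by rewrite ltW.
have [t t0 Qt] : exists2 r : R, 0 < r & nu Q = r%:E.
  apply: bounded_pos.
  - by apply: measurable_preimage_cV => //; exact: measurable_mulmx.
  - have [M M0 BM] := mulmx_coord_bound B.
    exists ((M + 1)^-1); first by rewrite invr_gt0 addr_gt0.
    move=> x xe i.
    have M1 : 0 < M + 1 by rewrite addr_gt0.
    apply: (@le_lt_trans _ _ (M * (M + 1)^-1)).
      apply: BM => j; have /andP[x0 x2] := xe j.
      by rewrite ger0_norm// ltW.
    by rewrite ltr_pdivrMr// mul1r ltrDl.
  - have [M M0 BM] := mulmx_coord_bound (invmx B).
    exists (M + 1); first by rewrite addr_gt0.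
    move=> x xe i.
    have : `|x i ord0| <= M.
      rewrite -(mulKmx Bu x) -[M]mulr1; apply: BM => j.
      by rewrite ltW//; exact: xe.
    rewrite ler_norml => /andP[x1 x2]; apply/andP; split.
      by rewrite opprD (le_trans _ x1)// gerDl oppr_le0.
    by rewrite (le_lt_trans x2)// ltrDl.
exists (t / r); first by rewrite divr_gt0.
move=> A mA.
have : (leb A * nu Q = nu A * leb Q)%E by exact: invariant_measure_unique.
rewrite -[leb [set x | A (B *m x)]]/(nu A) Qr Qt.
move=> /(congr1 (fun z => z * r^-1%:E)%E); rewrite -!muleA -!EFinM.
by rewrite mulfV ?gt_eqF// mule1 => <-; rewrite muleC.
Qed.

End linear.

Lemma lebesgue_cV_affine (x0 : 'cV[R]_n) B : B \in unitmx ->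
  exists2 c : R, 0 < c & forall A, measurable A ->
    leb (affine_map x0 B @^-1` A) = (c%:E * leb A)%E.
Proof.
move=> /lebesgue_cV_linear[c c0 cE]; exists c => // A mA.
rewrite -(lebesgue_cV_shift x0 mA) -cE; last first.
  apply: measurable_preimage_cV => //; exact: measurable_cVD.
by congr (lebesgue_cV _); apply/seteqP; split => x; rewrite /= addrC.
Qed.

End affine_change.

Section change_of_variables.
Context {R : realType} {n : nat}.
Local Notation leb := (@lebesgue_cV R n).
Implicit Types (A D : set 'cV[R]_n).
Variables (x0 : 'cV[R]_n) (B : 'M[R]_n) (J : R).
Local Notation F := (affine_map x0 B).

(* J is |det B|; only the induced scaling of volumes is needed, and its existence
   follows from the uniqueness of translation-invariant measures. *)
Definition jacobian := 0 < J /\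
  forall A, measurable A -> leb A = (J%:E * leb (F @^-1` A))%E.

Hypothesis Jac : jacobian.

Let J0 : 0 < J. Proof. by have [] := Jac. Qed.

Lemma ge0_change_of_variables D (f : 'cV[R]_n -> \bar R) :
  measurable D -> measurable_fun D f -> (forall x, D x -> (0 <= f x)%E) ->
  (\int[leb]_(x in D) f x = J%:E * \int[leb]_(x in F @^-1` D) f (F x))%E.
Proof.
move=> mD mf f0; have mF := measurable_affine_map x0 B.
have E := @ge0_integral_pushforward _ _ _ _ R F mF leb D f mD mf.
rewrite -E; last by move=> x /set_mem; exact: f0.
rewrite -(ge0_integral_mscale _ _ (NngNum (ltW J0)))//.
by apply: eq_measure_integral => A mA _; exact: Jac.2.
Qed.

Lemma change_of_variables D (f : 'cV[R]_n -> \bar R) :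
  measurable D -> measurable_fun D f ->
  (\int[leb]_(x in D) f x = J%:E * \int[leb]_(x in F @^-1` D) f (F x))%E.
Proof.
move=> mD mf.
rewrite integralE [in RHS]integralE.
rewrite ge0_change_of_variables//; last exact: measurable_funepos.
rewrite [X in (_ - X)%E]ge0_change_of_variables//; last exact: measurable_funeneg.
under [X in (_ = _ * (X - _))%E]eq_integral do rewrite (funepos_comp f F)/=.
under [X in (_ = _ * (_ - X))%E]eq_integral do rewrite (funeneg_comp f F)/=.
set a := (X in (_ * X - _)%E); set b := (X in (_ - _ * X)%E).
rewrite -[RHS]/(J%:E * (a - b))%E.
have : (0 <= a)%E by exact: integral_ge0.
have : (0 <= b)%E by exact: integral_ge0.
have J0' : (0 < J%:E)%E by rewrite lte_fin.
case: a b => [a| |] [b| |]//= _ _; rewrite ?gt0_muley ?gt0_muleNy//.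
by rewrite -[RHS]/((J * (a - b))%:E) mulrBr.
Qed.

End change_of_variables.

Section jacobian_theory.
Context {R : realType} {n : nat}.
Local Notation leb := (@lebesgue_cV R n).
Implicit Types (B : 'M[R]_n) (x : 'cV[R]_n).

Lemma affine_mapK x0 B : B \in unitmx ->
  cancel (affine_map x0 B) (affine_map (- (invmx B *m x0)) (invmx B)).
Proof.
by move=> Bu x; rewrite /affine_map mulmxDr mulKmx// addrA addNr add0r.
Qed.

Lemma affine_mapVK x0 B : B \in unitmx ->
  cancel (affine_map (- (invmx B *m x0)) (invmx B)) (affine_map x0 B).
Proof.
by move=> Bu x; rewrite /affine_map mulmxDr mulmxN !mulKVmx// addrA subrr add0r.
Qed.

Lemma image_affine_map x0 B (A : set 'cV[R]_n) : B \in unitmx ->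
  affine_map x0 B @` A = affine_map (- (invmx B *m x0)) (invmx B) @^-1` A.
Proof.
move=> Bu; apply/seteqP; split=> x.
  by move=> [y Ay <-]; rewrite /= affine_mapK.
by move=> Ax; eexists; [exact: Ax|exact: affine_mapVK].
Qed.

Lemma preimage_affine_mapK x0 B (A : set 'cV[R]_n) : B \in unitmx ->
  affine_map (- (invmx B *m x0)) (invmx B) @^-1` (affine_map x0 B @^-1` A) = A.
Proof. by move=> Bu; apply/seteqP; split=> x /=; rewrite affine_mapVK. Qed.

Lemma exists_jacobian x0 B : B \in unitmx -> exists J, jacobian x0 B J.
Proof.
move=> /lebesgue_cV_affine-/(_ x0)[c c0 cE].
exists c^-1; split; rewrite ?invr_gt0// => A mA.
by rewrite cE// muleA -EFinM mulVf ?gt_eqF// mul1e.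
Qed.

Lemma jacobianV x0 B J : B \in unitmx -> jacobian x0 B J ->
  jacobian (- (invmx B *m x0)) (invmx B) J^-1.
Proof.
move=> Bu [J0 JE]; split; rewrite ?invr_gt0// => A mA.
rewrite [in RHS]JE; last first.
  by rewrite -[X in measurable X]setTI; apply: measurable_affine_map.
rewrite muleA -EFinM mulVf ?gt_eqF// mul1e; congr (lebesgue_cV _).
by apply/seteqP; split=> x /=; rewrite affine_mapK.
Qed.

End jacobian_theory.

Section euclidean_norm.
Context {R : realType} {n : nat}.
Implicit Types (x y : 'cV[R]_n) (B : 'M[R]_n).

Lemma dotv_mulmx x y : dotv x y = (x^T *m y) ord0 ord0.
Proof. by rewrite mxE; apply: eq_bigr => i _; rewrite mxE. Qed.

Lemma dotv_ge0 x : 0 <= dotv x x.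
Proof. by apply: sumr_ge0 => i _; rewrite -expr2 sqr_ge0. Qed.

Lemma enorm_ge0 x : 0 <= enorm x. Proof. exact: sqrtr_ge0. Qed.

Lemma sqr_enorm x : enorm x ^+ 2 = \sum_i x i ord0 ^+ 2.
Proof.
by rewrite sqr_sqrtr ?dotv_ge0//; apply: eq_bigr => i _; rewrite expr2.
Qed.

Lemma enormZ (a : R) x : enorm (a *: x) = `|a| * enorm x.
Proof.
apply/eqP; rewrite -(@eqrXn2 _ 2) ?mulr_ge0 ?enorm_ge0//.
rewrite exprMn !sqr_enorm mulr_sumr real_normK ?num_real//.
by apply/eqP/eq_bigr => i _; rewrite mxE exprMn.
Qed.

Lemma enorm0 : enorm (0 : 'cV[R]_n) = 0.
Proof. by rewrite -(scale0r 0) enormZ normr0 mul0r. Qed.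

Lemma enormN x : enorm (- x) = enorm x.
Proof. by rewrite -scaleN1r enormZ normrN1 mul1r. Qed.

Lemma coord_le_enorm x i : `|x i ord0| <= enorm x.
Proof.
rewrite -(@ler_pXn2r _ 2) ?nnegrE ?enorm_ge0// sqr_enorm real_normK ?num_real//.
by rewrite (bigD1 i)//= lerDl sumr_ge0// => j _; rewrite sqr_ge0.
Qed.

Lemma enorm_eq0 x : (enorm x == 0) = (x == 0).
Proof.
apply/idP/idP => [/eqP x0|/eqP->]; last by rewrite enorm0.
apply/eqP/matrixP => i j; rewrite (ord1 j) mxE; apply/eqP.
by rewrite -normr_le0 -x0 coord_le_enorm.
Qed.

Lemma enorm_gt0 x : (0 < enorm x) = (x != 0).
Proof. by rewrite lt_def enorm_eq0 enorm_ge0 andbT. Qed.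

Lemma enorm_le_coord x r : (forall i, `|x i ord0| <= r) ->
  enorm x ^+ 2 <= n%:R * r ^+ 2.
Proof.
move=> xr; rewrite sqr_enorm -[n in n%:R]card_ord -sum1_card natr_sum mulr_suml.
apply: ler_sum => i _; rewrite mul1r -(real_normK (num_real (x i ord0))).
by rewrite ler_pXn2r ?nnegrE// (le_trans _ (xr i)).
Qed.

Lemma dotv_enorm x : dotv x x = enorm x ^+ 2.
Proof. by rewrite sqr_sqrtr ?dotv_ge0. Qed.

Lemma dotv_le_enorm x y : dotv x y <= enorm x * enorm y.
Proof.
have [->|x0] := eqVneq x 0.
  by rewrite enorm0 mul0r /dotv big1// => i _; rewrite mxE mul0r.
have [->|y0] := eqVneq y 0.
  by rewrite enorm0 mulr0 /dotv big1// => i _; rewrite mxE mulr0.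
have nx : 0 < enorm x by rewrite enorm_gt0.
have ny : 0 < enorm y by rewrite enorm_gt0.
have : 0 <= enorm (enorm y *: x - enorm x *: y) ^+ 2 by rewrite sqr_ge0.
have -> : enorm (enorm y *: x - enorm x *: y) ^+ 2 =
  enorm y ^+ 2 * enorm x ^+ 2 + enorm x ^+ 2 * enorm y ^+ 2
    - 2 * (enorm x * enorm y) * dotv x y.
  rewrite [in LHS]sqr_enorm [X in _ * X + _ - _]sqr_enorm.
  rewrite [X in _ + _ * X - _]sqr_enorm /dotv !mulr_sumr -big_split -sumrB.
  by apply: eq_bigr => i _; rewrite !mxE /=; ring.
rewrite [X in 0 <= X](_ : _ = 2 * (enorm x * enorm y) *
   (enorm x * enorm y - dotv x y)); last by ring.
by rewrite pmulr_rge0 ?subr_ge0// !mulr_gt0.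
Qed.

(* Gradients are pulled back by the transpose of B. *)
Lemma mulmx_trmx_enorm B (b : R) : (forall x, enorm (B *m x) <= b * enorm x) ->
  forall x, enorm (B^T *m x) <= b * enorm x.
Proof.
move=> Bb x; have [-> |Bx0] := eqVneq (B^T *m x) 0.
  rewrite enorm0; exact: le_trans (enorm_ge0 _) (Bb x).
rewrite -(ler_pM2l (_ : 0 < enorm (B^T *m x))) ?enorm_gt0// -expr2.
rewrite -dotv_enorm.
have -> : dotv (B^T *m x) (B^T *m x) = dotv x (B *m (B^T *m x)).
  by rewrite !dotv_mulmx trmx_mul trmxK !mulmxA.
rewrite (le_trans (dotv_le_enorm _ _))// mulrA [leRHS]mulrC ler_wpM2l ?enorm_ge0//.
by rewrite mulrC.
Qed.

Lemma measurable_enorm : measurable_fun setT (@enorm R n).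
Proof.
have m1 := continuous_measurable_fun (@sqrt_continuous R).
apply: (measurableT_comp m1); apply: measurable_sum => i.
by apply: measurable_funM; exact: (@measurable_cV_coord R n i).
Qed.

End euclidean_norm.

Section jacobian_bound.
Context {R : realType} {n : nat}.
Local Notation leb := (@lebesgue_cV R n).

Lemma lebesgue_cV_dilation (b : R) (A : set 'cV[R]_n) : 0 < b -> measurable A ->
  leb [set x | A (b^-1 *: x)] = ((b ^+ n)%:E * leb A)%E.
Proof.
move=> b0 mA; have Bu : (b^-1%:M : 'M[R]_n) \in unitmx.
  by rewrite unitmxE det_scalar unitrX// unitfE invr_eq0 gt_eqF.
have [c c0 cE] := lebesgue_cV_affine 0 Bu.
have EF X : affine_map 0 b^-1%:M @^-1` X = [set x : 'cV[R]_n | X (b^-1 *: x)].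
  by apply/seteqP; split=> x; rewrite /affine_map /= add0r mul_scalar_mx.
have /eqP := cE _ (@measurable_cube R n 0 1).
rewrite EF (_ : [set x | _] = cube 0 b); last first.
  apply/seteqP; split=> x h i; have := h i; rewrite mxE.
    by rewrite mulrC ler_pdivlMr// mul0r ltr_pdivrMr// mul1r.
  by rewrite mulrC ler_pdivlMr// mul0r ltr_pdivrMr// mul1r.
rewrite !lebesgue_cV_cube ?ltW// !subr0 expr1n mule1 => /eqP ->.
by rewrite -cE// EF.
Qed.

Lemma jacobian_le x0 (B : 'M[R]_n) (J b : R) : B \in unitmx ->
  jacobian x0 B J -> 0 < b ->
  (forall x, enorm (B *m x) <= b * enorm x) -> J <= b ^+ n.
Proof.
move=> Bu [J0 JE] b0 Bb.
pose E : set 'cV[R]_n := [set x | enorm x < 1].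
have mE : measurable E.
  rewrite -[X in measurable X]setTI.
  by apply: (measurable_enorm measurableT (measurable_itv `]-oo, 1[)).
pose A := affine_map (- (invmx B *m x0)) (invmx B) @^-1` E.
have mA : measurable A.
  by rewrite -[X in measurable X]setTI; apply: measurable_affine_map.
have AE : affine_map x0 B @^-1` A = E.
  by apply/seteqP; split => x; rewrite /A /= affine_mapK.
have EJ := JE _ mA; rewrite AE in EJ.
have Efin : (leb E < +oo)%E.
  apply: (@le_lt_trans _ _ (leb (cube (- 1) 1))).
    apply: le_measure; rewrite ?inE//; first exact: measurable_cube.
    move=> x Ex i; have := le_lt_trans (coord_le_enorm x i) Ex.
    by rewrite ltr_norml => /andP[/ltW -> ->].
  by rewrite lebesgue_cV_cube ?ltry// lerNl opprK ler01.
have Epos : (0 < leb E)%E.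
  pose e : R := (n%:R + 2)^-1.
  have e0 : 0 < e by rewrite invr_gt0 ltr_wpDl.
  apply: (@lt_le_trans _ _ (leb (cube 0 e))).
    by rewrite lebesgue_cV_cube ?ltW// subr0 lte_fin exprn_gt0.
  apply: le_measure; rewrite ?inE//; first exact: measurable_cube.
  move=> x ex; rewrite /E/= -(@ltr_pXn2r _ 2) ?nnegrE ?enorm_ge0// expr1n.
  apply: (@le_lt_trans _ _ (n%:R * e ^+ 2)).
    apply: enorm_le_coord => i; have /andP[h1 h2] := ex i.
    by rewrite ger0_norm// ltW.
  rewrite expr2 mulrA (@le_lt_trans _ _ (1 * e))//.
    rewrite (ler_wpM2r (ltW e0))// /e ler_pdivrMr ?ltr_wpDl// mul1r.
    by rewrite lerDl.
  have n2 : (1 : R) < n%:R + 2 by have := ler0n R n; lra.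
  by rewrite mul1r invf_lt1 // (lt_trans _ n2).
have : (leb A <= (b ^+ n)%:E * leb E)%E.
  have mE' : measurable [set x : 'cV[R]_n | E (b^-1 *: x)].
    rewrite (_ : [set x | _] = affine_map 0 b^-1%:M @^-1` E).
      by rewrite -[X in measurable X]setTI; apply: measurable_affine_map.
    by apply/seteqP; split=> x; rewrite /affine_map /= add0r mul_scalar_mx.
  rewrite -lebesgue_cV_dilation// -[leRHS](lebesgue_cV_shift (- x0))//.
  apply: le_measure; rewrite ?inE//.
    by apply: measurable_preimage_cV => //; exact: measurable_cVD.
  move=> x; rewrite /A /E /=.
  set y := affine_map _ _ x => y1.
  have -> : x - x0 = B *m y.
    by rewrite -(affine_mapVK x0 Bu x) -/y /affine_map addrAC subrr add0r.
  rewrite enormZ ger0_norm ?invr_ge0 ?ltW// (le_lt_trans _ y1)//.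
  by rewrite ler_pdivrMl.
by rewrite EJ -[leb E]fineK ?ge0_fin_numE// -!EFinM lee_fin ler_pM2r// fine_gt0// Epos.
Qed.
End jacobian_bound.

(** * Affine change of variables in the norms *)

Section seminorms_squared.
Context {R : realType} {n : nat}.
Local Notation leb := (@lebesgue_cV R n).
Implicit Types (O : set 'cV[R]_n) (v : 'cV[R]_n -> R).
Local Open Scope ereal_scope.

Lemma normL2_ge0 O v : 0 <= normL2 O v. Proof. exact: sqrte_ge0. Qed.

Lemma sqr_normL2 O v : normL2 O v ^+ 2 = \int[leb]_(x in O) ((v x) ^+ 2)%:E.
Proof.
by rewrite sqr_sqrte// integral_ge0// => x _; rewrite lee_fin sqr_ge0.
Qed.

Lemma seminormHs_ge0 s O v : 0 <= seminormHs s O v.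
Proof. exact: sqrte_ge0. Qed.

Lemma ge0_le_integral_cV O (f g : 'cV[R]_n -> \bar R) : measurable O ->
  measurable_fun O f -> measurable_fun O g ->
  (forall x, O x -> 0 <= f x) -> (forall x, O x -> f x <= g x) ->
  \int[leb]_(x in O) f x <= \int[leb]_(x in O) g x.
Proof. by move=> mO mf mg f0 fg; exact: ge0_le_integral. Qed.

Definition slobodeckij s v (p : 'cV[R]_n * 'cV[R]_n) : R :=
  (`|v p.1 - v p.2| ^+ 2 / enorm (p.1 - p.2) `^ (n%:R + 2 * s))%R.

Lemma slobodeckij_ge0 s v p : (0 <= slobodeckij s v p)%R.
Proof. by rewrite divr_ge0 ?sqr_ge0 ?powR_ge0. Qed.

Lemma sqr_seminormHs s O v : seminormHs s O v ^+ 2 =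
  \int[leb]_(x in O) \int[leb]_(y in O) (slobodeckij s v (x, y))%:E.
Proof.
rewrite sqr_sqrte// integral_ge0// => x _; rewrite integral_ge0// => y _.
by rewrite lee_fin (slobodeckij_ge0 s v (x, y)).
Qed.

Lemma normHs_ge0 s O v : 0 <= normHs s O v.
Proof. exact: sqrte_ge0. Qed.

Lemma sqr_normHs s O v :
  normHs s O v ^+ 2 = normL2 O v ^+ 2 + seminormHs s O v ^+ 2.
Proof. by rewrite sqr_sqrte// adde_ge0 ?sqre_ge0. Qed.

Lemma measurable_sectioned_integral O (f : 'cV[R]_n * 'cV[R]_n -> \bar R) :
  measurable O -> measurable_fun (O `*` O) f -> (forall p, 0 <= f p) ->
  measurable_fun O (fun x => \int[leb]_(y in O) f (x, y)).
Proof.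
move=> mO mf f0; have mOO : measurable (O `*` O) by exact: measurableX.
have mg : measurable_fun setT (f \_ (O `*` O)) by apply/(measurable_restrictT f mOO).
have g0 p : 0 <= (f \_ (O `*` O)) p by rewrite /patch; case: ifP.
have := @measurable_fun_fubini_tonelli_F _ _ _ _ R leb _ mg g0.
move=> /(@measurable_funTS _ _ _ _ O); apply: eq_measurable_fun => x xO.
rewrite /fubini_F [RHS]integral_mkcond; apply: eq_integral => y _.
by rewrite /patch/= in_setX/= xO.
Qed.

Lemma measurable_slobodeckij s O v : measurable O -> measurable_fun O v ->
  measurable_fun (O `*` O) (slobodeckij s v).
Proof.
move=> mO mv; have mOO : measurable (O `*` O) by exact: measurableX.
apply: measurable_funM.
  apply: measurable_funX; apply: measurableT_comp => //; apply: measurable_funB.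
    apply: (measurable_comp mO) => //; first by move=> _ [p [? ?] <-].
    exact: measurable_funTS.
  apply: (measurable_comp mO) => //; first by move=> _ [p [? ?] <-].
  exact: measurable_funTS.
rewrite (_ : (fun _ => _) = (fun p : 'cV[R]_n * 'cV[R]_n =>
    enorm (p.1 - p.2) `^ (- (n%:R + 2 * s)))%R).
  apply: (measurableT_comp (measurable_powR _)).
  apply: (measurableT_comp measurable_enorm); apply: measurable_funTS.
  by apply: measurable_cVD => //; exact: measurable_cVN.
by apply/funext => p; rewrite powRN.
Qed.

Lemma measurable_slobodeckij_section s O v x : measurable O ->
  measurable_fun O v -> measurable_fun O (fun y => slobodeckij s v (x, y)).
Proof.
move=> mO mv; apply: measurable_funM.
  apply: measurable_funX; apply: measurableT_comp => //.
  exact: (measurable_funB (measurable_cst (v x)) mv).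
rewrite (_ : (fun _ => _) = (fun y =>
    enorm (x - y) `^ (- (n%:R + 2 * s)))%R).
  apply: (measurableT_comp (measurable_powR _)).
  apply: (measurableT_comp measurable_enorm); apply: measurable_funTS.
  by apply: measurable_cVD => //; exact: measurable_cVN.
by apply/funext => p; rewrite powRN.
Qed.

Lemma measurable_slobodeckij_integral s O v : measurable O ->
  measurable_fun O v ->
  measurable_fun O (fun x => \int[leb]_(y in O) (slobodeckij s v (x, y))%:E).
Proof.
move=> mO mv.
apply: (@measurable_sectioned_integral O (EFin \o slobodeckij s v)) => //.
  by apply/measurable_EFinP; apply: measurable_slobodeckij.
by move=> p; rewrite lee_fin slobodeckij_ge0.
Qed.

Lemma seminormHs_shift s O v (a : R) :
  seminormHs s O (fun x => v x + a)%R = seminormHs s O v.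
Proof.
congr sqrte; apply: eq_integral => x _; apply: eq_integral => y _.
by rewrite (_ : _ - _ = v x - v y)%R//; ring.
Qed.

Lemma L2_measurable O v : L2 O v -> measurable_fun O v. Proof. by case. Qed.

Lemma L2P O v : L2 O v <-> measurable_fun O v /\ normL2 O v ^+ 2 < +oo.
Proof.
have E : (normL2 O v ^+ 2 < +oo) = (normL2 O v < +oo).
  rewrite -!ge0_fin_numE ?sqre_ge0 ?normL2_ge0// sqr_sqrte.
    by rewrite sqrte_fin_num// integral_ge0// => x _; rewrite lee_fin sqr_ge0.
  by rewrite integral_ge0// => x _; rewrite lee_fin sqr_ge0.
by rewrite /L2 -E.
Qed.

Lemma HsP s O v : Hs s O v <-> L2 O v /\ seminormHs s O v ^+ 2 < +oo.
Proof.
split=> [[L2v nv]|[/[dup] L2v /L2P[_ v2] sv]]; split=> //.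
  have : normHs s O v ^+ 2 < +oo.
    move: nv; rewrite -!ge0_fin_numE ?sqre_ge0 ?normHs_ge0//.
    by rewrite sqr_sqrte ?sqrte_fin_num// adde_ge0 ?sqre_ge0.
  by apply: le_lt_trans; rewrite sqr_normHs leeDr// sqre_ge0.
rewrite -ge0_fin_numE ?normHs_ge0// /normHs sqrte_fin_num ?adde_ge0 ?sqre_ge0//.
by rewrite ge0_fin_numE ?adde_ge0 ?sqre_ge0// lte_add_pinfty.
Qed.

End seminorms_squared.

Section affine_norms.
Context {R : realType} {n : nat}.
Local Notation leb := (@lebesgue_cV R n).
Variables (x0 : 'cV[R]_n) (B : 'M[R]_n) (J b : R).
Hypotheses (Bu : B \in unitmx) (Jac : jacobian x0 B J) (b_gt0 : 0 < b).
Hypothesis Bb : forall x, enorm (B *m x) <= b * enorm x.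
Local Notation F := (affine_map x0 B).
Implicit Types (O : set 'cV[R]_n) (v : 'cV[R]_n -> R).

Lemma measurable_preimage_affine O : measurable O -> measurable (F @^-1` O).
Proof.
by move=> mO; rewrite -[X in measurable X]setTI; apply: measurable_affine_map.
Qed.

Lemma measurable_fun_affine d (T : measurableType d) O (v : 'cV[R]_n -> T) :
  measurable O ->
  measurable_fun O v -> measurable_fun (F @^-1` O) (fun x => v (F x)).
Proof.
move=> mO mv; apply: (measurable_comp mO _ mv) => //.
  by move=> _ [x Ox <-].
by apply: measurable_funTS; apply: measurable_affine_map.
Qed.

Lemma sqr_normL2_affine O v : measurable O -> measurable_fun O v ->
  (normL2 O v ^+ 2 = J%:E * normL2 (F @^-1` O) (fun x => v (F x)) ^+ 2)%E.
Proof.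
move=> mO mv; rewrite !sqr_normL2 (ge0_change_of_variables Jac)//.
  by apply/measurable_EFinP; exact: measurable_funX.
by move=> x _; rewrite lee_fin sqr_ge0.
Qed.

Lemma L2_affine O v : measurable O -> L2 O v ->
  L2 (F @^-1` O) (fun x => v (F x)).
Proof.
have [J0 _] := Jac.
move=> mO /L2P[mv v2]; apply/L2P; split; first exact: measurable_fun_affine.
move: v2; rewrite sqr_normL2_affine//; set z := (X in (_ * X)%E).
have : (0 <= z)%E by rewrite /z sqr_normL2 integral_ge0// => x _; rewrite lee_fin sqr_ge0.
rewrite -[X in _ -> _ -> (X < _)%E]/z.
by case: z => [r||] //; rewrite ?ltry// gt0_muley// lte_fin.
Qed.

Lemma sqr_seminormHs_affine s O v : 0 < s -> measurable O -> measurable_fun O v ->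
  ((J ^+ 2)%:E * seminormHs s (F @^-1` O) (fun x => v (F x)) ^+ 2 <=
   (b `^ (n%:R + 2 * s))%:E * seminormHs s O v ^+ 2)%E.
Proof.
move=> s0 mO mv; have [J0 _] := Jac.
have mO' := measurable_preimage_affine mO.
have mvF := measurable_fun_affine mO mv.
set p := n%:R + 2 * s; set b' := b `^ p.
have p0 : 0 < p by rewrite ltr_wpDl// mulr_gt0.
have b'0 : 0 <= b' by exact: powR_ge0.
have kF x y : slobodeckij s (fun x => v (F x)) (x, y) <=
    b' * slobodeckij s v (F x, F y).
  rewrite /slobodeckij/= -/p.
  have -> : F x - F y = B *m (x - y).
    by rewrite /affine_map mulmxBr opprD addrACA subrr add0r.
  have [->|xy] := eqVneq x y.
    by rewrite !subrr normr0 expr0n/= !mul0r mulr0.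
  have xy0 : x - y != 0 by rewrite subr_eq0.
  have Bxy : B *m (x - y) != 0.
    by apply: contra xy0 => /eqP h; rewrite -(mulKmx Bu (x - y)) h mulmx0.
  rewrite mulrCA ler_wpM2l ?sqr_ge0//.
  rewrite ler_pdivlMr ?powR_gt0 ?enorm_gt0// mulrC ler_pdivrMr ?powR_gt0 ?enorm_gt0//.
  rewrite /b' -powRM ?(ltW b_gt0) ?enorm_ge0// ge0_ler_powR ?(ltW p0)//.
    by rewrite nnegrE enorm_ge0.
  by rewrite nnegrE mulr_ge0 ?enorm_ge0 ?ltW.
have mKx x : measurable_fun (F @^-1` O)
    (fun y => (slobodeckij s v (F x, F y))%:E).
  apply/measurable_EFinP.
  apply: (measurable_fun_affine (v := fun y => slobodeckij s v (F x, y)) mO).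
  exact: measurable_slobodeckij_section.
have mK : measurable_fun (F @^-1` O) (fun x => \int[leb]_(y in F @^-1` O)
    (slobodeckij s v (F x, F y))%:E)%E.
  apply: (measurable_sectioned_integral
    (f := fun p => (slobodeckij s v (F p.1, F p.2))%:E)) => //.
    apply/measurable_EFinP.
    apply: (measurable_comp (measurableX mO mO) _ (measurable_slobodeckij s mO mv)
      (g := fun p => (F p.1, F p.2))).
      by move=> _ [q [? ?] <-].
    apply: measurable_funTS; apply/measurable_fun_pairP; split => /=.
      by apply: (measurableT_comp (measurable_affine_map x0 B)).
    by apply: (measurableT_comp (measurable_affine_map x0 B)).
  by move=> q; rewrite lee_fin slobodeckij_ge0.
rewrite [X in (_ * X <= _)%E]sqr_seminormHs [X in (_ <= _ * X)%E]sqr_seminormHs.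
have -> : (\int[leb]_(x in O) \int[leb]_(y in O) (slobodeckij s v (x, y))%:E =
  (J ^+ 2)%:E * \int[leb]_(x in F @^-1` O) \int[leb]_(y in F @^-1` O)
     (slobodeckij s v (F x, F y))%:E)%E.
  have I0 x : O x ->
      (0 <= \int[leb]_(y in O) (slobodeckij s v (x, y))%:E)%E.
    by move=> _; apply: integral_ge0 => y _; rewrite lee_fin slobodeckij_ge0.
  have -> := ge0_change_of_variables Jac mO
    (measurable_slobodeckij_integral s mO mv) I0.
  rewrite expr2 EFinM -muleA; congr (_ * _)%E.
  rewrite -ge0_integralZl_EFin ?(ltW J0)//; last first.
    by move=> x _; apply: integral_ge0 => y _; rewrite lee_fin slobodeckij_ge0.
  apply: eq_integral => x _.
  have mx : measurable_fun O (fun y => (slobodeckij s v (F x, y))%:E).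
    by apply/measurable_EFinP; exact: measurable_slobodeckij_section.
  have k0 y : O y -> (0 <= (slobodeckij s v (F x, y))%:E)%E.
    by rewrite lee_fin slobodeckij_ge0.
  exact: (ge0_change_of_variables Jac mO mx k0).
rewrite muleCA; apply: lee_wpmul2l; first by rewrite lee_fin sqr_ge0.
have k0 x y : (0 <= (slobodeckij s v (F x, F y))%:E)%E.
  by rewrite lee_fin slobodeckij_ge0.
have kF0 x y : (0 <= (slobodeckij s (fun x => v (F x)) (x, y))%:E)%E.
  by rewrite lee_fin slobodeckij_ge0.
have i0 x : (0 <= \int[leb]_(y in F @^-1` O) (slobodeckij s v (F x, F y))%:E)%E.
  by apply: integral_ge0 => y _; exact: k0.
have iF0 x : (0 <= \int[leb]_(y in F @^-1` O)
    (slobodeckij s (fun x => v (F x)) (x, y))%:E)%E.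
  by apply: integral_ge0 => y _; exact: kF0.
rewrite -(ge0_integralZl_EFin _ mO' (fun x _ => i0 x) mK b'0).
have Kx x : (\int[leb]_(y in F @^-1` O)
      (slobodeckij s (fun x => v (F x)) (x, y))%:E <=
    b'%:E * \int[leb]_(y in F @^-1` O) (slobodeckij s v (F x, F y))%:E)%E.
  rewrite -(ge0_integralZl_EFin _ mO' (fun y _ => k0 x y) (mKx x) b'0).
  have mx : measurable_fun (F @^-1` O)
      (fun y => (slobodeckij s (fun x => v (F x)) (x, y))%:E).
    by apply/measurable_EFinP; exact: measurable_slobodeckij_section.
  have kxy y : ((slobodeckij s (fun x => v (F x)) (x, y))%:E <=
      b'%:E * (slobodeckij s v (F x, F y))%:E)%E.
    by rewrite -EFinM lee_fin kF.
  exact: (ge0_le_integral_cV mO' mx (measurable_funeM _ (mKx x))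
    (fun y _ => kF0 x y) (fun y _ => kxy y)).
exact: (ge0_le_integral_cV mO' (measurable_slobodeckij_integral s mO' mvF)
  (measurable_funeM _ mK) (fun x _ => iF0 x) (fun x _ => Kx x)).
Qed.

End affine_norms.

Section affine_calculus.
Context {R : realType} {n : nat}.
Variables (x0 : 'cV[R]_n) (B : 'M[R]_n).
Local Notation F := (affine_map x0 B).
Implicit Types f : 'cV[R]_n -> R.

Lemma coord_le_mx_norm (x : 'cV[R]_n) i : `|x i ord0| <= `|x|.
Proof.
rewrite [leRHS]/Num.norm /= mx_normrE.
by apply/bigmax_geP; right; exists (i, ord0).
Qed.

Lemma mx_norm_le_coord (x : 'cV[R]_n) r : 0 <= r ->
  (forall i, `|x i ord0| <= r) -> `|x| <= r.
Proof.
move=> r0 xr; rewrite [leLHS]/Num.norm /= mx_normrE.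
by apply/bigmax_leP; split => // -[i j] _ /=; rewrite (ord1 j).
Qed.

Lemma continuous_mulmx : continuous (fun x : 'cV[R]_n => B *m x).
Proof.
have [M M0 BM] := mulmx_coord_bound B.
apply: (@bounded_linear_continuous _ _ _ (mulmx B)).
exists M; split; first exact: num_real.
move=> K MK; apply/nbhs_ballP; exists 1 => //= x; rewrite -ball_normE/= sub0r normrN => x1.
apply: mx_norm_le_coord => [|i]; first by rewrite ltW// (lt_trans _ MK).
apply: (le_trans (BM x 1 _ i)); last by rewrite mulr1 ltW.
by move=> j; rewrite (le_trans (coord_le_mx_norm _ _))// ltW.
Qed.

Lemma differentiable_affine_map x : differentiable F x.
Proof.
rewrite (_ : F = cst x0 + mulmx B); last by apply/funext => y.
apply: differentiableD => //.
by apply: linear_differentiable; exact: continuous_mulmx.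
Qed.

Lemma continuous_affine_map : continuous F.
Proof. by move=> x; apply: differentiable_continuous; exact: differentiable_affine_map. Qed.

Lemma derive_comp_affine f d x : 'D_d (fun y => f (F y)) x = 'D_(B *m d) f (F x).
Proof.
rewrite /derive.
rewrite (_ : (fun h => h^-1 *: _) = fun h =>
   h^-1 *: ((f \o shift (F x)) (h *: (B *m d)) - f (F x)))//.
apply/funext => h /=; congr (h^-1 *: (f _ - _)).
by rewrite /affine_map mulmxDr -scalemxAr addrCA.
Qed.

Lemma smooth_comp_affine f : smooth f -> smooth (fun y => f (F y)).
Proof.
move=> sf ds x.
suff -> : foldr (fun d f => 'D_d f) (fun y => f (F y)) ds =
   (fun y => foldr (fun d f => 'D_d f) f (map (mulmx B) ds) (F y)).
  by apply: differentiable_comp; [exact: differentiable_affine_map|exact: sf].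
elim: ds => // d ds IH /=; rewrite IH; apply/funext => y.
exact: derive_comp_affine.
Qed.

End affine_calculus.

Lemma test_function_comp_affine {R : realType} {n : nat} (x0 : 'cV[R]_n)
    (B : 'M[R]_n) (O : set 'cV[R]_n) (f : 'cV[R]_n -> R) : B \in unitmx ->
  test_function O f ->
  test_function (affine_map x0 B @^-1` O) (fun y => f (affine_map x0 B y)).
Proof.
set F := affine_map x0 B; move=> Bu [sf cf fO].
set G := affine_map (- (invmx B *m x0)) (invmx B).
have FK : cancel F G by exact: affine_mapK.
have sub : closure [set x | f (F x) != 0] `<=` F @^-1` closure [set x | f x != 0].
  move=> x cx U /continuous_affine_map FU.
  by have [y [fy Uy]] := cx _ FU; exists (F y).
split; first exact: smooth_comp_affine.
- have cG : compact (G @` closure [set x | f x != 0]).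
    apply: continuous_compact => //; apply: continuous_subspaceT.
    exact: continuous_affine_map.
  apply: (subclosed_compact _ cG); first exact: closed_closure.
  by move=> x /sub fx; exists (F x) => //; rewrite FK.
by move=> x /sub /fO.
Qed.

Section test_functions.
Context {R : realType} {n : nat}.
Local Notation leb := (@lebesgue_cV R n).
Implicit Types (O : set 'cV[R]_n) (f : 'cV[R]_n -> R).

Lemma integrable_bounded_support f (C : set 'cV[R]_n) (M : R) :
  measurable C -> (leb C < +oo)%E -> measurable_fun setT f ->
  (forall x, `|f x| <= M) -> (forall x, ~ C x -> f x = 0) ->
  leb.-integrable setT (EFin \o f).
Proof.
move=> mC Coo mf fM f0.
have -> : EFin \o f = (EFin \o f) \_ C.
  apply/funext => x; rewrite /patch; case: ifPn => // xC.
  by rewrite /= f0// => Cx; move: xC; rewrite (mem_set Cx).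
apply/integrable_restrict => //; rewrite ?setTI//.
apply: measurable_bounded_integrable => //; first exact: measurable_funTS.
exists M; split; first exact: num_real.
by move=> K MK x _ /=; rewrite (le_trans (fM x))// ltW.
Qed.

Lemma smooth_differentiable f x : smooth f -> differentiable f x.
Proof. by move=> /(_ [::] x). Qed.

Lemma smooth_continuous f : smooth f -> continuous f.
Proof.
by move=> sf x; apply: differentiable_continuous; exact: smooth_differentiable.
Qed.

Lemma smooth_derive f d : smooth f -> smooth ('D_d f).
Proof. by move=> sf ds x; have := sf (rcons ds d) x; rewrite foldr_rcons. Qed.

Lemma test_function_eq0 O f x : test_function O f -> ~ O x -> f x = 0.
Proof.
move=> [_ _ fO] Ox; apply: contrapT => /eqP fx; apply: Ox; apply: fO.
exact: subset_closure.
Qed.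

Lemma derive_support f d :
  closure [set x | 'D_d f x != 0] `<=` closure [set x | f x != 0].
Proof.
rewrite [X in _ `<=` X](closure_id _).1; last exact: closed_closure.
apply: closure_subset => x /eqP fx; apply: contrapT => xK.
apply: fx.
have xf : \near x, f x = (cst 0 : 'cV[R]_n -> R) x.
  have : open (~` closure [set x | f x != 0]).
    by apply: closed_openC; exact: closed_closure.
  move=> oK; have := open_nbhs_nbhs (conj oK xK).
  apply: filterS => y yK; apply: contrapT => /eqP fy; apply: yK.
  exact: subset_closure.
by rewrite (near_eq_derive _ xf) derive_cst.
Qed.

Lemma test_function_derive O f d : test_function O f -> test_function O ('D_d f).
Proof.
move=> [sf cf fO]; split; first exact: smooth_derive.
  by apply: (subclosed_compact _ cf); [exact: closed_closure|exact: derive_support].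
exact: subset_trans (@derive_support _ _) fO.
Qed.

Lemma test_function_bounded O f : test_function O f ->
  exists2 M : R, 0 < M & forall x, `|f x| <= M.
Proof.
move=> tf; have [sf cf _] := tf.
have := @continuous_compact _ _ f _ _ cf.
move=> /(_ (continuous_subspaceT (smooth_continuous sf)))/compact_bounded.
move=> [M [_ /(_ (`|M| + 1))]] MP.
exists (`|M| + 1); first by rewrite ltr_wpDl.
move=> x; have [->|fx] := eqVneq (f x) 0; first by rewrite normr0 addr_ge0.
apply: MP; first by rewrite (le_lt_trans (ler_norm _))// ltrDl.
by exists x => //; exact: subset_closure.
Qed.

Lemma test_function_measurable O f : test_function O f -> measurable_fun setT f.
Proof. by move=> [sf _ _]; by apply: continuous_measurable_cV; apply: smooth_continuous. Qed.

Lemma compact_support_cube O f : test_function O f ->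
  exists2 M : R, 0 < M & forall x, f x != 0 -> forall i, `|x i ord0| <= M.
Proof.
move=> [_ /compact_bounded[M [_ /(_ (`|M| + 1)) MP]] _].
exists (`|M| + 1); first by rewrite ltr_wpDl.
move=> x fx i; rewrite (le_trans (coord_le_mx_norm _ _))//.
apply: MP; first by rewrite (le_lt_trans (ler_norm _))// ltrDl.
exact: subset_closure.
Qed.

Lemma jacobian_shift (a : 'cV[R]_n) : jacobian a 1%:M 1.
Proof.
split=> // A mA; rewrite mul1e -(lebesgue_cV_shift a mA).
by congr (lebesgue_cV _); apply/seteqP; split=> x;
  rewrite /affine_map /= mul1mx addrC.
Qed.

(* Differentiate under the integral sign in t |-> \int f (x + t d) dx, which is
   constant by translation invariance. *)
Lemma integral_derive_test_function O f d : measurable O -> test_function O f ->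
  (\int[leb]_(x in O) ('D_d f x)%:E = 0)%E.
Proof.
move=> mO tf; have tg := test_function_derive d tf.
have [sf _ _] := tf.
rewrite integral_mkcond (_ : _ \_ O = EFin \o 'D_d f); last first.
  apply/funext => x; rewrite /patch; case: ifPn => // xO; congr EFin.
  by apply/esym/(test_function_eq0 tg) => Ox; move: xO; rewrite (mem_set Ox).
have mf := test_function_measurable tf; have mg := test_function_measurable tg.
have [N N0 fN] := compact_support_cube tf.
have [Mf Mf0 fM] := test_function_bounded tf.
have [M M0 gM] := test_function_bounded tg.
have [N' N'0 gN] := compact_support_cube tg.
pose r := N + N' + `|d| + 1.
have r0 : 0 < r by rewrite ltr_wpDl// !addr_ge0// ltW.
pose C : set 'cV[R]_n := cube (- r) r.
have mC : measurable C by exact: measurable_cube.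
have Coo : (leb C < +oo)%E.
  by rewrite lebesgue_cV_cube ?ltry// ge0_cp// ltW.
have outC (h : 'cV[R]_n -> R) K x t : 0 < K -> K <= N + N' -> `|t| < 1 ->
    (forall x, h x != 0 -> forall i, `|x i ord0| <= K) -> ~ C x ->
    h (x + t *: d) = 0.
  move=> K0 KN t1 hK; apply: contra_notP => /eqP /hK xK i.
  have := xK i; rewrite !mxE => xi.
  suff : `|x i ord0| < r by rewrite ltr_norml => /andP[/ltW -> ->].
  rewrite -[x i ord0](addrK (t * d i ord0)).
  rewrite (le_lt_trans (ler_normB _ _))// /r.
  rewrite (@le_lt_trans _ _ (N + N' + `|d|)) ?ltrDl//.
  rewrite lerD ?(le_trans xi)// normrM.
  by rewrite -[leRHS]mul1r ler_pM ?coord_le_mx_norm// ltW.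
have mshift t : measurable_fun setT (fun x : 'cV[R]_n => x + t *: d).
  exact: measurable_cVD.
pose F t x := f (x + t *: d).
have dF x t : derive1 (F^~ x) t = 'D_d f (x + t *: d).
  rewrite derive1E /derive.
  rewrite (_ : (fun h => h^-1 *: _) = fun h =>
   h^-1 *: ((f \o shift (x + t *: d)) (h *: d) - f (x + t *: d)))//.
  apply/funext => h /=; congr (h^-1 *: (f _ - _)).
  by rewrite /F /= scalerDl [h *: 1]mulr1 addrCA.
have G1 : leb.-integrable setT (EFin \o (fun x => M * \1_C x)).
  apply: (@integrable_bounded_support _ C M) => //.
    by apply: measurable_funM.
    move=> x; rewrite indicE; case: (x \in C); rewrite ?mulr1 ?mulr0.
      by rewrite ger0_norm// ltW.
    by rewrite normr0 ltW.
  by move=> x Cx; rewrite indicE memNset ?mulr0.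
have := @cvg_differentiation_under_integral R _ _ leb F setT measurableT 0 (- 1) 1.
move=> /(_ _ _ _ (fun x => M * \1_C x) _ G1) H.
have {H}: h^-1 *: ((fun x' : R => (\int[leb]_y F x' y)%R) (h + 0) -
   (fun x' : R => (\int[leb]_y F x' y)%R) 0) @[h --> 0^'] -->
   (\int[leb]_y partial1of2 F 0 y)%R.
  apply: H.
  - by rewrite /= in_itv/= ltr01 oppr_lt0 ltr01.
  - move=> t; rewrite /= in_itv/= => t1.
    apply: (@integrable_bounded_support _ C Mf) => //.
      exact: (measurableT_comp mf (mshift t)).
      by move=> x; exact: fM.
    move=> x Cx; apply: (outC _ N) => //; first by rewrite lerDl ltW.
    by rewrite ltr_norml.
  - move=> t y _ _; have /(@diff_derivable _ _ _ _ _ d) :=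
      smooth_differentiable (y + t *: d) sf.
    rewrite /derivable.
    rewrite (_ : (fun h => h^-1 *: (_ (h *: d) - _)) = fun h =>
      h^-1 *: (((F^~ y) \o shift t) (h *: 1) - (F^~ y) t))//.
    apply/funext => h /=; congr (h^-1 *: (f _ - _)).
    by rewrite [h%:A]mulr1 scalerDl addrCA.
  - by move=> y; rewrite indicE mulr_ge0 // ltW.
  - move=> t y; rewrite /= in_itv/= => t1 _.
    rewrite /partial1of2 dF indicE; case: (boolP (y \in C)) => yC.
      by rewrite mulr1.
    rewrite (outC ('D_d f) N') ?normr0 ?mulr0// ?lerDr ?(ltW N0)//.
      by rewrite ltr_norml.
    by move=> Cy; move: yC; rewrite (mem_set Cy).
have E t : (\int[leb]_y F t y = \int[leb]_y F 0 y)%R.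
  rewrite /Rintegral (change_of_variables (jacobian_shift (t *: d)) (f := EFin \o F 0))//; last first.
    by apply/measurable_EFinP; exact: (measurableT_comp mf (mshift 0)).
  rewrite mul1e preimage_setT; congr fine; apply: eq_integral => x _.
  by rewrite /F /affine_map /= mul1mx scale0r addr0 addrC.
rewrite (_ : (fun h => h^-1 *: _) = cst 0); last first.
  by apply/funext => h /=; rewrite E subrr scaler0.
move=> H; have : (\int[leb]_y partial1of2 F 0 y)%R = 0.
  by apply/esym/(cvg_unique _ _ H) => //; exact: cvg_cst.
rewrite /Rintegral (_ : (fun y => (partial1of2 F 0 y)%:E) = EFin \o 'D_d f).
  move=> I0; rewrite -[LHS]fineK ?I0//.
  apply: integrable_fin_num => //.
  apply: (integrable_bounded_support mC Coo mg gM) => x Cx.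
  have := outC ('D_d f) N' x 0; rewrite scale0r addr0; apply=> //.
    by rewrite lerDr ltW.
  by rewrite normr0.
by apply/funext => y /=; rewrite /partial1of2 dF scale0r addr0.
Qed.

End test_functions.

Section ereal_squares.
Context {R : realType}.
Local Open Scope ereal_scope.
Implicit Types x y z : \bar R.

Lemma sqreM_EFin (a : R) x : (a%:E * x) ^+ 2 = (a ^+ 2)%:E * x ^+ 2.
Proof. by rewrite !expe2 muleACA -EFinM. Qed.

Lemma le_mul_ereal_inf_sqr x (S : set \bar R) (a c : R) :
  (0 < a)%R -> (0 < c)%R -> 0 <= x -> (forall y, S y -> 0 <= y) ->
  (forall y, S y -> a%:E * x ^+ 2 <= c%:E * y ^+ 2) ->
  a%:E * x ^+ 2 <= c%:E * ereal_inf S ^+ 2.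
Proof.
move=> a0 c0 x0 S0 H; pose r := Num.sqrt (a / c).
have ac0 : (0 < a / c)%R by exact: divr_gt0.
have E y : (c%:E * y ^+ 2 >= a%:E * x ^+ 2) = (y ^+ 2 >= (r%:E * x) ^+ 2).
  rewrite sqreM_EFin sqr_sqrtr ?(ltW ac0)// mulrC EFinM -muleA.
  by rewrite lee_pdivrMl.
rewrite E lee_sqr.
- by apply: le_ereal_inf_tmp => y Sy; apply: lee_sqrE; rewrite ?S0// -E H.
- by rewrite mule_ge0// lee_fin sqrtr_ge0.
- exact: le_ereal_inf_tmp.
Qed.

Lemma le_mul_ereal_inf x (S : set \bar R) (a : R) : (0 < a)%R ->
  (forall y, S y -> x <= a%:E * y) -> x <= a%:E * ereal_inf S.
Proof.
move=> a0 H; rewrite -lee_pdivrMl//; apply: le_ereal_inf_tmp => y Sy.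
by rewrite lee_pdivrMl// H.
Qed.

Lemma lee_chain x y z (a b : R) : (0 <= a)%R ->
  x <= a%:E * y -> y <= b%:E * z -> x <= (a * b)%:E * z.
Proof.
move=> a0 xy yz; rewrite (le_trans xy)// EFinM -muleA.
by rewrite lee_wpmul2l// lee_fin.
Qed.

Lemma lee_weaken x z (a b : R) : (a <= b)%R -> 0 <= z ->
  x <= a%:E * z -> x <= b%:E * z.
Proof. by move=> ab z0 /le_trans; apply; rewrite lee_wpmul2r// lee_fin. Qed.

End ereal_squares.

Section L2_space.
Context {R : realType} {n : nat}.
Local Notation leb := (@lebesgue_cV R n).
Variable O : set 'cV[R]_n.
Hypothesis mO : measurable O.
Implicit Types f g : 'cV[R]_n -> R.

Lemma L2_integrable_sqr f : L2 O f ->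
  leb.-integrable O (fun x => (f x ^+ 2)%:E).
Proof.
move=> /L2P[mf f2]; apply/integrableP; split.
  by apply/measurable_EFinP; exact: measurable_funX.
move: f2; rewrite sqr_normL2; congr (_ < _)%E; apply: eq_integral => x _.
by rewrite gee0_abs// lee_fin sqr_ge0.
Qed.

Lemma L2_le f (h : 'cV[R]_n -> \bar R) : measurable_fun O f ->
  leb.-integrable O h -> (forall x, O x -> ((f x ^+ 2)%:E <= h x)%E) -> L2 O f.
Proof.
move=> mf ih fh; apply/L2P; split=> //; rewrite sqr_normL2.
have /integrableP[mh hoo] := ih.
apply: le_lt_trans hoo; apply: ge0_le_integral_cV => //.
- by apply/measurable_EFinP; exact: measurable_funX.
- exact: measurableT_comp.
- by move=> x _; rewrite lee_fin sqr_ge0.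
by move=> x Ox; rewrite (le_trans (fh x Ox))// lee_abs.
Qed.

Lemma L2D f g : L2 O f -> L2 O g -> L2 O (fun x => f x + g x).
Proof.
move=> Lf Lg.
apply: (@L2_le _ (fun x => 2%:E * (f x ^+ 2)%:E + 2%:E * (g x ^+ 2)%:E)%E).
- by apply: measurable_funD; exact: L2_measurable.
- by apply: integrableD => //; apply: integrableZl => //; exact: L2_integrable_sqr.
move=> x Ox; rewrite -!EFinM -EFinD lee_fin -subr_ge0.
by rewrite (_ : _ - _ = (f x - g x) ^+ 2) ?sqr_ge0//; ring.
Qed.

Lemma L2Z (a : R) f : L2 O f -> L2 O (fun x => a * f x).
Proof.
move=> Lf; apply: (@L2_le _ (fun x => (a ^+ 2)%:E * (f x ^+ 2)%:E)%E).
- by apply: measurable_funM => //; exact: L2_measurable.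
- by apply: integrableZl => //; exact: L2_integrable_sqr.
by move=> x Ox; rewrite -EFinM exprMn.
Qed.

Lemma L2_sum (I : Type) (r : seq I) (f : I -> 'cV[R]_n -> R) :
  (forall i, L2 O (f i)) -> L2 O (fun x => \sum_(i <- r) f i x).
Proof.
move=> Lf; elim: r => [|i r IH].
  under eq_fun do rewrite big_nil.
  apply: (@L2_le _ (cst 0%E)) => //; first exact: integrable0.
  by move=> x _; rewrite expr0n.
by under eq_fun do rewrite big_cons; exact: L2D.
Qed.

Lemma eq_L2 f g : (forall x, O x -> f x = g x) -> L2 O f -> L2 O g.
Proof.
move=> fg Lf; apply: (@L2_le _ (fun x => (f x ^+ 2)%:E)).
- apply: eq_measurable_fun (L2_measurable Lf) => x /set_mem; exact: fg.
- exact: L2_integrable_sqr.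
by move=> x Ox; rewrite fg.
Qed.

Hypothesis Ooo : (leb O < +oo)%E.

Lemma L2_cst (a : R) : L2 O (cst a).
Proof.
apply/L2P; split => //; rewrite sqr_normL2 (integral_cst _ mO (a ^+ 2)%:E) lte_mul_pinfty//.
by rewrite lee_fin sqr_ge0.
Qed.

Lemma L2_mul_bounded_integrable f (h : 'cV[R]_n -> R) (M : R) : L2 O f ->
  measurable_fun O h -> (forall x, O x -> `|h x| <= M) ->
  leb.-integrable O (EFin \o (fun x => f x * h x)).
Proof.
move=> Lf mh hM.
apply: (@le_integrable _ _ _ leb O mO _
  (fun x => (f x ^+ 2)%:E + (M ^+ 2)%:E)%E).
- apply/measurable_EFinP; apply: measurable_funM => //; exact: L2_measurable.
- move=> x Ox /=; rewrite lee_fin.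
  rewrite [leRHS]ger0_norm ?addr_ge0 ?sqr_ge0//.
  rewrite normrM (@le_trans _ _ (`|f x| * M))// ?ler_wpM2l ?hM//.
  have M0 : 0 <= M by exact: le_trans (hM x Ox).
  rewrite -(real_normK (num_real (f x))) -subr_ge0.
  have := sqr_ge0 (`|f x| - M); have := mulr_ge0 (normr_ge0 (f x)) M0; nra.
apply: integrableD => //; first exact: L2_integrable_sqr.
apply: (@measurable_bounded_integrable _ _ _ leb (cst (M ^+ 2))) => //.
exists (`|M ^+ 2|); split; first exact: num_real.
by move=> K MK x _; exact: ltW.
Qed.

Lemma L2_integrable f : L2 O f -> leb.-integrable O (EFin \o f).
Proof.
move=> Lf; have := @L2_mul_bounded_integrable f (cst 1) 1 Lf.
rewrite (_ : EFin \o (fun x => f x * cst 1 x) = EFin \o f); last first.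
  by apply/funext => x; rewrite /= mulr1.
by apply => // x _; rewrite normr1.
Qed.

End L2_space.

Section weak_gradient.
Context {R : realType} {n : nat}.
Local Notation leb := (@lebesgue_cV R n).
Implicit Types (O : set 'cV[R]_n) (v : 'cV[R]_n -> R) (g : 'cV[R]_n -> 'cV[R]_n).

Lemma measurable_enorm_comp O g :
  (forall i, measurable_fun O (fun x => g x i ord0)) ->
  measurable_fun O (fun x => enorm (g x)).
Proof.
move=> mg; have m1 := continuous_measurable_fun (@sqrt_continuous R).
apply: (measurableT_comp m1); apply: measurable_sum => i.
by apply: measurable_funM; exact: mg.
Qed.

Lemma weak_gradient_shift O v g (a : R) : measurable O -> (leb O < +oo)%E ->
  L2 O v -> is_weak_gradient O v g -> is_weak_gradient O (fun x => v x + a) g.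
Proof.
move=> mO Ooo Lv wg i; have [Lg wgi] := wg i; split => // phi tphi.
have tD := test_function_derive (delta_mx i ord0) tphi.
have mD := measurable_funTS (D := O) (test_function_measurable tD).
have [M M0 DM] := test_function_bounded tD.
rewrite -wgi// -[RHS]adde0.
transitivity (\int[leb]_(x in O) ((v x * 'D_(delta_mx i ord0) phi x)%:E +
   (a * 'D_(delta_mx i ord0) phi x)%:E))%E.
  by apply: eq_integral => x _; rewrite -EFinD mulrDl.
rewrite integralD//=; last 2 first.
- exact: (L2_mul_bounded_integrable mO Ooo Lv mD (fun x _ => DM x)).
- exact: (L2_mul_bounded_integrable mO Ooo (L2_cst mO Ooo a) mD (fun x _ => DM x)).
congr (_ + _)%E; under eq_integral do rewrite EFinM.
rewrite integralZl//.
  by rewrite integral_derive_test_function// mule0.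
have := L2_mul_bounded_integrable mO Ooo (L2_cst mO Ooo 1) mD (fun x _ => DM x).
by apply: eq_integrable => // x _; rewrite /= mul1r.
Qed.

Lemma seminormH1_ge0 O v : (0 <= seminormH1 O v)%E.
Proof. by apply: le_ereal_inf_tmp => _ [g _ <-]; exact: normL2_ge0. Qed.

Lemma seminormH1_shift_le O v (a : R) : measurable O -> (leb O < +oo)%E ->
  L2 O v -> (seminormH1 O (fun x => v x + a)%R <= seminormH1 O v)%E.
Proof.
move=> mO Ooo Lv; apply: le_ereal_inf_tmp => _ [g wg <-].
by apply: ereal_inf_lbound; exists g => //; exact: weak_gradient_shift.
Qed.

Lemma H1_shift O v (a : R) : measurable O -> (leb O < +oo)%E ->
  H1 O v -> H1 O (fun x => v x + a).
Proof.
move=> mO Ooo [Lv [g wg]]; split; first by apply: L2D => //; exact: L2_cst.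
by exists g; exact: weak_gradient_shift.
Qed.

Section affine.
Variables (x0 : 'cV[R]_n) (B : 'M[R]_n) (J b : R).
Hypotheses (Bu : B \in unitmx) (Jac : jacobian x0 B J) (b_gt0 : 0 < b).
Hypothesis Bb : forall x, enorm (B *m x) <= b * enorm x.
Local Notation F := (affine_map x0 B).
Variable O : set 'cV[R]_n.
Hypotheses (mO : measurable O) (Ooo : (leb O < +oo)%E).

Lemma weak_gradient_affine v g : L2 O v -> is_weak_gradient O v g ->
  is_weak_gradient (F @^-1` O) (fun x => v (F x)) (fun x => B^T *m g (F x)).
Proof.
move=> Lv wg i.
have mO' := measurable_preimage_affine x0 B mO.
have LgF j : L2 (F @^-1` O) (fun x => g (F x) j ord0).
  by have [Lg _] := wg j; exact: (L2_affine Jac mO Lg).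
split.
  apply: (@eq_L2 _ _ _ mO' (fun x => \sum_j B j i * g (F x) j ord0)).
    by move=> x _; rewrite mxE; apply: eq_bigr => j _; rewrite mxE.
  by apply: L2_sum => // j; exact: L2Z.
move=> phi tphi.
set G := affine_map (- (invmx B *m x0)) (invmx B).
pose psi y := phi (G y).
have phiE : phi = fun x => psi (F x).
  by apply/funext => x; rewrite /psi /G affine_mapK.
have Bu' : invmx B \in unitmx by rewrite unitmx_inv.
have tpsi : test_function O psi.
  have := test_function_comp_affine (- (invmx B *m x0)) Bu' tphi.
  by rewrite preimage_affine_mapK.
have [spsi _ _] := tpsi.
have tD j := test_function_derive (delta_mx j ord0) tpsi.
have mD j := measurable_funTS (D := O) (test_function_measurable (tD j)).
have mpsi := measurable_funTS (D := O) (test_function_measurable tpsi).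
have [M M0 psiM] := test_function_bounded tpsi.
have DE x : 'D_(delta_mx i ord0) phi x =
    \sum_j B j i * 'D_(delta_mx j ord0) psi (F x).
  rewrite phiE derive_comp_affine deriveE; last exact: smooth_differentiable.
  rewrite (_ : B *m delta_mx i ord0 = \sum_j B j i *: delta_mx j ord0).
    rewrite linear_sum; apply: eq_bigr => j _; rewrite linearZ/=.
    by rewrite -deriveE//; exact: smooth_differentiable.
  rewrite -colE [LHS]matrix_sum_delta; apply: eq_bigr => j _.
  by rewrite big_ord1 mxE.
have lin (f : 'I_n -> 'cV[R]_n -> R) (h : 'cV[R]_n -> R) :
    (forall j, leb.-integrable O (EFin \o f j)) ->
    (forall x, h x = \sum_j B j i * f j (F x)) ->
    (\int[leb]_(x in F @^-1` O) (h x)%:E =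
     (J^-1 * \sum_j (B j i * fine (\int[leb]_(x in O) (f j x)%:E)))%:E)%E.
  move=> fi hE.
  have Bfi j : leb.-integrable O (fun x => (B j i)%:E * (f j x)%:E)%E.
    exact: (integrableZl mO (B j i) (fi j)).
  have sfi : leb.-integrable O (fun x => \sum_j (B j i)%:E * (f j x)%:E)%E.
    by apply: integrable_sum.
  have [J0 _] := Jac.
  transitivity (J^-1%:E * (\int[leb]_(x in O) \sum_j (B j i)%:E * (f j x)%:E))%E.
    rewrite (change_of_variables Jac mO (measurable_int _ sfi)).
    rewrite muleA -EFinM mulVf ?gt_eqF// mul1e; apply: eq_integral => x _.
    by rewrite hE -sumEFin; apply: eq_bigr => j _; rewrite EFinM.
  rewrite integral_sum// EFinM -sumEFin; congr (_ * _)%E.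
  apply: eq_bigr => j _; rewrite (integralZl mO (fi j)) [RHS]EFinM fineK//.
  exact: (integrable_fin_num mO (fi j)).
rewrite (lin (fun j x => v x * 'D_(delta_mx j ord0) psi x)); last 2 first.
- move=> j; have [M' _ DM] := test_function_bounded (tD j).
  exact: (L2_mul_bounded_integrable mO Ooo Lv (mD j) (fun x _ => DM x)).
- by move=> x; rewrite DE mulr_sumr; apply: eq_bigr => j _; rewrite mulrCA.
rewrite (lin (fun j x => g x j ord0 * psi x)); last 2 first.
- move=> j; have [Lg _] := wg j.
  exact: (L2_mul_bounded_integrable mO Ooo Lg mpsi (fun x _ => psiM x)).
- move=> x; rewrite mxE mulr_suml; apply: eq_bigr => j _.
  by rewrite mxE phiE mulrA.
rewrite -EFinN -mulrN -sumrN; congr (_ * _)%:E; apply: eq_bigr => j _.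
by rewrite -mulrN; have [_ ->//] := wg j; rewrite fineN.
Qed.

Lemma normL2_trmx_affine g : (forall i, L2 O (fun x => g x i ord0)) ->
  (J%:E * normL2 (F @^-1` O) (fun x => enorm (B^T *m g (F x))) ^+ 2 <=
   (b ^+ 2)%:E * normL2 O (fun x => enorm (g x)) ^+ 2)%E.
Proof.
move=> Lg; have mg i := L2_measurable (Lg i).
have me := measurable_enorm_comp mg.
have mO' := measurable_preimage_affine x0 B mO.
rewrite [in leRHS](sqr_normL2_affine Jac mO me) [leRHS]muleCA.
have [J0 _] := Jac; apply: lee_wpmul2l; first by rewrite lee_fin ltW.
rewrite !sqr_normL2.
have mgF i : measurable_fun (F @^-1` O) (fun x => g (F x) i ord0).
  exact: (L2_measurable (L2_affine Jac mO (Lg i))).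
have mBg i : measurable_fun (F @^-1` O) (fun x => (B^T *m g (F x)) i ord0).
  under eq_fun do rewrite mxE.
  by apply: measurable_sum => j; apply: measurable_funM.
have sq (f : 'cV[R]_n -> 'cV[R]_n) :
    (forall i, measurable_fun (F @^-1` O) (fun x => f x i ord0)) ->
    measurable_fun (F @^-1` O) (fun x => (enorm (f x) ^+ 2)%:E).
  move=> mf; apply/measurable_EFinP; apply: measurable_funX.
  exact: measurable_enorm_comp.
rewrite -ge0_integralZl_EFin ?sqr_ge0//; last 2 first.
- by move=> x _; rewrite lee_fin sqr_ge0.
- exact: sq.
apply: (ge0_le_integral_cV mO' (sq _ mBg)).
- by apply: measurable_funeM; exact: sq.
- by move=> x _; rewrite lee_fin sqr_ge0.
move=> x _; rewrite -EFinM lee_fin -exprMn.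
rewrite ler_pXn2r ?nnegrE ?enorm_ge0 ?mulr_ge0 ?enorm_ge0//; last exact: ltW.
exact: mulmx_trmx_enorm.
Qed.

Lemma H1_affine v : H1 O v -> H1 (F @^-1` O) (fun x => v (F x)).
Proof.
move=> [Lv [g wg]]; split; first exact: (L2_affine Jac mO Lv).
by eexists; exact: weak_gradient_affine wg.
Qed.

Lemma seminormH1_affine v : L2 O v ->
  (J%:E * seminormH1 (F @^-1` O) (fun x => v (F x)) ^+ 2 <=
   (b ^+ 2)%:E * seminormH1 O v ^+ 2)%E.
Proof.
move=> Lv; have [J0 _] := Jac; apply: le_mul_ereal_inf_sqr => //.
- by rewrite exprn_gt0.
- exact: seminormH1_ge0.
- by move=> _ [g _ <-]; exact: normL2_ge0.
move=> _ [g wg <-].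
apply: le_trans (normL2_trmx_affine (fun i => (wg i).1)).
apply: lee_wpmul2l; first by rewrite lee_fin ltW.
rewrite lee_sqr ?normL2_ge0 ?seminormH1_ge0//; apply: ereal_inf_lbound.
by eexists; [exact: weak_gradient_affine wg|].
Qed.

End affine.
End weak_gradient.

Section K_functional.
Context {R : realType} {n : nat}.
Local Notation leb := (@lebesgue_cV R n).
Local Notation mu := (@lebesgue_measure R).
Local Open Scope ereal_scope.
Implicit Types (N : set 'cV[R]_n -> ('cV[R]_n -> R) -> \bar R).
Implicit Types (O : set 'cV[R]_n) (v : 'cV[R]_n -> R) (s t : R).

Definition K_functional N O v t : \bar R :=
  ereal_inf [set normL2 O w.1 ^+ 2 + (t ^+ 2)%:E * N O w.2 ^+ 2
            | w in decomposition O v].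

Lemma K_functional_ge0 N O v t : 0 <= K_functional N O v t.
Proof.
apply: le_ereal_inf_tmp => _ [w _ <-].
by rewrite adde_ge0 ?sqre_ge0// mule_ge0 ?sqre_ge0// lee_fin sqr_ge0.
Qed.

Lemma K_functional_nondecreasing N O v t t' : (0 <= t)%R -> (t <= t')%R ->
  K_functional N O v t <= K_functional N O v t'.
Proof.
move=> t0 tt'; apply: le_ereal_inf_tmp => _ [w wv <-].
apply: (@le_trans _ _ (normL2 O w.1 ^+ 2 + (t ^+ 2)%:E * N O w.2 ^+ 2)).
  by apply: ereal_inf_lbound; exists w.
rewrite leeD2l// lee_wpmul2r ?sqre_ge0// lee_fin.
by rewrite ler_pXn2r// nnegrE (le_trans t0).
Qed.

Lemma measurable_K_functional N O v :
  measurable_fun (`]0%R, +oo[ : set R) (K_functional N O v).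
Proof.
apply: (measurability _ (ErealGenOInfty.measurableE R)) => //.
move=> /= _ [_ [a ->]] <-; apply: is_interval_measurable => x y.
move=> [/= x0 ax] [/= y0 ay] z /andP[xz zy]; split.
  by move: x0; rewrite /= !in_itv/= !andbT => /lt_le_trans; apply.
move: ax; rewrite /= !in_itv/= !andbT => /lt_le_trans; apply.
apply: K_functional_nondecreasing => //.
by move: x0; rewrite in_itv/= andbT => /ltW.
Qed.

Definition interpolation_density s (k : R -> \bar R) t : \bar R :=
  (t `^ (- (2 * s)))%:E * k t * (t^-1)%:E.

Lemma interpolation_density_ge0 s (k : R -> \bar R) t : (0 < t)%R ->
  0 <= k t -> 0 <= interpolation_density s k t.
Proof.
by move=> t0 k0; rewrite !mule_ge0 ?lee_fin ?powR_ge0 ?invr_ge0// ltW.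
Qed.

Lemma measurable_invr : measurable_fun (`]0%R, +oo[ : set R) (fun t : R => t^-1)%R.
Proof.
apply: (@eq_measurable_fun _ _ _ _ _ (fun t : R => t `^ (-1))%R).
  move=> t; rewrite inE/= in_itv/= andbT => t0.
  by rewrite powR_inv1// ltW.
by apply: measurable_funTS; exact: measurable_powR.
Qed.

Lemma measurable_interpolation_density s (k : R -> \bar R) :
  measurable_fun (`]0%R, +oo[ : set R) k ->
  measurable_fun (`]0%R, +oo[ : set R) (interpolation_density s k).
Proof.
move=> mk; apply: emeasurable_funM.
  apply: emeasurable_funM => //; apply/measurable_EFinP.
  by apply: measurable_funTS; exact: measurable_powR.
by apply/measurable_EFinP; exact: measurable_invr.
Qed.

Lemma sqr_interpolation N s O v : interpolation N s O v ^+ 2 =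
  \int[mu]_(t in `]0%R, +oo[) interpolation_density s (K_functional N O v) t.
Proof.
rewrite sqr_sqrte// integral_ge0// => t; rewrite /= in_itv/= andbT => t0.
exact: (interpolation_density_ge0 s t0 (K_functional_ge0 N O v t)).
Qed.

Lemma le_interpolation (k k' : R -> \bar R) s :
  measurable_fun (`]0%R, +oo[ : set R) k ->
  measurable_fun (`]0%R, +oo[ : set R) k' ->
  (forall t, (0 < t)%R -> 0 <= k t) ->
  (forall t, (0 < t)%R -> k t <= k' t) ->
  \int[mu]_(t in `]0%R, +oo[) interpolation_density s k t <=
  \int[mu]_(t in `]0%R, +oo[) interpolation_density s k' t.
Proof.
move=> mk mk' k0 kk'; apply: ge0_le_integral => //.
- move=> t; rewrite /= in_itv/= andbT => t0.
  by apply: interpolation_density_ge0 => //; exact: k0.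
- exact: measurable_interpolation_density.
- exact: measurable_interpolation_density.
move=> t; rewrite /= in_itv/= andbT => t0.
rewrite lee_wpmul2r ?lee_fin ?invr_ge0 ?(ltW t0)//.
by rewrite lee_wpmul2l ?lee_fin ?powR_ge0// kk'.
Qed.

Lemma seminormI_ge0 s O v : 0 <= seminormI s O v.
Proof. exact: sqrte_ge0. Qed.

Lemma normI_ge0 s O v : 0 <= normI s O v.
Proof. exact: sqrte_ge0. Qed.

Lemma sqr_normH1 O v :
  normH1 O v ^+ 2 = normL2 O v ^+ 2 + seminormH1 O v ^+ 2.
Proof. by rewrite sqr_sqrte// adde_ge0 ?sqre_ge0. Qed.

Lemma sqr_seminormI_le_normI s O v : seminormI s O v ^+ 2 <= normI s O v ^+ 2.
Proof.
rewrite !sqr_interpolation; apply: le_interpolation.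
- exact: measurable_K_functional.
- exact: measurable_K_functional.
- by move=> t _; exact: K_functional_ge0.
move=> t t0; apply: le_ereal_inf_tmp => _ [w wv <-].
apply: (@le_trans _ _ (normL2 O w.1 ^+ 2 + (t ^+ 2)%:E * seminormH1 O w.2 ^+ 2)).
  by apply: ereal_inf_lbound; exists w.
rewrite leeD2l// lee_wpmul2l ?lee_fin ?sqr_ge0// sqr_normH1.
by rewrite leeDr// sqre_ge0.
Qed.

Lemma decomposition_shift O v (a : R) w : measurable O -> leb O < +oo ->
  decomposition O v w ->
  decomposition O (fun x => v x + a)%R (w.1, fun x => w.2 x + a)%R.
Proof.
move=> mO Ooo [L1 H2 [A [mA A0 Av]]]; split => //=; first exact: H1_shift.
exists A; split => // x /= h; apply: Av => /= h'; apply: h => Ox.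
by rewrite h'// addrA.
Qed.

Lemma sqr_seminormI_shift_le s O v (a : R) : measurable O -> leb O < +oo ->
  seminormI s O (fun x => v x + a)%R ^+ 2 <= seminormI s O v ^+ 2.
Proof.
move=> mO Ooo; rewrite !sqr_interpolation; apply: le_interpolation.
- exact: measurable_K_functional.
- exact: measurable_K_functional.
- by move=> t _; exact: K_functional_ge0.
move=> t t0; apply: le_ereal_inf_tmp => _ [w wv <-].
have [_ [Lw2 _] _] := wv.
apply: (@le_trans _ _ (normL2 O w.1 ^+ 2 +
    (t ^+ 2)%:E * seminormH1 O (fun x => w.2 x + a)%R ^+ 2)).
  apply: ereal_inf_lbound; exists (w.1, fun x => w.2 x + a)%R => //.
  exact: decomposition_shift.
rewrite leeD2l// lee_wpmul2l ?lee_fin ?sqr_ge0//.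
by rewrite lee_sqr ?seminormH1_ge0// seminormH1_shift_le.
Qed.

Lemma sqr_seminormI_shift s O v (a : R) : measurable O -> leb O < +oo ->
  seminormI s O (fun x => v x + a)%R ^+ 2 = seminormI s O v ^+ 2.
Proof.
move=> mO Ooo; apply: le_anti; apply/andP; split.
  exact: sqr_seminormI_shift_le.
have := @sqr_seminormI_shift_le s O (fun x => v x + a)%R (- a) mO Ooo.
by under eq_fun do rewrite addrK.
Qed.

End K_functional.

Section interpolation_affine.
Context {R : realType} {n : nat}.
Local Notation leb := (@lebesgue_cV R n).
Local Notation mu := (@lebesgue_measure R).

Lemma integral_dilation (f : R -> \bar R) (b : R) : 0 < b ->
  measurable_fun (`]0, +oo[ : set R) f ->
  (forall t, 0 < t -> (0 <= f t)%E) ->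
  (\int[mu]_(t in `]0%R, +oo[) f t =
   b%:E * \int[mu]_(t in `]0%R, +oo[) f (b * t)%R)%E.
Proof.
move=> b0 mf f0.
have mb : measurable_fun setT (( *%R b) : measurableTypeR R -> measurableTypeR R).
  exact: measurable_funM.
have D : (( *%R b) : measurableTypeR R -> measurableTypeR R) @^-1`
    `]0, +oo[%classic = `]0, +oo[%classic.
  by apply/seteqP; split=> t; rewrite /= !in_itv/= !andbT pmulr_rgt0.
have f0' : {in `]0, +oo[%classic, forall t, (0 <= f t)%E}.
  by move=> t; rewrite inE/= in_itv/= andbT; exact: f0.
have := @ge0_integral_pushforward _ _ _ _ R _ mb mu _ f (measurable_itv _) mf f0'.
rewrite D => <-.
rewrite -(ge0_integral_mscale _ _ (NngNum (ltW b0)))//; last first.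
  by move=> t; rewrite /= in_itv/= andbT; exact: f0.
apply: eq_measure_integral => A mA _; apply/esym.
transitivity (b%:E * mu [set x | A (b * x)%R])%E; first by [].
by rewrite pushforward_lebesgue_scale// muleA -EFinM mulfV ?gt_eqF// mul1e.
Qed.

Variables (x0 : 'cV[R]_n) (B : 'M[R]_n) (J b : R).
Hypotheses (Bu : B \in unitmx) (Jac : jacobian x0 B J) (b_gt0 : 0 < b).
Hypothesis Bb : forall x, enorm (B *m x) <= b * enorm x.
Local Notation F := (affine_map x0 B).
Variable O : set 'cV[R]_n.
Hypotheses (mO : measurable O) (Ooo : (leb O < +oo)%E).

Lemma decomposition_affine v w : decomposition O v w ->
  decomposition (F @^-1` O) (fun x => v (F x))
    (fun x => w.1 (F x), fun x => w.2 (F x)).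
Proof.
have [J0 JE] := Jac.
move=> [L1 H2 [A [mA A0 Av]]]; split => /=; first exact: (L2_affine Jac mO L1).
  exact: (H1_affine Bu Jac mO Ooo H2).
exists (F @^-1` A); split.
- by rewrite -[X in measurable X]setTI; apply: measurable_affine_map.
- move/eqP: A0; rewrite JE// mule_eq0 eqe gt_eqF//= => /eqP //.
- by move=> x /= h; apply: Av.
Qed.

Lemma sqr_seminormI_affine s v :
  (J%:E * seminormI s (F @^-1` O) (fun x => v (F x)) ^+ 2 <=
   (b `^ (2 * s))%:E * seminormI s O v ^+ 2)%E.
Proof.
have [J0 _] := Jac.
rewrite [X in (_ * X <= _)%E]sqr_interpolation [X in (_ <= _ * X)%E]sqr_interpolation.
set k := K_functional _ O v; set kF := K_functional _ _ _.
have mk : measurable_fun (`]0, +oo[ : set R) k by exact: measurable_K_functional.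
have mkF : measurable_fun (`]0, +oo[ : set R) kF by exact: measurable_K_functional.
have Kk t : 0 < t -> (J%:E * kF t <= k (b * t)%R)%E.
  move=> t0; apply: le_ereal_inf_tmp => _ [w wv <-].
  have [L1 [L2w _] _] := wv.
  apply: (@le_trans _ _ (J%:E * (
      normL2 (F @^-1` O) (fun x => w.1 (F x)) ^+ 2 +
      (t ^+ 2)%:E * seminormH1 (F @^-1` O) (fun x => w.2 (F x)) ^+ 2))%E).
    apply: lee_wpmul2l; first by rewrite lee_fin ltW.
    apply: ereal_inf_lbound; exists (fun x => w.1 (F x), fun x => w.2 (F x)) => //.
    exact: decomposition_affine.
  rewrite ge0_muleDr ?sqre_ge0//; last first.
    by rewrite mule_ge0 ?sqre_ge0// lee_fin sqr_ge0.
  rewrite -(sqr_normL2_affine Jac mO (L2_measurable L1)) leeD2l//.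
  rewrite exprMn [leLHS]muleCA (mulrC (b ^+ 2)) [in leRHS]EFinM -[leRHS]muleA lee_wpmul2l ?lee_fin ?sqr_ge0//.
  exact: (seminormH1_affine Bu Jac b_gt0 Bb mO Ooo).
have k0 t : (0 <= k t)%E by exact: K_functional_ge0.
have kF0 t : (0 <= kF t)%E by exact: K_functional_ge0.
clearbody k kF.
have dk0 t : 0 < t -> (0 <= interpolation_density s k t)%E.
  by move=> t0; apply: interpolation_density_ge0.
have dkF0 t : 0 < t -> (0 <= interpolation_density s kF t)%E.
  by move=> t0; apply: interpolation_density_ge0.
have mkb : measurable_fun (`]0, +oo[ : set R) (fun t => k (b * t)%R).
  apply: (measurable_comp (measurable_itv `]0, +oo[) _ mk).
    by move=> _ [t + <-]; rewrite /= !in_itv/= !andbT pmulr_rgt0.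
  exact: measurable_funM.
have gE t : 0 < t -> ((b `^ (2 * s))%:E * (b%:E *
    interpolation_density s k (b * t)%R) =
    interpolation_density s (fun t => k (b * t)%R) t)%E.
  move=> t0; rewrite /interpolation_density !muleA -!EFinM.
  rewrite muleAC -EFinM [RHS]muleAC -EFinM; congr (_%:E * _)%E.
  rewrite powRM ?(ltW t0) ?(ltW b_gt0)// [in LHS]powRN.
  field; rewrite !gt_eqF ?powR_gt0//.
have -> : ((b `^ (2 * s))%:E *
    \int[mu]_(t in `]0%R, +oo[) interpolation_density s k t =
    \int[mu]_(t in `]0%R, +oo[) interpolation_density s (fun t => k (b * t)%R) t)%E.
  have mdk := measurable_interpolation_density s mk.
  rewrite (integral_dilation b_gt0 mdk dk0).
  have mdkb : measurable_fun (`]0, +oo[ : set R)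
      (fun t => interpolation_density s k (b * t)%R).
    apply: (measurable_comp (measurable_itv `]0, +oo[) _ mdk).
      by move=> _ [t + <-]; rewrite /= !in_itv/= !andbT pmulr_rgt0.
    exact: measurable_funM.
  have dkb0 t : t \in `]0, +oo[ -> (0 <= interpolation_density s k (b * t)%R)%E.
    by rewrite in_itv/= andbT => t0; rewrite dk0// mulr_gt0.
  rewrite -[X in (_ * X)%E]ge0_integralZl_EFin;
    [|exact: measurable_itv|exact: dkb0|exact: mdkb|exact: ltW].
  rewrite -ge0_integralZl_EFin ?powR_ge0//; last 2 first.
  - by move=> t /dkb0 h; rewrite mule_ge0// lee_fin ltW.
  - exact: measurable_funeM.
  by apply: eq_integral => t; rewrite inE/= in_itv/= andbT; exact: gE.
have -> : (J%:E * \int[mu]_(t in `]0%R, +oo[) interpolation_density s kF t =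
    \int[mu]_(t in `]0%R, +oo[)
      interpolation_density s (fun t => J%:E * kF t) t)%E.
  rewrite -ge0_integralZl_EFin ?(ltW J0)//; last 2 first.
  - by move=> t; rewrite /= in_itv/= andbT; exact: dkF0.
  - exact: measurable_interpolation_density.
  apply: eq_integral => t _; rewrite /interpolation_density !muleA.
  by congr (_ * _ * _)%E; rewrite muleC.
apply: le_interpolation => //.
- exact: measurable_funeM.
- by move=> t _; rewrite mule_ge0// lee_fin ltW.
Qed.

End interpolation_affine.

(** * Norms versus semi-norms on one domain *)

Section power_integrals.
Context {R : realType}.
Local Notation mu := (@lebesgue_measure R).

Lemma continuous_powR (p t : R) : 0 < t -> {for t, continuous (fun x : R => x `^ p)}.
Proof.
move=> t0; apply: differentiable_continuous; apply/derivable1_diffP.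
by have [] := is_derive1_powR p t0.
Qed.

Lemma integral_powR_itv (p x y : R) : p != 0 -> 0 < x -> x < y ->
  (\int[mu]_(t in `[x, y]) (t `^ (p - 1))%:E = ((y `^ p - x `^ p) / p)%:E)%E.
Proof.
move=> p0 x0 xy; have y0 := lt_trans x0 xy.
rewrite (@continuous_FTC2 R _ (fun t => p^-1 * t `^ p))//; last 3 first.
- apply: continuous_in_subspaceT => t; rewrite inE/= in_itv/= => /andP[xt _].
  by apply: continuous_powR; exact: lt_le_trans x0 xt.
- have cc t : 0 < t -> {for t, continuous (fun t : R => p^-1 * t `^ p)}.
    by move=> t0; apply: continuousM; [exact: cvg_cst|exact: continuous_powR].
  split.
  + move=> t; rewrite in_itv/= => /andP[xt _].
    apply: derivableM; first exact: derivable_cst.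
    by have [] := is_derive1_powR p (lt_trans x0 xt).
  + apply: cvg_at_right_filter; exact: cc.
  + apply: cvg_at_left_filter; exact: cc.
- move=> t; rewrite in_itv/= => /andP[xt _].
  have t0 := lt_trans x0 xt.
  have [dp Dp] := is_derive1_powR p t0.
  rewrite derive1E deriveMl// Dp.
  by rewrite mulrA mulVf// mul1r.
by rewrite -EFinB; congr EFin; field.
Qed.

Lemma integral_powR_bigcup_le (p C : R) (D : (set R)^nat) :
  {homo D : i j / (i <= j)%N >-> i `<=` j} -> (forall k, measurable (D k)) ->
  (forall k, \int[mu]_(t in D k) (t `^ p)%:E <= C%:E)%E ->
  (\int[mu]_(t in \bigcup_k D k) (t `^ p)%:E <= C%:E)%E.
Proof.
move=> ndD mD DC.
have mf E : measurable_fun E (fun t : R => (t `^ p)%:E).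
  by apply/measurable_EFinP; apply: measurable_funTS; exact: measurable_powR.
have f0 k t : D k t -> (0 <= (t `^ p)%:E)%E by rewrite lee_fin powR_ge0.
have ndD' : {homo D : i j / (i <= j)%N >-> (i <= j)%O}.
  by move=> i j /ndD/subsetPset.
have H := ge0_nondecreasing_set_cvg_integral (mu := mu) ndD' mD (fun k => mf (D k)) f0.
by apply: (cvge_to_le H); apply: nearW => k; exact: DC.
Qed.

Lemma integral_powR_le_near0 (p : R) : 0 < p ->
  (\int[mu]_(t in `]0%R, 1%R]) (t `^ (p - 1))%:E <= (p^-1)%:E)%E.
Proof.
move=> p0; pose D (k : nat) : set R := `[k.+2%:R^-1, 1]%classic.
have -> : `]0%R, 1%R]%classic = \bigcup_k D k.
  apply/seteqP; split=> t /=.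
    rewrite in_itv/= => /andP[t0 t1].
    exists (Num.truncn t^-1) => //; rewrite /D/= in_itv/= t1 andbT.
    rewrite -[leRHS]invrK lef_pV2 ?posrE ?invr_gt0//.
    by rewrite (le_trans (ltW (truncnS_gt _)))// ler_nat.
  move=> [k _]; rewrite /D/= !in_itv/= => /andP[kt ->]; rewrite andbT.
  by apply: lt_le_trans kt; rewrite invr_gt0.
apply: integral_powR_bigcup_le => [i j ij t|k|k].
- rewrite /D/= !in_itv/= => /andP[it ->].
  by rewrite andbT (le_trans _ it)// lef_pV2 ?posrE// ler_nat.
- exact: measurable_itv.
rewrite integral_powR_itv ?gt_eqF ?invr_gt0//; last first.
  by rewrite invf_lt1 ?ltr1n.
rewrite lee_fin powR1 ler_pdivrMr// mulVf ?gt_eqF// gerBl powR_ge0//.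
Qed.

Lemma integral_powR_le_infty (p : R) : 0 < p ->
  (\int[mu]_(t in `]1%R, +oo[) (t `^ (- p - 1))%:E <= (p^-1)%:E)%E.
Proof.
move=> p0; pose D (k : nat) : set R := `[1, k.+2%:R]%classic.
apply: (@le_trans _ _ (\int[mu]_(t in `[1%R, +oo[) (t `^ (- p - 1))%:E)%E).
  apply: ge0_subset_integral => //.
  - by apply/measurable_EFinP; apply: measurable_funTS; exact: measurable_powR.
  - by move=> t _; rewrite lee_fin powR_ge0.
  - by move=> t; rewrite /= !in_itv/= !andbT => /ltW.
have -> : `[1%R, +oo[%classic = \bigcup_k D k.
  apply/seteqP; split=> t /=.
    rewrite in_itv/= andbT => t1; exists (Num.truncn t) => //.
    rewrite /D/= in_itv/= t1/=.
    by rewrite (le_trans (ltW (truncnS_gt _)))// ler_nat.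
  by move=> [k _]; rewrite /D/= !in_itv/= andbT => /andP[].
apply: integral_powR_bigcup_le => [i j ij t|k|k].
- rewrite /D/= !in_itv/= => /andP[-> ti]/=.
  by rewrite (le_trans ti)// ler_nat.
- exact: measurable_itv.
rewrite integral_powR_itv ?oppr_eq0 ?gt_eqF ?ltr1n//.
rewrite lee_fin powR1 -[leLHS]mulrNN -invrN opprK opprB ler_pdivrMr//.
by rewrite mulVf ?gt_eqF// gerBl powR_ge0.
Qed.

End power_integrals.

Section interpolation_norm_bound.
Context {R : realType} {n : nat}.
Local Notation leb := (@lebesgue_cV R n).
Local Notation mu := (@lebesgue_measure R).
Implicit Types (O : set 'cV[R]_n) (v : 'cV[R]_n -> R).

Lemma weak_gradient0 O : measurable O -> (leb O < +oo)%E ->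
  is_weak_gradient O (cst 0%R) (cst 0%R).
Proof.
move=> mO Ooo i; split.
  apply: (@eq_L2 _ _ _ mO (cst 0%R)); last exact: L2_cst.
  by move=> x _; rewrite mxE.
move=> phi _; rewrite !integral0_eq ?oppe0// => x _.
  by rewrite mxE mul0r.
by rewrite mul0r.
Qed.

Lemma sqr_normL20 O : (normL2 O (cst 0%R) ^+ 2 = 0)%E.
Proof. by rewrite sqr_normL2 integral0_eq// => x _; rewrite expr0n. Qed.

Lemma sqr_normH10 O : measurable O -> (leb O < +oo)%E ->
  (normH1 O (cst 0%R) ^+ 2 = 0)%E.
Proof.
move=> mO Ooo; rewrite sqr_normH1 sqr_normL20 add0e.
apply: le_anti; rewrite sqre_ge0 andbT -(sqr_normL20 O).
rewrite lee_sqr ?seminormH1_ge0 ?normL2_ge0//.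
apply: ereal_inf_lbound; exists (cst 0%R); first exact: weak_gradient0.
by congr (normL2 O _); apply/funext => x; rewrite enorm0.
Qed.

(* Bounds the extra L2 term of the K-functional of the full H1 norm; its weighted
   integral (1 + s) / (2 s (1 - s)) is where 1 / (s (1 - s)) comes from. *)
Definition cutoff (t : R) : R := if t <= 1 then 2 * t ^+ 2 else 1.

Lemma K_functional_normH1_le1 O v t m : measurable O ->
  (normL2 O v ^+ 2 = m%:E)%E -> L2 O v -> 0 < t -> t <= 1 ->
  (K_functional normH1 O v t <=
   3%:E * K_functional seminormH1 O v t + (2 * t ^+ 2 * m)%:E)%E.
Proof.
move=> mO vm Lv t0 t1; rewrite -leeBlDr//; apply: le_mul_ereal_inf => // _ [w wv <-].
rewrite leeBlDr//.
have [L1 [L2w _] [A [mA A0 Av]]] := wv.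
apply: (@le_trans _ _ (normL2 O w.1 ^+ 2 + (t ^+ 2)%:E * normH1 O w.2 ^+ 2)%E).
  by apply: ereal_inf_lbound; exists w.
have H2 : (normL2 O w.2 ^+ 2 <= 2%:E * normL2 O w.1 ^+ 2 + 2%:E * normL2 O v ^+ 2)%E.
  have mX f : L2 O f -> measurable_fun O (fun x => (f x ^+ 2)%:E).
    move=> /L2_measurable mf; apply/measurable_EFinP; exact: measurable_funX.
  have X0 f x : O x -> (0 <= ((f x : R) ^+ 2)%:E)%E by rewrite lee_fin sqr_ge0.
  rewrite !sqr_normL2 -!ge0_integralZl_EFin//; try by [exact: mX|exact: X0].
  rewrite -ge0_integralD//; last 4 first.
  - by move=> x Ox; rewrite mule_ge0// X0.
  - by apply: measurable_funeM; exact: mX.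
  - by move=> x Ox; rewrite mule_ge0// X0.
  - by apply: measurable_funeM; exact: mX.
  apply: ae_ge0_le_integral => //.
  - by move=> x Ox; exact: X0.
  - exact: mX.
  - by move=> x Ox; rewrite adde_ge0// mule_ge0// X0.
  - by apply: emeasurable_funD; apply: measurable_funeM; exact: mX.
  exists A; split => // x /= h; apply: Av => /= h'; apply: h => Ox.
  rewrite -!EFinM -EFinD lee_fin (h' Ox) -subr_ge0.
  rewrite (_ : _ - _ = (2 * w.1 x + w.2 x) ^+ 2) ?sqr_ge0//; ring.
rewrite sqr_normH1.
have [a aE] : exists a : R, (normL2 O w.1 ^+ 2 = a%:E)%E /\ 0 <= a.
  have /L2P[_] := L1; have := sqre_ge0 (normL2 O w.1).
  by case: (_ ^+ 2)%E => [a| |]// a0 _; exists a.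
have [c cE] : exists a : R, (normL2 O w.2 ^+ 2 = a%:E)%E /\ 0 <= a.
  have /L2P[_] := L2w; have := sqre_ge0 (normL2 O w.2).
  by case: (_ ^+ 2)%E => [c| |]// c0 _; exists c.
move: H2; rewrite vm aE.1 cE.1 -!EFinM -EFinD lee_fin => H2.
have := sqre_ge0 (seminormH1 O w.2); case: (seminormH1 O w.2 ^+ 2)%E => [g| |] //.
  rewrite lee_fin => g0; rewrite -!(EFinM, EFinD) lee_fin.
  have tt : t ^+ 2 <= 1 by rewrite expr_le1// ltW.
  have tt0 := sqr_ge0 t.
  have := ler_wpM2l tt0 H2; have := ler_wpM2r aE.2 tt; have := mulr_ge0 tt0 g0.
  nra.
move=> _; rewrite addey// gt0_muley ?lte_fin ?exprn_gt0//.
by rewrite addey// gt0_muley ?lte_fin// addye// leey.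
Qed.

Lemma K_functional_normH1_le O v t m : measurable O -> (leb O < +oo)%E ->
  (normL2 O v ^+ 2 = m%:E)%E -> L2 O v -> 0 < t ->
  (K_functional normH1 O v t <=
   3%:E * K_functional seminormH1 O v t + (cutoff t * m)%:E)%E.
Proof.
move=> mO Ooo vm Lv t0; rewrite /cutoff; case: ifPn => t1.
  exact: K_functional_normH1_le1.
rewrite mul1r -vm; apply: (@le_trans _ _ (normL2 O v ^+ 2)%E); last first.
  by rewrite leeDr// mule_ge0// K_functional_ge0.
apply: ereal_inf_lbound; exists (v, cst 0%R).
  split => /=; first exact: Lv.
    split; first exact: L2_cst.
    by exists (cst 0%R); exact: weak_gradient0.
  by apply: aeW => x _; rewrite addr0.
transitivity (normL2 O v ^+ 2 + (t ^+ 2)%:E * normH1 O (cst 0%R) ^+ 2)%E => //.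
by rewrite sqr_normH10// mule0 adde0.
Qed.

Lemma measurable_cutoff : measurable_fun setT cutoff.
Proof.
apply: measurable_fun_ifT => //.
  exact: measurable_fun_ler.
by apply: measurable_funM => //; exact: exprn_measurable.
Qed.

Lemma integral_cutoff (s : R) : 0 < s -> s < 1 ->
  (\int[mu]_(t in `]0%R, +oo[) interpolation_density s (EFin \o cutoff) t <=
   ((s * (1 - s))^-1)%:E)%E.
Proof.
move=> s0 s1.
have md : measurable_fun (`]0, +oo[ : set R)
    (interpolation_density s (EFin \o cutoff)).
  apply: measurable_interpolation_density; apply/measurable_EFinP.
  by apply: measurable_funTS; exact: measurable_cutoff.
have d0 t : (`]0, +oo[ : set R)%classic t -> (0 <= interpolation_density s (EFin \o cutoff) t)%E.
  rewrite /= in_itv/= andbT => t0; apply: interpolation_density_ge0 => //=.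
  by rewrite lee_fin /cutoff; case: ifP => // _; rewrite mulr_ge0// sqr_ge0.
have U : `]0, +oo[%classic = `]0, 1]%classic `|` `]1, +oo[%classic :> set R.
  by rewrite -itv_bndbnd_setU// ?bnd_simp.
rewrite U in md d0 *.
rewrite ge0_integral_setU//; last first.
  by rewrite disj_set2E; apply/eqP/seteqP; split => t //= [];
    rewrite !in_itv/= andbT => /andP[_ +] /lt_geF => ->.
have p1 : 0 < 2 - 2 * s by lra.
have p2 : 0 < 2 * s by lra.
have I1 : (\int[mu]_(t in `]0%R, 1%R])
    interpolation_density s (EFin \o cutoff) t <= (2 / (2 - 2 * s))%:E)%E.
  rewrite EFinM; apply: le_trans (lee_wpmul2l _ (integral_powR_le_near0 p1)) => //.
  rewrite -ge0_integralZl_EFin//; last 2 first.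
  - by move=> t _; rewrite lee_fin powR_ge0.
  - by apply/measurable_EFinP; apply: measurable_funTS; exact: measurable_powR.
  rewrite le_eqVlt; apply/orP; left; apply/eqP/eq_integral => t.
  rewrite inE/= in_itv/= => /andP[t0 t1].
  rewrite /interpolation_density /= /cutoff t1 -!EFinM; congr EFin.
  rewrite (_ : 2 - 2 * s - 1 = - (2 * s) + 1); last by ring.
  rewrite powRD; last by rewrite (gt_eqF t0) implybT.
  by rewrite powRr1 ?(ltW t0)//; field; rewrite gt_eqF.
have I2 : (\int[mu]_(t in `]1%R, +oo[)
    interpolation_density s (EFin \o cutoff) t <= ((2 * s)^-1)%:E)%E.
  apply: le_trans (integral_powR_le_infty p2).
  rewrite le_eqVlt; apply/orP; left; apply/eqP/eq_integral => t.
  rewrite inE/= in_itv/= andbT => t1; have t0 := lt_trans ltr01 t1.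
  rewrite /interpolation_density /= /cutoff leNgt t1/= -!EFinM; congr EFin.
  rewrite powRD; last by rewrite (gt_eqF t0) implybT.
  by rewrite powR_inv1 ?(ltW t0)// mulr1.
apply: le_trans (leeD I1 I2) _; rewrite -EFinD lee_fin.
have s1' : 0 < 1 - s by lra.
rewrite (_ : 2 / (2 - 2 * s) + (2 * s)^-1 = (1 + s) / 2 / (s * (1 - s))); last first.
  by field; rewrite !gt_eqF.
rewrite -[leRHS]mul1r ler_wpM2r ?invr_ge0 ?mulr_ge0 ?ltW//; lra.
Qed.

Lemma sqr_normI_le s O v : 0 < s -> s < 1 -> measurable O -> (leb O < +oo)%E ->
  L2 O v -> (normI s O v ^+ 2 <= 3%:E * seminormI s O v ^+ 2 +
    ((s * (1 - s))^-1)%:E * normL2 O v ^+ 2)%E.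
Proof.
move=> s0 s1 mO Ooo Lv.
have [m vm] : exists m : R, (normL2 O v ^+ 2 = m%:E)%E /\ 0 <= m.
  have /L2P[_] := Lv; have := sqre_ge0 (normL2 O v).
  by case: (_ ^+ 2)%E => [m| |]// m0 _; exists m.
have [{}vm m0] := vm.
rewrite [X in (X <= _)%E]sqr_interpolation [X in (_ * X + _)%E]sqr_interpolation vm.
have K0 t := K_functional_ge0 seminormH1 O v t.
have mK := measurable_K_functional seminormH1 O v.
have Kle t := K_functional_normH1_le mO Ooo vm Lv (t := t).
have c0 t : 0 <= cutoff t.
  by rewrite /cutoff; case: ifP => // _; rewrite mulr_ge0// sqr_ge0.
have mc : measurable_fun (`]0, +oo[ : set R) (EFin \o cutoff).
  by apply/measurable_EFinP; apply: measurable_funTS; exact: measurable_cutoff.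
set k := K_functional seminormH1 O v in K0 mK Kle *; clearbody k.
have d0 (h : R -> \bar R) t : (forall t, (0 <= h t)%E) ->
    `]0, +oo[%classic t -> (0 <= interpolation_density s h t)%E.
  by move=> h0; rewrite /= in_itv/= andbT => t0; exact: interpolation_density_ge0.
have dk t := d0 k t K0.
have dc t : `]0, +oo[%classic t ->
    (0 <= interpolation_density s (EFin \o cutoff) t)%E.
  by apply: d0 => x; rewrite lee_fin.
apply: (@le_trans _ _ (\int[mu]_(t in `]0%R, +oo[)
    (3%:E * interpolation_density s k t +
     m%:E * interpolation_density s (EFin \o cutoff) t))%E).
  rewrite [leRHS](_ : _ = \int[mu]_(t in `]0%R, +oo[)
     interpolation_density s (fun t => 3%:E * k t + (cutoff t * m)%:E) t)%E.
    apply: le_interpolation => //.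
    - exact: measurable_K_functional.
    - apply: emeasurable_funD; first exact: measurable_funeM.
      apply/measurable_EFinP; apply: measurable_funM => //.
      by apply: measurable_funTS; exact: measurable_cutoff.
    - by move=> t _; exact: K_functional_ge0.
  apply: eq_integral => t; rewrite inE/= in_itv/= andbT => t0.
  rewrite /interpolation_density ge0_muleDr ?lee_fin ?mulr_ge0//; last first.
    by rewrite mule_ge0// lee_fin.
  rewrite ge0_muleDl ?mule_ge0 ?lee_fin ?powR_ge0 ?mulr_ge0//.
  congr (_ + _)%E; first by rewrite muleA (muleA _ 3%:E) (muleC _ 3%:E) -!muleA.
  by rewrite /= -!EFinM; congr EFin; ring.
rewrite ge0_integralD//; last 4 first.
- by move=> t t0; rewrite mule_ge0 ?dk.
- by apply: measurable_funeM; exact: measurable_interpolation_density.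
- by move=> t t0; apply: mule_ge0; [rewrite lee_fin|exact: dc].
- by apply: measurable_funeM; exact: measurable_interpolation_density.
rewrite ge0_integralZl_EFin//; last exact: measurable_interpolation_density.
rewrite ge0_integralZl_EFin//; last exact: measurable_interpolation_density.
by rewrite leeD2l// muleC lee_wpmul2r ?lee_fin// integral_cutoff.
Qed.

End interpolation_norm_bound.

Section poincare.
Context {R : realType} {n : nat}.
Local Notation leb := (@lebesgue_cV R n).
Implicit Types w : 'cV[R]_n -> R.
Variable O : set 'cV[R]_n.
Hypotheses (mO : measurable O) (Ooo : (leb O < +oo)%E) (O0 : (0 < leb O)%E).
Local Notation V := (volume O).

Lemma volume_gt0 : 0 < V.
Proof. by rewrite fine_gt0// O0 Ooo. Qed.

Lemma volumeE : leb O = V%:E.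
Proof. by rewrite fineK// ge0_fin_numE. Qed.

Lemma integral_cst_volume (a : R) : (\int[leb]_(x in O) a%:E = (a * V)%:E)%E.
Proof. by rewrite (integral_cst _ mO a%:E) -[X in (_ * X)%E]/(leb O) volumeE. Qed.

Lemma exists_mean_zero w : L2 O w -> exists a : R, mass O (fun x => w x + a) = 0%E.
Proof.
move=> Lw; have iw := L2_integrable mO Ooo Lw.
exists (- (fine (mass O w) / V)).
have ic := L2_integrable mO Ooo (L2_cst mO Ooo (- (fine (mass O w) / V))).
rewrite /mass; under eq_integral do rewrite EFinD.
rewrite (integralD mO iw ic) integral_cst_volume mulNr divfK ?gt_eqF ?volume_gt0//.
by rewrite EFinN fineK ?subee//; exact: integrable_fin_num.
Qed.

Lemma integral_sqr_diff w m x : L2 O w -> mass O w = 0%E ->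
  (normL2 O w ^+ 2 = m%:E)%E ->
  (\int[leb]_(y in O) ((w x - w y) ^+ 2)%:E = (V * w x ^+ 2 + m)%:E)%E.
Proof.
move=> Lw w0 wm; have iw := L2_integrable mO Ooo Lw.
have iw2 := L2_integrable_sqr Lw.
have ic := L2_integrable mO Ooo (L2_cst mO Ooo (w x ^+ 2)).
have iz := integrableZl mO (- (2 * w x)) iw.
transitivity (\int[leb]_(y in O) (((w x ^+ 2)%:E + (- (2 * w x))%:E * (w y)%:E) +
   (w y ^+ 2)%:E))%E.
  by apply: eq_integral => y _; rewrite -EFinM -!EFinD; congr EFin; ring.
rewrite (integralD mO (integrableD mO ic iz) iw2) (integralD mO ic iz).
rewrite (integralZl mO iw) -[X in (_ * X)%E]/(mass O w) w0 mule0 adde0.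
by rewrite -(sqr_normL2 O w) wm integral_cst_volume mulrC.
Qed.

Lemma sqr_normL2_le_seminormHs s w (D : R) : 0 < s ->
  (forall x y, O x -> O y -> enorm (x - y) <= D) -> L2 O w -> mass O w = 0%E ->
  (normL2 O w ^+ 2 <=
   (D `^ (n%:R + 2 * s) / (2 * V))%:E * seminormHs s O w ^+ 2)%E.
Proof.
move=> s0 OD Lw w0; have mw := L2_measurable Lw.
have [m wm m0] : exists2 m : R, (normL2 O w ^+ 2 = m%:E)%E & 0 <= m.
  have /L2P[_] := Lw; have := sqre_ge0 (normL2 O w).
  by case: (_ ^+ 2)%E => [m| |]// m0 _; exists m.
have V0 := volume_gt0; set p := n%:R + 2 * s.
have p0 : 0 < p by rewrite ltr_wpDl// mulr_gt0.
have E : (\int[leb]_(x in O) \int[leb]_(y in O) ((w x - w y) ^+ 2)%:E =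
    (2 * V * m)%:E)%E.
  under eq_integral do rewrite (integral_sqr_diff _ Lw w0 wm).
  transitivity (\int[leb]_(x in O) (V%:E * (w x ^+ 2)%:E + (cst m x)%:E))%E.
    by apply: eq_integral => x _; rewrite -EFinM -EFinD.
  have iz := integrableZl mO V (L2_integrable_sqr Lw).
  rewrite (integralD mO iz (L2_integrable mO Ooo (L2_cst mO Ooo m))).
  rewrite (integralZl mO (L2_integrable_sqr Lw)) -(sqr_normL2 O w) wm.
  rewrite integral_cst_volume -!EFinM -EFinD; congr EFin; ring.
rewrite EFinM muleAC lee_pdivlMr ?mulr_gt0//.
rewrite wm -EFinM (mulrC m) -E muleC.
rewrite [X in (_ <= X * _)%E]sqr_seminormHs.
have D0 : 0 <= D `^ p by exact: powR_ge0.
have k0 x y : (0 <= (slobodeckij s w (x, y))%:E)%E.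
  by rewrite lee_fin slobodeckij_ge0.
have mI := measurable_slobodeckij_integral s mO mw.
have mS x : measurable_fun O (fun y => (slobodeckij s w (x, y))%:E).
  by apply/measurable_EFinP; exact: measurable_slobodeckij_section.
have I0 x : O x -> (0 <= \int[leb]_(y in O) (slobodeckij s w (x, y))%:E)%E.
  by move=> _; apply: integral_ge0 => y _; exact: k0.
have md x : measurable_fun O (fun y => ((w x - w y) ^+ 2)%:E).
  apply/measurable_EFinP; apply: measurable_funX.
  exact: (measurable_funB (measurable_cst (w x)) mw).
rewrite muleC -(ge0_integralZl_EFin _ mO I0 mI D0).
apply: (ge0_le_integral_cV mO).
- apply: (@eq_measurable_fun _ _ _ _ _ (fun x => (V * w x ^+ 2 + m)%:E)).
    by move=> x _; rewrite (integral_sqr_diff x Lw w0 wm).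
  apply/measurable_EFinP; apply: measurable_funD => //.
  by apply: measurable_funM => //; exact: measurable_funX.
- exact: measurable_funeM.
- by move=> x _; apply: integral_ge0 => y _; rewrite lee_fin sqr_ge0.
move=> x Ox; rewrite -(ge0_integralZl_EFin _ mO (fun y _ => k0 x y) (mS x) D0).
apply: (ge0_le_integral_cV mO (md x)).
- exact: measurable_funeM (mS x).
- by move=> y _; rewrite lee_fin sqr_ge0.
move=> y Oy; rewrite -EFinM lee_fin /slobodeckij/= -/p.
have [->|xy] := eqVneq x y; first by rewrite !subrr normr0 expr0n/= mul0r mulr0.
have xy0 : 0 < enorm (x - y) by rewrite enorm_gt0 subr_eq0.
rewrite real_normK ?num_real// mulrCA ler_peMr ?sqr_ge0//.
rewrite ler_pdivlMr ?powR_gt0// mul1r ge0_ler_powR ?(ltW p0) ?nnegrE ?enorm_ge0 ?OD//.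
exact: le_trans (enorm_ge0 _) (OD _ _ Ox Oy).
Qed.

Lemma sqr_CPF_SS_ge s : 0 <= diam O ->
  diam O `^ (n%:R + 2 * s) / (2 * V) <= CPF_SS s O ^+ 2.
Proof.
move=> D0; have V0 := volume_gt0; rewrite /CPF_SS exprMn.
have -> : (V `^ (- 2^-1)) ^+ 2 = V^-1.
  by rewrite -powR_mulrn ?powR_ge0// -powRrM mulNr mulVf// powR_inv1// ltW.
rewrite invfM mulrA mulrC ler_wpM2l ?invr_ge0 ?(ltW V0)//.
set t := _ * diam O `^ _.
have -> : diam O `^ (n%:R + 2 * s) / 2 = t ^+ 2.
  rewrite /t exprMn -!powR_mulrn ?powR_ge0// -!powRrM mulNr mulVf//.
  rewrite powR_inv1// mulrC; congr (_ * _ `^ _).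
  by field.
have t0 : 0 <= t by rewrite mulr_ge0 ?powR_ge0.
by rewrite ler_pXn2r ?nnegrE// le_max ?ler01 ?lexx ?orbT.
Qed.

End poincare.

(** * Geometry of the domains *)

Section domain_geometry.
Context {R : realType} {n : nat}.
Hypothesis n_gt0 : (0 < n)%N.
Local Notation leb := (@lebesgue_cV R n).
Implicit Types O : set 'cV[R]_n.

Definition bounded_open O := [/\ O !=set0, open O &
  exists2 M : R, 0 < M & forall x, O x -> forall i, `|x i ord0| <= M].

Lemma lipschitz_bounded_open O : lipschitz_domain O -> bounded_open O.
Proof.
move=> [ne oO _ [M [_ /(_ (`|M| + 1)) MP]] _]; split => //.
exists (`|M| + 1); first by rewrite ltr_wpDl.
move=> x Ox i; rewrite (le_trans (coord_le_mx_norm _ _))// MP//.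
by rewrite (le_lt_trans (ler_norm _))// ltrDl.
Qed.

Lemma bounded_open_image O x0 B : B \in unitmx -> bounded_open O ->
  bounded_open (affine_map x0 B @` O).
Proof.
move=> Bu [[x Ox] oO [M M0 OM]]; split.
- by exists (affine_map x0 B x), x.
- rewrite image_affine_map//; apply: open_comp => // y _.
  exact: continuous_affine_map.
- have [C C0 BC] := mulmx_coord_bound B.
  exists (`|x0| + C * M); first by rewrite ltr_wpDl// mulr_gt0.
  move=> _ [y Oy <-] i; rewrite mxE (le_trans (ler_normD _ _))// lerD//.
    exact: coord_le_mx_norm.
  by apply: BC => j; exact: OM.
Qed.

Lemma bounded_open_measurable O : bounded_open O -> measurable O.
Proof. by move=> [_ oO _]; exact: open_measurable_cV. Qed.

Lemma bounded_open_lty O : bounded_open O -> (leb O < +oo)%E.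
Proof.
move=> dO; have [_ _ [M M0 OM]] := dO.
have M1 : 0 < M + 1 by rewrite addr_gt0.
apply: (@le_lt_trans _ _ (leb (cube (- (M + 1)) (M + 1)))).
  apply: le_measure; rewrite ?inE.
  - exact: bounded_open_measurable.
  - exact: measurable_cube.
  move=> x Ox i; have := OM x Ox i; rewrite ler_norml => /andP[x1 x2].
  by apply/andP; split; lra.
by rewrite lebesgue_cV_cube ?ltry// ge0_cp// ltW.
Qed.

Lemma bounded_open_gt0 O : bounded_open O -> (0 < leb O)%E.
Proof.
move=> dO; have [[x Ox] oO _] := dO.
have /nbhs_ballP[e /= e0 xe] : nbhs x O by exact: open_nbhs_nbhs.
rewrite -(lebesgue_cV_shift x (bounded_open_measurable dO)).
apply: (@lt_le_trans _ _ (leb (cube 0 e))).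
  by rewrite lebesgue_cV_cube ?ltW// subr0 lte_fin exprn_gt0.
apply: le_measure; rewrite ?inE; first exact: measurable_cube.
  apply: measurable_preimage_cV; last exact: bounded_open_measurable.
  exact: measurable_cVD.
move=> y ye /=; apply: xe; apply/ball_cVP => // i.
have /andP[y0 y1] := ye i.
by rewrite mxE opprD addrCA subrr addr0 normrN ger0_norm.
Qed.

Lemma enorm_le_diam O x y : bounded_open O -> O x -> O y ->
  enorm (x - y) <= diam O.
Proof.
move=> [_ _ [M M0 OM]] Ox Oy; apply: ub_le_sup; last by exists x => //; exists y.
exists (n%:R * (M + M) ^+ 2 + 1) => _ [a Oa [b Ob <-]].
have ab : enorm (a - b) ^+ 2 <= n%:R * (M + M) ^+ 2.
  apply: enorm_le_coord => i; rewrite !mxE (le_trans (ler_normB _ _))//.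
  by rewrite lerD// OM.
by have := sqr_ge0 (enorm (a - b) - 1); have := sqr_ge0 (enorm (a - b)); nra.
Qed.

Lemma ball_diameter_le O x0 B c r x : bounded_open O -> B \in unitmx ->
  0 < r -> eball c r `<=` O ->
  2 * r * enorm (B *m x) <= diam (affine_map x0 B @` O) * enorm x.
Proof.
move=> dO Bu r0 cO.
have dFO := bounded_open_image x0 Bu dO.
have [->|xn0] := eqVneq x 0; first by rewrite mulmx0 enorm0 !mulr0.
have nx : 0 < enorm x by rewrite enorm_gt0.
set d := diam _; set a := enorm (B *m x).
have a0 : 0 <= a by exact: enorm_ge0.
have H t : 0 <= t -> t < r -> 2 * t * a <= d * enorm x.
  move=> t0 tr; pose u := (t / enorm x) *: x.
  have nu : enorm u = t.
    rewrite enormZ ger0_norm ?divfK ?gt_eqF//.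
    by rewrite divr_ge0// ltW.
  have h1 : O (c + u) by apply: cO; rewrite /eball/= addrC addKr nu.
  have h2 : O (c - u).
    by apply: cO; rewrite /eball/= addrC addKr enormN nu.
  have := enorm_le_diam dFO (imageP _ h1) (imageP _ h2).
  have -> : affine_map x0 B (c + u) - affine_map x0 B (c - u) =
      (2 * t / enorm x) *: (B *m x).
    rewrite /affine_map opprD addrACA subrr add0r -mulmxBr.
    rewrite (_ : c + u - (c - u) = u + u).
      by rewrite mulmxDr -scalemxAr -scalerDl; congr (_ *: _); ring.
    by apply/matrixP => i j; rewrite !mxE; ring.
  rewrite enormZ ger0_norm ?divr_ge0 ?mulr_ge0 ?(ltW nx)// -/a -/d.
  by rewrite mulrAC ler_pdivrMr.
rewrite leNgt; apply/negP => dr.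
have D0 : 0 <= d * enorm x by have := H 0 (lexx _) r0; rewrite mulr0 mul0r.
have a1 : 0 < a.
  by rewrite lt_neqAle a0 andbT; apply: contraTneq dr => <-; rewrite mulr0 -leNgt.
set e := d * enorm x in H dr D0 *.
have e2 : e / (2 * a) < r by rewrite ltr_pdivrMr ?mulr_gt0//; lra.
have e0 : 0 <= e / (2 * a) by apply: divr_ge0 => //; exact: mulr_ge0.
have := H ((e / (2 * a) + r) / 2).
have -> : 2 * ((e / (2 * a) + r) / 2) * a = e / 2 + r * a by field; rewrite gt_eqF.
move=> /(_ _ _)H'.
have : e / 2 + r * a <= e by apply: H'; lra.
lra.
Qed.

Lemma ball_diameter_le_diam O c r : bounded_open O -> 0 < r ->
  eball c r `<=` O -> 2 * r <= diam O.
Proof.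
move=> dO r0 cO; pose x : 'cV[R]_n := delta_mx (Ordinal n_gt0) ord0.
have B1 : (1%:M : 'M[R]_n) \in unitmx by exact: unitmx1.
have := ball_diameter_le 0 x dO B1 r0 cO.
rewrite mul1mx (_ : affine_map 0 1%:M @` O = O); last first.
  apply/seteqP; split=> y.
    by move=> [z Oz <-]; rewrite /affine_map add0r mul1mx.
  by move=> Oy; exists y => //; rewrite /affine_map add0r mul1mx.
rewrite ler_pM2r// enorm_gt0; apply/eqP => /matrixP /(_ (Ordinal n_gt0) ord0).
by rewrite !mxE !eqxx => /eqP; rewrite oner_eq0.
Qed.

Lemma indiam_gt0 O : bounded_open O -> 0 < indiam O.
Proof.
move=> dO; have [[x Ox] oO _] := dO.
have /nbhs_ballP[e /= e0 xe] : nbhs x O by exact: open_nbhs_nbhs.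
apply: (@lt_le_trans _ _ (2 * e)); first by rewrite mulr_gt0.
apply: ub_le_sup.
  by exists (diam O) => _ [c [r [r0 cO ->]]]; exact: ball_diameter_le_diam cO.
exists x, e; split => // y ye; apply: xe; apply/ball_cVP => // i.
apply: le_lt_trans ye; rewrite distrC.
by have := coord_le_enorm (y - x) i; rewrite !mxE.
Qed.

Lemma indiam_le_diam O : bounded_open O -> indiam O <= diam O.
Proof.
move=> dO; apply: ge_sup; last first.
  by move=> _ [c [r [r0 cO ->]]]; exact: ball_diameter_le_diam cO.
have := indiam_gt0 dO; apply: contraPP => /nonemptyPn S0.
by rewrite /indiam S0 sup0 ltxx.
Qed.

Lemma diam_gt0 O : bounded_open O -> 0 < diam O.
Proof. by move=> dO; exact: lt_le_trans (indiam_gt0 dO) (indiam_le_diam dO). Qed.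

Lemma enorm_mulmx_le_diam O x0 B x : bounded_open O -> B \in unitmx ->
  enorm (B *m x) <= diam (affine_map x0 B @` O) / indiam O * enorm x.
Proof.
move=> dO Bu; have d0 := indiam_gt0 dO.
rewrite mulrAC ler_pdivlMr// mulrC.
have [->|Bx0] := eqVneq (enorm (B *m x)) 0.
  rewrite mulr0 mulr_ge0 ?enorm_ge0 ?ltW// diam_gt0//.
  exact: bounded_open_image.
have Bx : 0 < enorm (B *m x) by rewrite lt_neqAle eq_sym Bx0 enorm_ge0.
rewrite -ler_pdivlMr//; apply: ge_sup.
  have := indiam_gt0 dO; apply: contraPP => /nonemptyPn S0.
  by rewrite /indiam S0 sup0 ltxx.
move=> _ [c [r [r0 cO ->]]]; rewrite ler_pdivlMr//.
exact: (ball_diameter_le x0 x dO Bu r0 cO).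
Qed.

End domain_geometry.

(** * The estimates *)

Section pullback.
Context {R : realType} {n : nat}.
Local Notation leb := (@lebesgue_cV R n).
Implicit Types (O : set 'cV[R]_n) (v w : 'cV[R]_n -> R).

Lemma lee_pmul_inv (x y : \bar R) (a c : R) : 0 < a ->
  (a%:E * x <= c%:E * y -> x <= (a^-1 * c)%:E * y)%E.
Proof. by move=> a0; rewrite EFinM -muleA lee_pdivlMl. Qed.

Lemma L2_shift O v (a : R) : measurable O -> (leb O < +oo)%E ->
  L2 O v -> L2 O (fun x => v x + a).
Proof. by move=> mO Ooo Lv; apply: L2D => //; exact: L2_cst. Qed.

Lemma Hs_shift s O v (a : R) : measurable O -> (leb O < +oo)%E ->
  Hs s O v -> Hs s O (fun x => v x + a).
Proof.
move=> mO Ooo /HsP[Lv sv]; apply/HsP; split; first exact: L2_shift.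
by rewrite seminormHs_shift.
Qed.

Lemma seminormHs_le_normHs_shift s O v (c : R) :
  (seminormHs s O v <= normHs s O (fun x => v x + c)%R)%E.
Proof.
rewrite -(seminormHs_shift s O v c) -lee_sqr ?seminormHs_ge0 ?normHs_ge0//.
by rewrite sqr_normHs; apply: leeDr; exact: sqre_ge0.
Qed.

Lemma sqr_normHs_le_max O O' s v w (a b : R) : 0 <= a ->
  (normL2 O v ^+ 2 <= a%:E * normL2 O' w ^+ 2)%E ->
  (seminormHs s O v ^+ 2 <= b%:E * seminormHs s O' w ^+ 2)%E ->
  (normHs s O v ^+ 2 <= (Num.max a b)%:E * normHs s O' w ^+ 2)%E.
Proof.
move=> a0 vw vw'; rewrite [leLHS]sqr_normHs [X in (_ * X)%E]sqr_normHs.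
rewrite [leRHS]ge0_muleDr; [|exact: sqre_ge0|exact: sqre_ge0].
apply: leeD.
  by apply: lee_weaken vw; [rewrite le_max lexx|exact: sqre_ge0].
by apply: lee_weaken vw'; [rewrite le_max lexx orbT|exact: sqre_ge0].
Qed.

Lemma affine_pullback O x0 B (s : R) : (0 < n)%N -> 0 < s -> bounded_open O ->
  B \in unitmx ->
  let FO := affine_map x0 B @` O in
  let b := diam FO / indiam O in
  let b' := diam O / indiam FO in
  exists J, [/\ 0 < J, J <= b ^+ n, J^-1 <= b' ^+ n & forall v, L2 FO v ->
    let vF x := v (affine_map x0 B x) in
    [/\ L2 O vF /\ (normL2 FO v ^+ 2 = J%:E * normL2 O vF ^+ 2)%E,
        (seminormHs s O vF ^+ 2 <=
          (J ^- 2 * b `^ (n%:R + 2 * s))%:E * seminormHs s FO v ^+ 2)%E,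
        (seminormHs s FO v ^+ 2 <=
          (J ^+ 2 * b' `^ (n%:R + 2 * s))%:E * seminormHs s O vF ^+ 2)%E,
        (seminormI s O vF ^+ 2 <=
          (J^-1 * b `^ (2 * s))%:E * seminormI s FO v ^+ 2)%E &
        (seminormI s FO v ^+ 2 <=
          (J * b' `^ (2 * s))%:E * seminormI s O vF ^+ 2)%E]].
Proof.
move=> n0 s0 dO Bu FO b b'.
have dFO : bounded_open FO by exact: bounded_open_image.
have Bu' : invmx B \in unitmx by rewrite unitmx_inv.
set x0' := - (invmx B *m x0).
have GFO : affine_map x0' (invmx B) @` FO = O.
  apply/seteqP; split=> [_ [_ [y Oy <-] <-]|y Oy]; first by rewrite affine_mapK.
  by exists (affine_map x0 B y); [exists y|rewrite affine_mapK].
have b0 : 0 < b by rewrite divr_gt0 ?diam_gt0 ?indiam_gt0.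
have b'0 : 0 < b' by rewrite divr_gt0 ?diam_gt0 ?indiam_gt0.
have Bb x : enorm (B *m x) <= b * enorm x by exact: enorm_mulmx_le_diam.
have Bb' x : enorm (invmx B *m x) <= b' * enorm x.
  have := enorm_mulmx_le_diam n0 x0' x dFO Bu'; by rewrite GFO.
have [J Jac] := exists_jacobian x0 Bu.
have Jac' := jacobianV Bu Jac; have [J0 _] := Jac.
have mO := bounded_open_measurable dO; have mFO := bounded_open_measurable dFO.
have Ooo := bounded_open_lty dO; have FOoo := bounded_open_lty dFO.
have preO : affine_map x0 B @^-1` FO = O.
  apply/seteqP; split=> [x [y Oy]|x Ox]; last by exists x.
  by move=> /(congr1 (affine_map x0' (invmx B))); rewrite !affine_mapK// => <-.
have preFO : affine_map x0' (invmx B) @^-1` O = FO by rewrite -image_affine_map.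
exists J; split => //.
- exact: jacobian_le Bu Jac b0 Bb.
- exact: jacobian_le Bu' Jac' b'0 Bb'.
move=> v Lv vF.
have vE : (fun x => vF (affine_map x0' (invmx B) x)) = v.
  by apply/funext => x; rewrite /vF affine_mapVK.
have LvF : L2 O vF by have := L2_affine Jac mFO Lv; rewrite preO.
have mv := L2_measurable Lv; have mvF := L2_measurable LvF.
split.
- by split=> //; rewrite (sqr_normL2_affine Jac mFO mv) preO.
- have := sqr_seminormHs_affine Bu Jac b0 Bb s0 mFO mv; rewrite preO.
  by apply: lee_pmul_inv; rewrite exprn_gt0.
- have := sqr_seminormHs_affine Bu' Jac' b'0 Bb' s0 mO mvF; rewrite preFO vE.
  move=> h; have := lee_pmul_inv _ h; rewrite exprVn invrK; apply.
  by rewrite invr_gt0 exprn_gt0.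
- have := sqr_seminormI_affine Bu Jac b0 Bb mFO FOoo s v; rewrite preO.
  exact: lee_pmul_inv.
- have := sqr_seminormI_affine Bu' Jac' b'0 Bb' mO Ooo s vF; rewrite preFO vE.
  by move=> h; have := lee_pmul_inv _ h; rewrite invrK; apply; rewrite invr_gt0.
Qed.

End pullback.

Section reference_domain.
Context {R : realType} {n : nat}.
Local Notation leb := (@lebesgue_cV R n).
Hypothesis n_gt0 : (0 < n)%N.
Variables (O : set 'cV[R]_n) (s k K CI : R).
Hypotheses (dO : bounded_open O) (s_gt0 : 0 < s) (s_lt1 : s < 1).
Hypotheses (k_gt0 : 0 < k) (K_gt0 : 0 < K) (CI_gt0 : 0 < CI).
Hypothesis kE : forall w, Hs s O w -> (k%:E * normI s O w <= normHs s O w)%E.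
Hypothesis KE : forall w, Hs s O w -> (normHs s O w <= K%:E * normI s O w)%E.
Hypothesis CIE : forall w, Hs s O w ->
  (normL2 O w <= CI%:E * (seminormI s O w + `|mass O w|))%E.

Let mO := bounded_open_measurable dO.
Let Ooo := bounded_open_lty dO.
Let O_gt0 := bounded_open_gt0 dO.

Lemma sqr_seminormI_le_normHs w (a : R) : Hs s O w ->
  (seminormI s O w ^+ 2 <= (k ^- 2)%:E * normHs s O (fun x => w x + a)%R ^+ 2)%E.
Proof.
move=> Hw; have Hwa := Hs_shift a mO Ooo Hw.
rewrite -(sqr_seminormI_shift s w a mO Ooo).
apply: le_trans (sqr_seminormI_le_normI _ _ _) _.
rewrite lee_pdivlMl ?exprn_gt0// -sqreM_EFin lee_sqr ?normHs_ge0 ?kE//.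
by rewrite mule_ge0 ?normI_ge0// lee_fin ltW.
Qed.

Lemma sqr_normHs_le_seminormI w : Hs s O w -> mass O w = 0%E ->
  (normHs s O w ^+ 2 <=
   (K ^+ 2 * (3 + CI ^+ 2 / (s * (1 - s))))%:E * seminormI s O w ^+ 2)%E.
Proof.
move=> Hw w0; have [Lw _] := Hw.
apply: (@lee_chain _ _ (normI s O w ^+ 2)%E); first exact: sqr_ge0.
  rewrite -sqreM_EFin lee_sqr ?normHs_ge0 ?KE//.
  by rewrite mule_ge0 ?normI_ge0// lee_fin ltW.
apply: le_trans (sqr_normI_le s_gt0 s_lt1 mO Ooo Lw) _.
have ss : 0 <= (s * (1 - s))^-1 by rewrite invr_ge0 mulr_ge0 ?subr_ge0 ?ltW.
have := CIE Hw; rewrite w0 abse0 adde0 => h.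
have : (normL2 O w ^+ 2 <= (CI ^+ 2)%:E * seminormI s O w ^+ 2)%E.
  rewrite -sqreM_EFin lee_sqr ?normL2_ge0//.
  by rewrite mule_ge0 ?seminormI_ge0// lee_fin ltW.
move=> h2; set c := CI ^+ 2 / _.
have c0 : 0 <= c by rewrite mulr_ge0 ?sqr_ge0.
rewrite (_ : (3 + c)%:E = 3%:E + c%:E)%E// ge0_muleDl ?lee_fin//.
apply: leeD2l; rewrite /c (mulrC (CI ^+ 2)) [in leRHS]EFinM -[leRHS]muleA.
by apply: lee_wpmul2l => //; rewrite lee_fin.
Qed.

Lemma exists_sqr_normL2_le w : Hs s O w ->
  exists2 a : R, mass O (fun x => w x + a) = 0%E &
  (normL2 O (fun x => w x + a)%R ^+ 2 <=
   (CPF_SS s O ^+ 2)%:E * seminormHs s O w ^+ 2)%E.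
Proof.
move=> Hw; have [Lw _] := Hw.
have [a wa] := exists_mean_zero mO Ooo O_gt0 Lw; exists a => //.
rewrite -(seminormHs_shift s O w a).
have D0 := ltW (diam_gt0 n_gt0 dO).
apply: lee_weaken (sqr_CPF_SS_ge Ooo O_gt0 s D0) (sqre_ge0 _) _.
apply: sqr_normL2_le_seminormHs => //.
  by move=> x y Ox Oy; exact: enorm_le_diam.
exact: L2_shift.
Qed.

End reference_domain.

(* D, d and Dh, dh stand for the diameter and the inner diameter of O and of the
   reference domain. *)
Section coefficients.
Context {R : realType}.
Variables (n : nat) (s D d Dh dh J : R).
Hypotheses (D0 : 0 < D) (d0 : 0 < d) (Dh0 : 0 < Dh) (dh0 : 0 < dh) (J0 : 0 < J).
Local Notation b := (D / dh).
Local Notation b' := (Dh / d).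
Hypotheses (Jb : J <= b ^+ n) (Jb' : J^-1 <= b' ^+ n).
Local Notation p := (n%:R + 2 * s).
Local Notation r := (D / d).
Local Notation rh := (Dh / dh).

Lemma powR_div (x y a : R) : 0 < x -> 0 < y -> (x / y) `^ a = x `^ a / y `^ a.
Proof.
move=> x0 y0; rewrite powRM ?invr_ge0 ?(ltW x0) ?(ltW y0)//; congr (_ * _).
by rewrite -(powR_inv1 (ltW y0)) -powRrM mulN1r powRN.
Qed.

Lemma powR_exponent (x : R) : 0 < x -> x `^ p = x ^+ n * x `^ (2 * s).
Proof.
by move=> x0; rewrite powRD ?(gt_eqF x0) ?implybT// powR_mulrn// ltW.
Qed.

Lemma aspect_powR a : b' `^ a * b `^ a = r `^ a * rh `^ a.
Proof.
rewrite -!powRM ?divr_ge0 ?ltW//; congr (_ `^ _).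
by field; rewrite !gt_eqF.
Qed.

Lemma coefficient_up : J * (b' `^ p * b `^ (2 * s)) <= r `^ p * rh `^ p.
Proof.
rewrite -aspect_powR [in leRHS](powR_exponent (divr_gt0 D0 dh0)).
rewrite mulrCA ler_wpM2l ?powR_ge0// ler_wpM2r ?powR_ge0//.
Qed.

Lemma coefficient_down : J^-1 * (b' `^ (2 * s) * b `^ p) <= r `^ p * rh `^ p.
Proof.
rewrite -aspect_powR [b' `^ p](powR_exponent (divr_gt0 Dh0 d0)) mulrA.
by rewrite ler_wpM2r ?powR_ge0// ler_wpM2r ?powR_ge0.
Qed.

Lemma coefficient_mean :
  J^-1 * b `^ p <= D `^ (2 * s) / Dh `^ (2 * s) * r `^ n%:R * rh `^ p.
Proof.
rewrite (_ : _ * rh `^ p = b' ^+ n * b `^ p).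
  by rewrite ler_wpM2r ?powR_ge0.
rewrite powR_mulrn ?divr_ge0 ?ltW//.
rewrite !powR_exponent ?divr_gt0// !powR_div// !expr_div_n.
by field; rewrite !(expf_neq0, gt_eqF, powR_gt0).
Qed.

Lemma coefficient_b' :
  b' `^ (2 * s) = D `^ (- (2 * s)) * Dh `^ (2 * s) * r `^ (2 * s).
Proof.
rewrite powRN !powR_div//; by field; rewrite !gt_eqF ?powR_gt0.
Qed.

Lemma coefficient_b :
  b `^ (2 * s) = D `^ (2 * s) * Dh `^ (- (2 * s)) * rh `^ (2 * s).
Proof.
rewrite powRN !powR_div//; by field; rewrite !gt_eqF ?powR_gt0.
Qed.

Lemma coefficient_splitl :
  r `^ p * rh `^ p = r `^ n%:R * rh `^ p * r `^ (2 * s).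
Proof.
rewrite [r `^ p](powR_exponent (divr_gt0 D0 d0)) powR_mulrn ?divr_ge0 ?ltW//.
ring.
Qed.

Lemma coefficient_splitr :
  r `^ p * rh `^ p = r `^ p * rh `^ n%:R * rh `^ (2 * s).
Proof.
rewrite [rh `^ p](powR_exponent (divr_gt0 Dh0 dh0)) powR_mulrn ?divr_ge0 ?ltW//.
ring.
Qed.

Lemma coefficient_maxl :
  J * b' `^ (2 * s) * Num.max J^-1 (J ^- 2 * b `^ p) <=
  Num.max (r `^ n%:R * rh `^ p) (D `^ (- (2 * s)) * Dh `^ (2 * s)) *
  r `^ (2 * s).
Proof.
have Jb'0 : 0 <= J * b' `^ (2 * s) by rewrite mulr_ge0 ?powR_ge0// ltW.
rewrite (maxr_pMr _ _ Jb'0) (maxr_pMl _ _ (powR_ge0 _ _)) -coefficient_splitl.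
rewrite -coefficient_b' ge_max !le_max; apply/andP; split; apply/orP; [right|left].
  by rewrite mulrAC divff ?gt_eqF// mul1r.
rewrite [leLHS](_ : _ = J^-1 * (b' `^ (2 * s) * b `^ p)) ?coefficient_down//.
by field; rewrite gt_eqF.
Qed.

Lemma coefficient_maxr :
  Num.max J (J ^+ 2 * b' `^ p) * (J^-1 * b `^ (2 * s)) <=
  Num.max (r `^ p * rh `^ n%:R) (D `^ (2 * s) * Dh `^ (- (2 * s))) *
  rh `^ (2 * s).
Proof.
have Jb0 : 0 <= J^-1 * b `^ (2 * s) by rewrite mulr_ge0 ?powR_ge0 ?invr_ge0 ?ltW.
rewrite (maxr_pMl _ _ Jb0) (maxr_pMl _ _ (powR_ge0 _ _)) -coefficient_splitr.
rewrite -coefficient_b ge_max !le_max; apply/andP; split; apply/orP; [right|left].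
  by rewrite mulrA divff ?gt_eqF// mul1r.
rewrite [leLHS](_ : _ = J * (b' `^ p * b `^ (2 * s))) ?coefficient_up//.
by field; rewrite gt_eqF.
Qed.

End coefficients.

Section estimates.
Context {R : realType} {n : nat}.
Local Notation leb := (@lebesgue_cV R n).
Hypothesis n_gt0 : (0 < n)%N.
Variables (Oh : set 'cV[R]_n) (s k K CI : R).
Hypotheses (dOh : bounded_open Oh) (s_gt0 : 0 < s) (s_lt1 : s < 1).
Hypotheses (k_gt0 : 0 < k) (K_gt0 : 0 < K) (CI_gt0 : 0 < CI).
Hypothesis kE : forall w, Hs s Oh w -> (k%:E * normI s Oh w <= normHs s Oh w)%E.
Hypothesis KE : forall w, Hs s Oh w -> (normHs s Oh w <= K%:E * normI s Oh w)%E.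
Hypothesis CIE : forall w, Hs s Oh w ->
  (normL2 Oh w <= CI%:E * (seminormI s Oh w + `|mass Oh w|))%E.
Variables (x0 : 'cV[R]_n) (B : 'M[R]_n).
Hypothesis Bu : B \in unitmx.
Local Notation O := (affine_map x0 B @` Oh).
Variable v : 'cV[R]_n -> R.
Hypothesis Hv : Hs s O v.
Local Notation vF := (fun x => v (affine_map x0 B x)).
Local Notation p := (n%:R + 2 * s).
Local Notation b := (diam O / indiam Oh).
Local Notation b' := (diam Oh / indiam O).

Let mOh := bounded_open_measurable dOh.
Let Ohoo := bounded_open_lty dOh.
Let dO : bounded_open O := bounded_open_image x0 Bu dOh.
Let mO := bounded_open_measurable dO.
Let Ooo := bounded_open_lty dO.
Let D0 := diam_gt0 n_gt0 dO.
Let d0 := indiam_gt0 n_gt0 dO.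
Let Dh0 := diam_gt0 n_gt0 dOh.
Let dh0 := indiam_gt0 n_gt0 dOh.

Lemma affine_estimates :
  [/\ (seminormHs s O v ^+ 2 <=
        (aspect O `^ p * aspect Oh `^ p *
         K ^+ 2 * (3 + CI ^+ 2 / (s * (1 - s))))%:E * seminormI s O v ^+ 2)%E
      /\
      (seminormI s O v ^+ 2 <=
        (aspect O `^ p * aspect Oh `^ p *
         k ^- 2 * (1 + CPF_SS s Oh ^+ 2))%:E * seminormHs s O v ^+ 2)%E,
      (seminormHs s O v <= seminormHs_inf s O v)%E /\
      (seminormHs_inf s O v ^+ 2 <=
        (1 + diam O `^ (2 * s) / diam Oh `^ (2 * s) *
             aspect O `^ n%:R * aspect Oh `^ p *
             CPF_SS s Oh ^+ 2)%:E * seminormHs s O v ^+ 2)%E,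
      (seminormI s O v ^+ 2 <=
        (Num.max (aspect O `^ n%:R * aspect Oh `^ p)
                 (diam O `^ (- (2 * s)) * diam Oh `^ (2 * s)) *
         aspect O `^ (2 * s) * k ^- 2)%:E * seminormHs_inf s O v ^+ 2)%E &
      (seminormHs_inf s O v ^+ 2 <=
        (Num.max (aspect O `^ p * aspect Oh `^ n%:R)
                 (diam O `^ (2 * s) * diam Oh `^ (- (2 * s))) *
         aspect Oh `^ (2 * s) *
         K ^+ 2 * (3 + CI ^+ 2 / (s * (1 - s))))%:E *
        seminormI s O v ^+ 2)%E].
Proof.
have [Lv sv] := (HsP s O v).1 Hv.
have [J [J0 Jb Jb' PB]] := affine_pullback x0 n_gt0 s_gt0 dOh Bu.
have [[LvF nv] T1 T2 T3 T4] := PB v Lv.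
have HvF : Hs s Oh vF.
  apply/HsP; split; first exact: LvF.
  refine (le_lt_trans T1 _); apply: lte_mul_pinfty sv.
    by rewrite lee_fin mulr_ge0 ?powR_ge0// invr_ge0 exprn_ge0 ?ltW.
  by [].
have HvFa a : Hs s Oh (fun x => vF x + a) by exact: Hs_shift.
have nva a : (normL2 O (fun x => v x + a)%R ^+ 2 =
    J%:E * normL2 Oh (fun x => vF x + a)%R ^+ 2)%E.
  by have [[]] := PB _ (L2_shift a mO Ooo Lv).
have [a ma PSS] := exists_sqr_normL2_le n_gt0 dOh s_gt0 HvF.
set C := 3 + CI ^+ 2 / (s * (1 - s)).
have C0 : 0 <= C.
  have ss : 0 <= s * (1 - s) by rewrite mulr_ge0 ?subr_ge0 ?ltW.
  by rewrite /C addr_ge0 ?divr_ge0 ?sqr_ge0.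
have K2C : 0 <= K ^+ 2 * C by rewrite mulr_ge0 ?sqr_ge0.
have R1 : (normHs s Oh (fun x => vF x + a)%R ^+ 2 <=
    (K ^+ 2 * C)%:E * seminormI s Oh vF ^+ 2)%E.
  have := sqr_normHs_le_seminormI dOh s_gt0 s_lt1 K_gt0 CI_gt0 KE CIE (HvFa a) ma.
  by rewrite (sqr_seminormI_shift s vF a mOh Ohoo).
have R2 := sqr_seminormI_le_normHs dOh k_gt0 kE _ HvF.
have k20 : 0 <= k ^- 2 by rewrite invr_ge0 exprn_ge0// ltW.
have bp0 : 0 <= b `^ p by exact: powR_ge0.
have b'p0 : 0 <= b' `^ p by exact: powR_ge0.
have b20 : 0 <= b `^ (2 * s) by exact: powR_ge0.
have b'20 : 0 <= b' `^ (2 * s) by exact: powR_ge0.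
have J2 : 0 <= J ^+ 2 by exact: sqr_ge0.
have JV2 : 0 <= J ^- 2 by rewrite invr_ge0.
have infle c : (seminormHs_inf s O v <= normHs s O (fun x => v x + c)%R)%E.
  by apply: ereal_inf_lbound; exists c.
have inf0 : (0 <= seminormHs_inf s O v)%E.
  by apply: le_ereal_inf_tmp => _ [c _ <-]; exact: normHs_ge0.
have infle2 c : (seminormHs_inf s O v ^+ 2 <=
    normHs s O (fun x => v x + c)%R ^+ 2)%E.
  by rewrite lee_sqr ?normHs_ge0.
have JV0 : 0 <= J^-1 by rewrite invr_ge0 ltW.
have cu : J * (b' `^ (n%:R + 2 * s) * b `^ (2 * s)) <= aspect O `^ p * aspect Oh `^ p.
  exact: (coefficient_up s D0 d0 Dh0 dh0 Jb).
have cd : J^-1 * (b' `^ (2 * s) * b `^ p) <= aspect O `^ p * aspect Oh `^ p.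
  exact: (coefficient_down s D0 d0 Dh0 dh0 Jb').
have JK : J \is a GRing.unit by rewrite unitfE gt_eqF.
have vFle c : (seminormHs s Oh vF ^+ 2 <= normHs s Oh (fun x => vF x + c)%R ^+ 2)%E.
  by rewrite lee_sqr ?seminormHs_ge0 ?normHs_ge0//; exact: seminormHs_le_normHs_shift.
have Xge0 := sqre_ge0 (seminormHs s O v).
have Yge0 := sqre_ge0 (seminormI s O v).
split; [split|split| |].
- refine (lee_weaken _ Yge0 (lee_chain _ T2
    (lee_chain _ (le_trans (vFle a) R1) T3))); [|exact: mulr_ge0|exact: K2C].
  rewrite [leLHS](_ : _ = (J * (b' `^ p * b `^ (2 * s))) * (K ^+ 2 * C)).
    by rewrite -[leRHS]mulrA ler_wpM2r.
  by field; rewrite gt_eqF.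
- have Sa : (normHs s Oh (fun x => vF x + a)%R ^+ 2 <=
      (1 + CPF_SS s Oh ^+ 2)%:E * seminormHs s Oh vF ^+ 2)%E.
    rewrite sqr_normHs seminormHs_shift EFinD ge0_muleDl ?lee_fin ?sqr_ge0//.
    by rewrite mul1e addeC leeD2l.
  have J2b : 0 <= J * b' `^ (2 * s) by rewrite mulr_ge0// ltW.
  refine (lee_weaken _ Xge0 (lee_chain J2b T4 (lee_chain k20 (R2 a)
    (lee_chain _ Sa T1)))); last by rewrite addr_ge0 ?sqr_ge0.
  rewrite [leLHS](_ : _ = (J^-1 * (b' `^ (2 * s) * b `^ p)) *
      (k ^- 2 * (1 + CPF_SS s Oh ^+ 2))).
    by rewrite -[leRHS]mulrA ler_wpM2r// mulr_ge0// addr_ge0 ?sqr_ge0.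
  by field; rewrite !gt_eqF.
- by apply: le_ereal_inf_tmp => _ [c _ <-]; exact: seminormHs_le_normHs_shift.
- refine (le_trans (infle2 a) _); rewrite sqr_normHs nva seminormHs_shift.
  rewrite EFinD ge0_muleDl ?lee_fin//; last first.
    by rewrite !mulr_ge0 ?invr_ge0 ?powR_ge0 ?sqr_ge0.
  rewrite mul1e addeC; apply: leeD2l.
  refine (lee_weaken _ Xge0 (lee_chain (ltW J0) (lexx _) (lee_chain (sqr_ge0 _) PSS T1))).
  have := coefficient_mean s D0 d0 Dh0 dh0 Jb'.
  move=> /(ler_wpM2r (sqr_ge0 (CPF_SS s Oh))); apply: le_trans.
  rewrite [leLHS](_ : _ = J^-1 * b `^ p * CPF_SS s Oh ^+ 2) ?lexx//.
  by field; rewrite gt_eqF.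
- set m := Num.max J^-1 (J ^- 2 * b `^ p).
  have vFc c : (normHs s Oh (fun x => vF x + c)%R ^+ 2 <=
      m%:E * normHs s O (fun x => v x + c)%R ^+ 2)%E.
    apply: sqr_normHs_le_max; first exact: JV0.
      rewrite [X in (_ * X)%E]nva [leRHS]muleA -EFinM mulVf ?gt_eqF//.
      by rewrite [leRHS]mul1e lexx.
    by rewrite !seminormHs_shift; exact: T1.
  have cm := coefficient_maxl s D0 d0 Dh0 dh0 J0 Jb'.
  have Jb'0 : 0 <= J * b' `^ (2 * s) by rewrite mulr_ge0// ltW.
  have m0 : 0 < m by rewrite lt_max invr_gt0 J0.
  have key c := lee_weaken _ (sqre_ge0 _)
    (lee_chain Jb'0 T4 (lee_chain k20 (R2 c) (vFc c))).
  rewrite -[leLHS]mul1e; apply: le_mul_ereal_inf_sqr => //.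
  + rewrite !mulr_gt0 ?invr_gt0 ?exprn_gt0 ?powR_gt0 ?divr_gt0//.
    by rewrite lt_max mulr_gt0 ?powR_gt0 ?divr_gt0.
  + exact: seminormI_ge0.
  + by move=> _ [c _ <-]; exact: normHs_ge0.
  + move=> _ [c _ <-]; rewrite mul1e; apply: key.
    rewrite mulrCA mulrC; apply: ler_wpM2r => //.
- have va : (normHs s O (fun x => v x + a)%R ^+ 2 <=
      (Num.max J (J ^+ 2 * b' `^ p))%:E * normHs s Oh (fun x => vF x + a)%R ^+ 2)%E.
    apply: sqr_normHs_le_max; [exact: ltW|by rewrite nva lexx|].
    by rewrite !seminormHs_shift; exact: T2.
  have cm := coefficient_maxr s D0 d0 Dh0 dh0 J0 Jb.
  refine (lee_weaken _ Yge0 (lee_chain _ (le_trans (infle2 a) va)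
    (lee_chain K2C R1 T3))); last by rewrite le_max ltW.
  by rewrite mulrCA mulrC -[leRHS]mulrA; apply: ler_wpM2r.
Qed.

End estimates.

Section uniform_bounds.
Context {R : realType}.

Lemma lee_of_sqr (x y : \bar R) (c M : R) : (0 <= x)%E -> (0 <= y)%E ->
  (x ^+ 2 <= c%:E * y ^+ 2)%E -> 0 <= M -> c <= M -> (x <= (M + 1)%:E * y)%E.
Proof.
move=> x0 y0 xy M0 cM; have M1 : 0 <= M + 1 by rewrite addr_ge0.
rewrite -lee_sqr//; last by rewrite mule_ge0.
rewrite sqreM_EFin; apply: lee_weaken xy; last exact: sqre_ge0.
by apply: (le_trans cM); nra.
Qed.

Lemma le_powR (a x y : R) : 0 <= a -> 0 <= x -> x <= y -> x `^ a <= y `^ a.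
Proof.
by move=> a0 x0 xy; apply: ge0_ler_powR; rewrite ?nnegrE// (le_trans x0).
Qed.

Lemma le_powRN (a x y : R) : 0 <= a -> 0 < x -> x <= y -> y `^ (- a) <= x `^ (- a).
Proof.
move=> a0 x0 xy; rewrite !powRN lef_pV2 ?posrE ?powR_gt0// ?(lt_le_trans x0)//.
by apply: le_powR => //; exact: ltW.
Qed.

End uniform_bounds.

Lemma seminormHs_inf_ge0 {R : realType} {n : nat} s O (v : 'cV[R]_n -> R) :
  (0 <= seminormHs_inf s O v)%E.
Proof. by apply: le_ereal_inf_tmp => _ [c _ <-]; exact: normHs_ge0. Qed.

Theorem theorem3p4 (R : realType) (n : nat) (n_gt0 : (0 < n)%N)
    (Oh : set 'cV[R]_n) (domOh : lipschitz_domain Oh)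
    (s : R) (s_gt0 : 0 < s) (s_lt1 : s < 1)
    (k K CI : R) (k_gt0 : 0 < k) (K_gt0 : 0 < K) (CI_gt0 : 0 < CI)
    (kE : forall w, Hs s Oh w -> (k%:E * normI s Oh w <= normHs s Oh w)%E)
    (KE : forall w, Hs s Oh w -> (normHs s Oh w <= K%:E * normI s Oh w)%E)
    (CIE : forall w, Hs s Oh w ->
      (normL2 Oh w <= CI%:E * (seminormI s Oh w + `|mass Oh w|))%E) :
  (forall (x0 : 'cV[R]_n) (B : 'M[R]_n), B \in unitmx ->
    let O := affine_map x0 B @` Oh in
    forall v, Hs s O v ->
    [/\ (* (i) *)
        (seminormHs s O v ^+ 2 <=
          (aspect O `^ (n%:R + 2 * s) * aspect Oh `^ (n%:R + 2 * s) *
           K ^+ 2 * (3 + CI ^+ 2 / (s * (1 - s))))%:E * seminormI s O v ^+ 2)%E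
        /\
        (seminormI s O v ^+ 2 <=
          (aspect O `^ (n%:R + 2 * s) * aspect Oh `^ (n%:R + 2 * s) *
           k ^- 2 * (1 + CPF_SS s Oh ^+ 2))%:E * seminormHs s O v ^+ 2)%E,
        (* (ii) *)
        (seminormHs s O v <= seminormHs_inf s O v)%E /\
        (seminormHs_inf s O v ^+ 2 <=
          (1 + diam O `^ (2 * s) / diam Oh `^ (2 * s) *
               aspect O `^ n%:R * aspect Oh `^ (n%:R + 2 * s) *
               CPF_SS s Oh ^+ 2)%:E * seminormHs s O v ^+ 2)%E,
        (* (iii) a) *)
        (seminormI s O v ^+ 2 <=
          (Num.max (aspect O `^ n%:R * aspect Oh `^ (n%:R + 2 * s))
                   (diam O `^ (- (2 * s)) * diam Oh `^ (2 * s)) *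
           aspect O `^ (2 * s) * k ^- 2)%:E * seminormHs_inf s O v ^+ 2)%E &
        (* (iii) b) *)
        (seminormHs_inf s O v ^+ 2 <=
          (Num.max (aspect O `^ (n%:R + 2 * s) * aspect Oh `^ n%:R)
                   (diam O `^ (2 * s) * diam Oh `^ (- (2 * s))) *
           aspect Oh `^ (2 * s) *
           K ^+ 2 * (3 + CI ^+ 2 / (s * (1 - s))))%:E *
          seminormI s O v ^+ 2)%E]) /\
  (forall (I : Type) (x0 : I -> 'cV[R]_n) (B : I -> 'M[R]_n),
    (forall i, B i \in unitmx) ->
    let O := fun i => affine_map (x0 i) (B i) @` Oh in
    shape_regular O ->
    [/\ uniformly_equivalent s O seminormHs seminormI,
        diam_bounded O -> uniformly_equivalent s O seminormHs seminormHs_inf,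
        diam_bounded_below O ->
          uniformly_bounded_by s O seminormI seminormHs_inf &
        diam_bounded O ->
          uniformly_bounded_by s O seminormHs_inf seminormI]).
Proof.
have dOh := lipschitz_bounded_open domOh.
have est (x0 : 'cV[R]_n) (B : 'M[R]_n) (Bu : B \in unitmx) v
    (Hv : Hs s (affine_map x0 B @` Oh) v) :=
  affine_estimates n_gt0 dOh s_gt0 s_lt1 k_gt0 K_gt0 CI_gt0 kE KE CIE Bu Hv.
split; first by move=> x0 B Bu O v Hv; exact: est.
move=> I x0 B Bu O [r Or].
have dO i : bounded_open (O i) by exact: bounded_open_image.
have a0 i : 0 <= aspect (O i).
  by rewrite divr_ge0// ltW ?(diam_gt0 n_gt0 (dO i))// (indiam_gt0 n_gt0 (dO i)).
have D0 i : 0 < diam (O i) by exact: (diam_gt0 n_gt0 (dO i)).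
have n0 : 0 <= n%:R :> R by [].
have s20 : 0 <= 2 * s by rewrite mulr_ge0// ltW.
have p0 : 0 <= n%:R + 2 * s by rewrite addr_ge0.
have rn i := le_powR n0 (a0 i) (Or i).
have rs i := le_powR s20 (a0 i) (Or i).
have rp i := le_powR p0 (a0 i) (Or i).
set C := 3 + CI ^+ 2 / (s * (1 - s)) in est *.
have C0 : 0 <= C.
  have ss : 0 <= s * (1 - s) by rewrite mulr_ge0 ?subr_ge0 ?ltW.
  by rewrite /C addr_ge0 ?divr_ge0 ?sqr_ge0.
have k20 : 0 <= k ^- 2 by rewrite invr_ge0 sqr_ge0.
have K20 : 0 <= K ^+ 2 by exact: sqr_ge0.
have S20 : 0 <= CPF_SS s Oh ^+ 2 by exact: sqr_ge0.
clearbody C; move: (K ^+ 2) (k ^- 2) (CPF_SS s Oh ^+ 2) K20 k20 S20 est.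
move=> K2 k2 S2 K20 k20 S20 est.
split.
- split.
  + exists (r `^ (n%:R + 2 * s) * aspect Oh `^ (n%:R + 2 * s) * K2 * C + 1).
      by rewrite ltr_wpDl// !mulr_ge0 ?powR_ge0.
    move=> i v Hv; have [[h _] _ _ _] := est _ _ (Bu i) _ Hv.
    refine (lee_of_sqr (seminormHs_ge0 _ _ _) (seminormI_ge0 _ _ _) h _ _).
      by rewrite !mulr_ge0 ?powR_ge0.
    by rewrite !ler_wpM2r ?powR_ge0 ?rp.
  + exists (r `^ (n%:R + 2 * s) * aspect Oh `^ (n%:R + 2 * s) * k2 *
        (1 + S2) + 1).
      by rewrite ltr_wpDl// !mulr_ge0 ?powR_ge0 ?addr_ge0.
    move=> i v Hv; have [[_ h] _ _ _] := est _ _ (Bu i) _ Hv.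
    refine (lee_of_sqr (seminormI_ge0 _ _ _) (seminormHs_ge0 _ _ _) h _ _).
      by rewrite !mulr_ge0 ?powR_ge0 ?addr_ge0.
    by rewrite !ler_wpM2r ?powR_ge0 ?addr_ge0 ?rp.
- move=> [D OD]; have Ds i := le_powR s20 (ltW (D0 i)) (OD i); split.
    exists 1; first exact: ltr01.
    move=> i v Hv; have [_ [h _] _ _] := est _ _ (Bu i) _ Hv.
    by rewrite [leRHS]mul1e; exact: h.
  exists (1 + D `^ (2 * s) / diam Oh `^ (2 * s) * r `^ n%:R *
      aspect Oh `^ (n%:R + 2 * s) * S2 + 1).
    by rewrite ltr_wpDl// addr_ge0// !mulr_ge0 ?invr_ge0 ?powR_ge0.
  move=> i v Hv; have [_ [_ h] _ _] := est _ _ (Bu i) _ Hv.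
  refine (lee_of_sqr (seminormHs_inf_ge0 _ _ _) (seminormHs_ge0 _ _ _) h _ _).
    by rewrite addr_ge0// !mulr_ge0 ?invr_ge0 ?powR_ge0.
  rewrite lerD2l !ler_wpM2r ?powR_ge0//.
  by rewrite ler_pM ?ler_wpM2r ?mulr_ge0 ?invr_ge0 ?powR_ge0 ?Ds ?rn.
- move=> [D Dgt0 OD]; have Ds i := le_powRN s20 Dgt0 (OD i).
  exists (Num.max (r `^ n%:R * aspect Oh `^ (n%:R + 2 * s))
      (D `^ (- (2 * s)) * diam Oh `^ (2 * s)) * r `^ (2 * s) * k2 + 1).
    by rewrite ltr_wpDl// !mulr_ge0 ?le_max ?mulr_ge0 ?powR_ge0.
  move=> i v Hv; have [_ _ h _] := est _ _ (Bu i) _ Hv.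
  refine (lee_of_sqr (seminormI_ge0 _ _ _) (seminormHs_inf_ge0 _ _ _) h _ _).
    by rewrite !mulr_ge0 ?le_max ?mulr_ge0 ?powR_ge0.
  rewrite ler_wpM2r//; apply: ler_pM; rewrite ?rs ?powR_ge0//.
    by rewrite le_max mulr_ge0 ?powR_ge0.
  by rewrite ge_max !le_max !ler_wpM2r ?powR_ge0 ?rp ?rn ?Ds ?orbT.
- move=> [D OD]; have Ds i := le_powR s20 (ltW (D0 i)) (OD i).
  exists (Num.max (r `^ (n%:R + 2 * s) * aspect Oh `^ n%:R)
      (D `^ (2 * s) * diam Oh `^ (- (2 * s))) *
      aspect Oh `^ (2 * s) * K2 * C + 1).
    by rewrite ltr_wpDl// !mulr_ge0 ?le_max ?mulr_ge0 ?powR_ge0.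
  move=> i v Hv; have [_ _ _ h] := est _ _ (Bu i) _ Hv.
  refine (lee_of_sqr (seminormHs_inf_ge0 _ _ _) (seminormI_ge0 _ _ _) h _ _).
    by rewrite !mulr_ge0 ?le_max ?mulr_ge0 ?powR_ge0.
  rewrite !ler_wpM2r ?powR_ge0//.
  by rewrite ge_max !le_max !ler_wpM2r ?powR_ge0 ?rp ?rn ?Ds ?orbT.
Qed.
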